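(* Consider the von Mises process $$d\theta_t=-\lambda\sin(\theta_t-\mu)\,dt+\sigma\,dW_t,\qquad t\in[0,T],$$ where $\lambda>0$, $\mu\in[0,2\pi)$ and $\sigma>0$. Let $\widehat\lambda,\widehat\mu,\widehat\sigma$ denote the maximum likelihood estimators of $\lambda,\mu,\sigma$ based on continuous observation of $\theta$ on $[0,T]$. Let $\Theta_\lambda\subset(0,\infty)$, $\Theta_\mu\subset[0,2\pi)$, $\Theta_\sigma\subset(0,\infty)$ be open parameter sets (open in $\mathbb{R}$), and let $K_\lambda\subset\Theta_\lambda$, $K_\mu\subset\Theta_\mu$, $K_\sigma\subset\Theta_\sigma$ be compact subsets. Then for every $\varepsilon>0$, $$\lim_{T\to\infty}\sup_{\lambda\in K_\lambda}\mathbb{P}_\lambda\left(|\widehat\lambda-\lambda|>\varepsilon\right)=0,$$ $$\lim_{T\to\infty}\sup_{\mu\in K_\mu}\mathbb{P}_\mu\left(|\widehat\mu-\mu|>\varepsilon\right)=0,$$ $$\lim_{T\to\infty}\sup_{\sigma\in K_\sigma}\mathbb{P}_\sigma\left(|\widehat\sigma-\sigma|>\varepsilon\right)=0.$$ That is, $(\widehat\lambda,\widehat\mu,\widehat\sigma)$ is uniformly consistent on compact subsets.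
   Context: $W$ is a standard Brownian motion, $\theta_0$ is an initial value independent of $W$, and the process on the circle is identified with its continuous lift to $\mathbb{R}$ in stochastic integrals with respect to $d\theta_t$. $\mathbb{P}_\lambda$ (respectively $\mathbb{P}_\mu$, $\mathbb{P}_\sigma$) is the law of the process when the true value of the indicated parameter is $\lambda$ (respectively $\mu$, $\sigma$), the two other true parameter values being fixed elements of their parameter sets. With $b(\theta;\lambda,\mu)=-\lambda\sin(\theta-\mu)$, the log-likelihood of $(\lambda,\mu)$ under continuous observation, for given $\sigma$ and up to an additive constant, is $$L_T(\lambda,\mu)=\frac{1}{\sigma^2}\int_0^T b(\theta_t;\lambda,\mu)\,d\theta_t-\frac{1}{2\sigma^2}\int_0^T b(\theta_t;\lambda,\mu)^2\,dt.$$ The maximum likelihood estimator $(\widehat\lambda,\widehat\mu)$ is a measurable function of the observed path that maximizes $L_T$ over the parameter set $\Theta_\lambda\times\Theta_\mu$ whenever a maximizer exists (an arbitrary measurable choice with values in the parameter set otherwise). The estimator of $\sigma$ is given by $\widehat\sigma^2=[\theta]_T/T$, where $[\theta]_T$ is the quadratic variation of $\theta$ on $[0,T]$. *)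

(* Defs.v *)
From HB Require Import structures.
From mathcomp Require Import all_boot all_order all_algebra.
From mathcomp Require Import all_classical all_reals all_analysis.
Set Implicit Arguments.
Unset Strict Implicit.
Unset Printing Implicit Defensive.
Import Order.TTheory GRing.Theory Num.Theory.
Import numFieldNormedType.Exports.
Local Open Scope classical_set_scope.
Local Open Scope ring_scope.

(* Processes are indexed by all of R, but only their values at times t >= 0
   are ever constrained or used. *)

Section brownian_motion.
Context {d : measure_display} {Omega : measurableType d} {R : realType}.
Variable P : probability Omega R.
Implicit Types (X W : R -> Omega -> R).

Definition independent_increments X : Prop :=
  forall (n : nat) (t : nat -> R) (B : nat -> set R),
    0 <= t 0%N -> (forall i, t i <= t i.+1) ->
    (forall i, measurable (B i)) ->
    P (\bigcap_(i < n) [set w | B i (X (t i.+1) w - X (t i) w)]) =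
    (\prod_(i < n) P [set w | B i (X (t i.+1) w - X (t i) w)%R])%E.

(* The second parameter of normal_prob is the standard deviation. *)
Definition is_brownian_motion W : Prop :=
  [/\ forall t, 0 <= t -> measurable_fun setT (W t),
      forall w, {within `[0, +oo[, continuous (fun t => W t w)},
      {ae P, forall w, W 0 w = 0},
      independent_increments W
    & forall s t, 0 <= s -> s < t -> forall B : set R, measurable B ->
        P [set w | B (W t w - W s w)] = normal_prob 0 (Num.sqrt (t - s)) B].

Definition generated_sigma_algebra X : set (set Omega) :=
  <<s [set A | exists t, exists B : set R,
         [/\ 0 <= t, measurable B & A = X t @^-1` B]] >>.

Definition independent_of_process (xi : Omega -> R) X : Prop :=
  forall (B : set R) (A : set Omega), measurable B ->
    generated_sigma_algebra X A ->
    P (xi @^-1` B `&` A) = (P (xi @^-1` B) * P A)%E.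

End brownian_motion.

Section stochastic_integral.
Context {d : measure_display} {Omega : measurableType d} {R : realType}.
Variable P : probability Omega R.
Implicit Types (X Y : R -> Omega -> R) (s : seq R).

(* A partition 0 = t_0 < t_1 < ... < t_n = T is represented, as in
   itv_partition, by the list s = [:: t_1; ...; t_n]; then t_i is
   nth 0 (0 :: s) i. *)
Definition partition_time s (i : nat) : R := nth 0 (0 :: s) i.

Definition mesh_lt s (h : R) : Prop :=
  forall i, (i < size s)%N -> partition_time s i.+1 - partition_time s i < h.

Definition limit_in_probability_of_partitions (T : R)
    (S : seq R -> Omega -> R) (I : Omega -> R) : Prop :=
  measurable_fun setT I /\
  forall e delta : R, 0 < e -> 0 < delta ->
    exists2 h, 0 < h & forall s, itv_partition 0 T s -> mesh_lt s h ->
      (P [set w | (e < `|S s w - I w|)%R] <= delta%:E)%E.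

(* For a continuous adapted integrand Y and a continuous semimartingale X, the
   Ito integral of Y against X over [0, T] is the limit in probability of the
   left-endpoint Riemann sums as the mesh tends to 0. *)
Definition is_ito_integral (T : R) Y X (I : Omega -> R) : Prop :=
  limit_in_probability_of_partitions T
    (fun s w => \sum_(i < size s) Y (partition_time s i) w *
       (X (partition_time s i.+1) w - X (partition_time s i) w)) I.

Definition is_quadratic_variation (T : R) X (Q : Omega -> R) : Prop :=
  limit_in_probability_of_partitions T
    (fun s w => \sum_(i < size s)
       (X (partition_time s i.+1) w - X (partition_time s i) w) ^+ 2) Q.

End stochastic_integral.

Section observed_path.
Context {R : realType}.

Definition path_space (T : R) : set (R -> R) :=
  [set x | {within `[0, T], continuous x}].

(* Measurability with respect to the sigma-algebra generated, on the continuous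
   paths, by the evaluations at times in [0, T]. In particular the value of a
   path-measurable function depends only on the path on [0, T]. *)
Definition path_measurable (T : R) (F : (R -> R) -> R) : Prop :=
  forall B : set R, measurable B ->
    <<s path_space T,
      [set A | exists t, exists C : set R,
         [/\ t \in `[0, T], measurable C &
             A = path_space T `&` [set x | C (x t)]]] >>
      (path_space T `&` F @^-1` B).

End observed_path.

Section von_mises.
Context {d : measure_display} {Omega : measurableType d} {R : realType}.
Variable P : probability Omega R.
Implicit Types (lam mu sigma T : R) (x : R -> R) (theta : R -> Omega -> R).

Definition drift lam mu (y : R) : R := - lam * sin (y - mu).

(* theta is the continuous lift to R of the process on the circle. *)
Definition is_von_mises_process (W : R -> Omega -> R) lam mu sigma theta :
    Prop :=
  [/\ forall t, 0 <= t -> measurable_fun setT (theta t),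
      forall w, {within `[0, +oo[, continuous (fun t => theta t w)},
      independent_of_process P (theta 0) W
    & {ae P, forall w, forall t, 0 <= t ->
        theta t w = theta 0 w +
          \int[lebesgue_measure]_(s in `[0, t]) drift lam mu (theta s w) +
          sigma * W t w}].

(* The log-likelihood at the path x, where J lam mu x stands for the stochastic
   integral of drift lam mu (x t) against d x t over [0, T]. *)
Definition log_likelihood sigma T (J : R -> R -> (R -> R) -> R) lam mu x : R :=
  (sigma ^+ 2)^-1 * J lam mu x -
  (2 * sigma ^+ 2)^-1 *
    \int[lebesgue_measure]_(t in `[0, T]) drift lam mu (x t) ^+ 2.

(* J is a version, as a functional of the path on [0, T], of the stochastic
   integrals of the drifts. Each of them is determined only almost surely, so
   to maximize over uncountably many (lam, mu) one takes the version that is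
   continuous in (lam, mu). The process family Theta is indexed by the true
   value of (lam, mu). *)
Definition is_drift_integral T (Lam Mu : set R)
    (Theta : R -> R -> R -> Omega -> R) (J : R -> R -> (R -> R) -> R) : Prop :=
  [/\ forall lam mu, Lam lam -> Mu mu -> path_measurable T (J lam mu),
      forall lam0 mu0 lam mu, Lam lam0 -> Mu mu0 -> Lam lam -> Mu mu ->
        is_ito_integral P T
          (fun t w => drift lam mu (Theta lam0 mu0 t w)) (Theta lam0 mu0)
          (fun w => J lam mu (fun t => Theta lam0 mu0 t w))
    & forall x, path_space T x ->
        {within Lam `*` Mu, continuous (fun p : R * R => J p.1 p.2 x)}].

Definition is_maximizer (Lam Mu : set R) (L : R -> R -> R) lam mu : Prop :=
  [/\ Lam lam, Mu mu &
      forall lam' mu', Lam lam' -> Mu mu' -> L lam' mu' <= L lam mu].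

Definition is_mle sigma T (Lam Mu : set R)
    (Theta : R -> R -> R -> Omega -> R) (lamhat muhat : (R -> R) -> R) : Prop :=
  [/\ path_measurable T lamhat, path_measurable T muhat,
      forall x, path_space T x -> Lam (lamhat x) /\ Mu (muhat x)
    & exists2 J, is_drift_integral T Lam Mu Theta J &
        forall x, path_space T x ->
          (exists lam mu,
             is_maximizer Lam Mu (fun l m => log_likelihood sigma T J l m x)
               lam mu) ->
          is_maximizer Lam Mu (fun l m => log_likelihood sigma T J l m x)
            (lamhat x) (muhat x)].

(* The quadratic variation is likewise a single functional of the path, a
   version of it under every value of the parameter. *)
Definition is_sigma_estimator T (Lam Mu Sig : set R)
    (Theta : R -> R -> R -> R -> Omega -> R) (sighat : (R -> R) -> R) : Prop :=
  exists Q : (R -> R) -> R,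
    [/\ path_measurable T Q,
        forall lam mu sigma, Lam lam -> Mu mu -> Sig sigma ->
          is_quadratic_variation P T (Theta lam mu sigma)
            (fun w => Q (fun t => Theta lam mu sigma t w))
      & forall x, path_space T x -> sighat x = Num.sqrt (Q x / T)].

(* The real supremum, unlike ereal_sup, is 0 on the empty set; on a nonempty
   set of probabilities the two agree. *)
Definition sup_prob (K : set R) (E : R -> set Omega) : R :=
  sup [set fine (P (E k)) | k in K].

End von_mises.

(* Main.v *)
Require Import Defs.
From HB Require Import structures.
From mathcomp Require Import all_boot all_order all_algebra.
From mathcomp Require Import all_classical all_reals all_analysis.
From mathcomp Require Import measurable_realfun ring lra.
Set Implicit Arguments.
Unset Strict Implicit.
Unset Printing Implicit Defensive.
Import Order.TTheory GRing.Theory Num.Theory.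
Import numFieldNormedType.Exports.
Local Open Scope classical_set_scope.
Local Open Scope ring_scope.

(** With v(lam, mu) = (lam cos mu, lam sin mu) and e(y) = (- sin y, cos y) the
    drift is v . e(y), so the log-likelihood is quadratic in v: for the true
    parameter v0,
      sigma^2 (L(v) - L(v0)) = (v - v0) . M - 1/2 int ((v - v0) . e(theta_t))^2 dt,
    where M = sigma int e(theta_t) dW_t satisfies E |M|^2 <= C T. The Ito formula
    for cos 2 theta and sin 2 theta shows that theta cannot stay near two
    antipodal points: int (u . e(theta_t))^2 dt >= c T |u|^2 for all u, with
    probability tending to 1, where c depends only on sigma and an upper bound
    of lam. Hence, outside an event of probability O(1/T), L(v) < L(v0) for all
    parameters outside a small box around the true one, so a maximizer exists
    and all maximizers lie in the box. The estimator of sigma is a.s. exact,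
    since [theta]_T = sigma^2 T.

    Every stochastic integral is replaced by a sum over a uniform grid along the
    Euler scheme, whose steps are adapted to the initial value and the increments
    of W and which converges to theta path by path; bounds on probabilities pass
    to the limit by P (liminf A_n) <= liminf P (A_n). *)

(** * Moments of a centered normal variable *)

(** Nothing in the hypotheses makes [theta] adapted: it is tied to [W] only by an almost sure
    equation. Martingale arguments are therefore run on the Euler scheme, which is adapted by
    construction; since the noise is additive, the scheme converges by a deterministic Gronwall
    argument on each path where the equation holds. The doubled angle appears because (u . e(y))^2
    is affine in cos 2y and sin 2y. The Ito formula bounds the time integral of the generator
    applied to these bounded functions up to a martingale of size sqrt T, whereas near the zeros of
    u . e that generator stays away from 0. The rate 1/T is Chebyshev's: the score has variance of
    order T, while the threshold [eta] below which it is harmless is proportional to T. Uniformity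
    holds because, for given sigma, the constants depend on the true parameter only through an upper
    bound of lam and a margin [e] to the complement of the parameter sets. *)

Section gaussian_moments.
Context {d : measure_display} {T : measurableType d} {R : realType}.
Variables (P : probability T R) (X : T -> R) (s : R).
Hypotheses (s_gt0 : 0 < s) (mX : measurable_fun setT X).
Hypothesis X_normal : forall B : set R, measurable B ->
  P (X @^-1` B) = normal_prob 0 s B.

Let s_neq0 : s != 0. Proof. by rewrite gt_eqF. Qed.

Lemma ge0_integral_normal_law (f : R -> R) : measurable_fun setT f ->
  (forall x, 0 <= f x) ->
  (\int[P]_w (f (X w))%:E =
   \int[lebesgue_measure]_x (f x * normal_pdf 0 s x)%:E)%E.
Proof.
move=> mf f0.
have mfE : measurable_fun setT (fun x : measurableTypeR R => (f x)%:E) by exact/measurable_EFinP.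
rewrite -(@ge0_integral_pushforward _ _ _ (measurableTypeR R) _ X mX P setT (fun x => (f x)%:E) measurableT)//=; last first.
  by move=> x _; rewrite lee_fin.
rewrite (eq_measure_integral (normal_prob 0 s)); last first.
  by move=> A mA _; rewrite /= /pushforward X_normal.
rewrite -(Radon_Nikodym_SigmaFinite.change_of_variables (@normal_prob_dominates R 0 s))//.
apply: ge0_ae_eq_integral => //.
- apply: emeasurable_funM => //; apply: (measurable_int lebesgue_measure).
  by apply: Radon_Nikodym_SigmaFinite.f_integrable; exact: normal_prob_dominates.
- apply/measurable_EFinP; apply: measurable_funM => //.
  exact: measurable_normal_pdf.
- move=> x _; rewrite mule_ge0 ?lee_fin//.
  by apply: Radon_Nikodym_SigmaFinite.f_ge0; exact: normal_prob_dominates.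
- by move=> x _; rewrite lee_fin mulr_ge0// normal_pdf_ge0.
- rewrite (_ : (fun x => (f x * normal_pdf 0 s x)%:E) =
    (fun x => (f x)%:E * (normal_pdf 0 s x)%:E)%E)//.
  (* The Radon-Nikodym derivative is determined up to null sets; it agrees almost everywhere with
     [normal_pdf] because both have the same integral over every measurable set. *)
  apply: ae_eqe_mul2l => /=.
  apply: integral_ae_eq => //=.
  + by apply: Radon_Nikodym_SigmaFinite.f_integrable; exact: normal_prob_dominates.
  + by apply/measurable_EFinP; exact: measurable_normal_pdf.
  + move=> E _ mE.
    by rewrite -Radon_Nikodym_SigmaFinite.f_integral//; exact: normal_prob_dominates.
Qed.

(** Multiplied by this exponential, the density of deviation s becomes r^-1 times the density of
    deviation s / r. Parametrizing by [r] keeps square roots out of the value. *)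
Lemma normal_law_expR_sqr (r : R) : 0 < r ->
  (\int[P]_w (expR ((1 - r ^+ 2) / (2 * s ^+ 2) * X w ^+ 2))%:E = (r^-1)%:E)%E.
Proof.
move=> r0.
rewrite (ge0_integral_normal_law
  (f := fun x => expR ((1 - r ^+ 2) / (2 * s ^+ 2) * x ^+ 2))); last 2 first.
- by apply: measurableT_comp => //; apply: measurable_funM => //; exact: exprn_measurable.
- by move=> x; exact: expR_ge0.
have sr0 : s / r != 0 by rewrite gt_eqF// divr_gt0.
under eq_integral => x _.
  rewrite (_ : _ * _ = r^-1 * normal_pdf 0 (s / r) x); last first.
    rewrite !normal_pdfE// /normal_peak /normal_fun !subr0.
    rewrite mulrCA -expRD (mulrA r^-1) -invfM; congr (_^-1 * expR _); last first.
      by field; rewrite !gt_eqF.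
    rewrite -[X in _ = X * _](ger0_norm (ltW r0)) -sqrtr_sqr -sqrtrM ?sqr_ge0//.
    by congr Num.sqrt; field; rewrite gt_eqF.
  rewrite EFinM.
  over.
rewrite ge0_integralZl//=.
- by rewrite integral_normal_pdf mule1.
- by apply/measurable_EFinP; exact: measurable_normal_pdf.
- by move=> x _; rewrite lee_fin normal_pdf_ge0.
- by rewrite lee_fin invr_ge0 ltW.
Qed.

(** Completing the square tilts the density into a multiple of the normal density with mean t
    s^2. *)
Lemma normal_law_expR (t : R) :
  (\int[P]_w (expR (t * X w))%:E = (expR (t ^+ 2 * s ^+ 2 / 2))%:E)%E.
Proof.
rewrite (ge0_integral_normal_law (f := fun x => expR (t * x))); last 2 first.
- by apply: measurableT_comp => //; exact: measurable_funM.
- by move=> x; exact: expR_ge0.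
under eq_integral => x _.
  rewrite (_ : _ * _ = expR (t ^+ 2 * s ^+ 2 / 2) *
      normal_pdf (t * s ^+ 2) s x); last first.
    rewrite !normal_pdfE// /normal_fun !subr0 !(mulrCA _ (normal_peak s)) -!expRD.
    by congr (_ * expR _); field; rewrite gt_eqF.
  rewrite EFinM.
  over.
rewrite ge0_integralZl//=.
- by rewrite integral_normal_pdf mule1.
- by apply/measurable_EFinP; exact: measurable_normal_pdf.
- by move=> x _; rewrite lee_fin normal_pdf_ge0.
Qed.

Lemma le_integral_EFin (f g : T -> R) :
  measurable_fun setT f -> measurable_fun setT g ->
  (forall w, 0 <= f w) -> (forall w, f w <= g w) ->
  (\int[P]_w (f w)%:E <= \int[P]_w (g w)%:E)%E.
Proof.
move=> mf mg f0 fg; apply: ge0_le_integral => //.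
- by move=> w _; rewrite lee_fin.
- exact/measurable_EFinP.
- exact/measurable_EFinP.
- by move=> w _; rewrite lee_fin.
Qed.

Let mXn n : measurable_fun setT (fun w => X w ^+ n).
Proof. exact: measurable_funX. Qed.

Let m_expR_sqr c : measurable_fun setT (fun w => expR (c * X w ^+ 2)).
Proof. by apply: measurableT_comp => //; exact: measurable_funM. Qed.

(* The second moment is squeezed by 1 + y <= expR y, taken at
   y = (1 - r ^+ 2) X ^+ 2 / (2 s ^+ 2) with r -> 1 from either side. *)
Lemma normal_law_moment2_ub (r : R) : 0 < r < 1 ->
  (\int[P]_w (X w ^+ 2)%:E <= (2 * s ^+ 2 / (r * (1 + r)))%:E)%E.
Proof.
move=> /andP[r0 r1]; pose c := (1 - r ^+ 2) / (2 * s ^+ 2).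
have c0 : 0 < c.
  by rewrite divr_gt0// ?subr_gt0 ?expr_lt1// ?mulr_gt0// ?exprn_gt0// ltW.
have : (\int[P]_w (1 + c * X w ^+ 2)%:E <= (r^-1)%:E)%E.
  rewrite -(normal_law_expR_sqr r0); apply: le_integral_EFin => //.
  - by apply: measurable_funD => //; exact: measurable_funM.
  - by move=> w; rewrite addr_ge0// mulr_ge0 ?sqr_ge0// ltW.
  - by move=> w; exact: expR_ge1Dx.
under eq_integral do rewrite EFinD EFinM.
rewrite ge0_integralD//=; last 2 first.
- by move=> w _; rewrite -EFinM lee_fin mulr_ge0 ?sqr_ge0// ltW.
- by apply/measurable_EFinP; exact: measurable_funM.
rewrite integral_cst//= probability_setT mule1 ge0_integralZl//=; last 3 first.
- exact/measurable_EFinP.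
- by move=> w _; rewrite lee_fin sqr_ge0.
- by rewrite lee_fin ltW.
rewrite -leeBrDl// -EFinB muleC -lee_pdivlMr// => /le_trans; apply.
rewrite -EFinM lee_fin le_eqVlt; apply/orP; left; apply/eqP.
have r_neq0 : r != 0 by rewrite gt_eqF.
have r1_neq0 : 1 + r != 0 by rewrite gt_eqF// addr_gt0.
have r2_neq0 : 1 - r ^+ 2 != 0 by rewrite gt_eqF// subr_gt0 expr_lt1// ltW.
by rewrite /c; field; rewrite r2_neq0 r1_neq0 r_neq0 s_neq0.
Qed.

Lemma normal_law_moment2_lb (r : R) : 1 < r ->
  ((2 * s ^+ 2 / (r * (1 + r)))%:E <= \int[P]_w (X w ^+ 2)%:E)%E.
Proof.
move=> r1; have r0 : 0 < r by rewrite (lt_trans _ r1).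
pose c := (r ^+ 2 - 1) / (2 * s ^+ 2).
have c0 : 0 < c.
  by rewrite divr_gt0// ?subr_gt0 ?exprn_egt1// ?mulr_gt0// exprn_gt0.
(* The exponent is now -c X^2; moving c X^2 to the right keeps all integrands nonnegative. *)
have : (\int[P]_w 1%:E <=
    \int[P]_w (expR ((1 - r ^+ 2) / (2 * s ^+ 2) * X w ^+ 2) + c * X w ^+ 2)%:E)%E.
  apply: le_integral_EFin => //.
  - by apply: measurable_funD => //; exact: measurable_funM.
  - move=> w; rewrite -lerBlDr (le_trans _ (expR_ge1Dx _))// lerD2l.
    by rewrite -mulNr -mulNr opprB.
under [X in (_ <= X)%E]eq_integral do rewrite EFinD EFinM.
rewrite ge0_integralD//=; last 3 first.
- exact/measurable_EFinP.
- by move=> w _; rewrite -EFinM lee_fin mulr_ge0 ?sqr_ge0// ltW.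
- by apply/measurable_EFinP; exact: measurable_funM.
rewrite integral_cst//= probability_setT mule1 ge0_integralZl//=; last 3 first.
- exact/measurable_EFinP.
- by move=> w _; rewrite lee_fin sqr_ge0.
- by rewrite lee_fin ltW.
rewrite normal_law_expR_sqr// -leeBlDl// -EFinB muleC -lee_pdivrMr//.
apply: le_trans.
rewrite -EFinM lee_fin le_eqVlt; apply/orP; left; apply/eqP.
have r_neq0 : r != 0 by rewrite gt_eqF.
have r1_neq0 : 1 + r != 0 by rewrite gt_eqF// addr_gt0.
have r2_neq0 : r ^+ 2 - 1 != 0 by rewrite gt_eqF// subr_gt0 exprn_egt1.
by rewrite /c; field; rewrite r2_neq0 r1_neq0 r_neq0 s_neq0.
Qed.

(** Passage to the limit e -> 0 under an error linear in e. The restriction e < 1 leaves room for r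
    = 1 - e in the moment bound. *)
Lemma ler_addM_small (x y C : R) : 0 <= C ->
  (forall e, 0 < e -> e < 1 -> x <= y + e * C) -> x <= y.
Proof.
move=> C0 H; apply/ler_addgt0Pr => e e0.
have e1 : 0 < Num.min (1 / 2) (e / (C + 1)).
  by rewrite lt_min divr_gt0//= divr_gt0// ltr_wpDl.
have e2 : Num.min (1 / 2) (e / (C + 1)) < 1 by rewrite gt_min; apply/orP; left; lra.
apply: (le_trans (H _ e1 e2)); rewrite lerD2l.
apply: (@le_trans _ _ (e / (C + 1) * (C + 1))); last by rewrite divfK// gt_eqF// ltr_wpDl.
apply: ler_pM => //; first exact: ltW.
  by rewrite ge_min lexx orbT.
by rewrite lerDl.
Qed.

Lemma normal_law_moment2 : (\int[P]_w (X w ^+ 2)%:E = (s ^+ 2)%:E)%E.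
Proof.
have s2 : 0 < s ^+ 2 by rewrite exprn_gt0.
have m0 : (0 <= \int[P]_w (X w ^+ 2)%:E)%E.
  by apply: integral_ge0 => w _; rewrite lee_fin sqr_ge0.
have ub := normal_law_moment2_ub; have lb := normal_law_moment2_lb.
(* The upper bound at r = 1/2 rules out an infinite second moment, so the integral is a real number
   [m]. *)
have h12 : 0 < (1 / 2 : R) < 1 by apply/andP; split; lra.
have := ub _ h12.
case E : (\int[P]_w (X w ^+ 2)%:E)%E m0 ub lb => [m| |]//.
rewrite lee_fin => m0 ub lb _; congr EFin; apply/eqP; rewrite eq_le; apply/andP; split.
- apply: (@ler_addM_small _ _ (2 * m)) => [|e e0 e1]; first by rewrite mulr_ge0.
  have r01 : 0 < 1 - e < 1 by apply/andP; split; lra.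
  have := ub _ r01; rewrite lee_fin ler_pdivlMr; last by rewrite mulr_gt0//; lra.
  have em0 : 0 <= e * m by rewrite mulr_ge0// ltW.
  have : 0 <= e * (e * m) by rewrite mulr_ge0// ltW.
  by have : e * (e * m) <= e * m; [rewrite ler_piMl// ltW|nra].
- apply: (@ler_addM_small _ _ (3 * m)) => [|e e0 e1]; first by rewrite mulr_ge0.
  have r01 : 1 < 1 + e by lra.
  have := lb _ r01; rewrite lee_fin ler_pdivrMr; last by rewrite mulr_gt0//; lra.
  have em0 : 0 <= e * m by rewrite mulr_ge0// ltW.
  have : 0 <= e * (e * m) by rewrite mulr_ge0// ltW.
  by have : e * (e * m) <= e * m; [rewrite ler_piMl// ltW|nra].
Qed.

(** Only the order s^4 matters: y^2 / 2 <= expR y at y = 3 X^2 / (8 s^2), the exponent for r = 1/2,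
    gives the constant 256 / 9 <= 29. *)
Lemma normal_law_moment4 : (\int[P]_w (X w ^+ 4)%:E <= (29 * s ^+ 4)%:E)%E.
Proof.
pose c := (1 - (1 / 2) ^+ 2) / (2 * s ^+ 2).
have c0 : 0 < c by rewrite divr_gt0// ?mulr_gt0// ?exprn_gt0//; lra.
have s4 : 0 < s ^+ 4 by rewrite exprn_gt0.
have : (\int[P]_w (c ^+ 2 / 2 * X w ^+ 4)%:E <= ((1 / 2)^-1)%:E)%E.
  rewrite -(@normal_law_expR_sqr (1 / 2))//; apply: le_integral_EFin => //.
  - exact: measurable_funM.
  - by move=> w; rewrite mulr_ge0 ?divr_ge0 ?sqr_ge0// exprn_even_ge0.
  - move=> w; have := @expR_ge1Dxn _ (c * X w ^+ 2) 1 (mulr_ge0 (ltW c0) (sqr_ge0 _)).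
    rewrite -/c; apply: le_trans.
    rewrite (_ : 2`! = 2)%N//; have := sqr_ge0 (c * X w ^+ 2); nra.
under eq_integral do rewrite EFinM.
rewrite ge0_integralZl//=; last 3 first.
- exact/measurable_EFinP.
- by move=> w _; rewrite lee_fin exprn_even_ge0.
- by rewrite lee_fin divr_ge0// sqr_ge0.
rewrite muleC -lee_pdivlMr// ?divr_gt0 ?exprn_gt0// => /le_trans; apply.
rewrite -EFinM lee_fin (_ : _ / _ = 256 / 9 * s ^+ 4); first by nra.
by rewrite /c; field.
Qed.

Lemma normal_law_integrable2 : P.-integrable setT (fun w => (X w ^+ 2)%:E).
Proof.
apply/integrableP; split; first exact/measurable_EFinP.
under eq_integral do rewrite /= ger0_norm ?sqr_ge0//.
by rewrite normal_law_moment2 ltry.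
Qed.

Lemma normal_law_integrable4 : P.-integrable setT (fun w => (X w ^+ 4)%:E).
Proof.
apply/integrableP; split; first exact/measurable_EFinP.
under eq_integral do rewrite /= ger0_norm ?exprn_even_ge0//.
by rewrite (le_lt_trans normal_law_moment4)// ltry.
Qed.

Lemma normal_law_integrable1 : P.-integrable setT (fun w => (X w)%:E).
Proof.
have : P.-integrable setT (fun w => (1 + X w ^+ 2)%:E).
  under eq_fun do rewrite EFinD.
  apply: integrableD => //; last exact: normal_law_integrable2.
  exact: finite_measure_integrable_cst.
apply: le_integrable => //; first exact/measurable_EFinP.
move=> w _ /=; rewrite lee_fin [leRHS]ger0_norm; last by rewrite addr_ge0 ?sqr_ge0.
by rewrite ler_norml; apply/andP; split; nra.
Qed.

(** The Laplace transform gives 1 + t m <= expR (t^2 s^2 / 2) for every t, so t m is at most of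
    order t^2; small t of either sign forces m = 0. *)
Lemma normal_law_mean : (\int[P]_w (X w)%:E = 0)%E.
Proof.
have iX := normal_law_integrable1.
have : (\int[P]_w (X w)%:E)%E \is a fin_num by exact: integrable_fin_num.
case E : (\int[P]_w (X w)%:E)%E => [m| |]// _.
have key t : 1 + t * m <= expR (t ^+ 2 * s ^+ 2 / 2).
  have iexp : P.-integrable setT (fun w => (expR (t * X w))%:E).
    apply/integrableP; split.
      apply/measurable_EFinP; apply: measurableT_comp => //.
      exact: measurable_funM.
    under eq_integral do rewrite /= ger0_norm ?expR_ge0//.
    by rewrite normal_law_expR ltry.
  have itX : P.-integrable setT (fun w => t%:E * (X w)%:E)%E by exact: integrableZl.
  rewrite -lee_fin -normal_law_expR EFinD EFinM -E -integralZl//.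
  have -> : (1%:E = \int[P]_w (cst 1%:E w))%E.
    by rewrite integral_cst//= probability_setT mule1.
  rewrite -integralD//=; last exact: finite_measure_integrable_cst.
  apply: le_integral => //=.
    by apply: integrableD => //; exact: finite_measure_integrable_cst.
  by move=> w _; rewrite -EFinM -EFinD lee_fin expR_ge1Dx.
have s2 : 0 < s ^+ 2 by rewrite exprn_gt0.
have expb (y : R) : 0 <= y -> y <= 1 / 2 -> expR y <= 1 + 2 * y.
  move=> y0 y1; have := expR_ge1Dx (- y); rewrite expRN => h.
  have : (1 - y) * expR y <= 1.
    by rewrite -ler_pdivlMr ?expR_gt0// div1r.
  have := expR_gt0 y; nra.
have {}key t : t ^+ 2 * s ^+ 2 <= 1 -> t * m <= t ^+ 2 * s ^+ 2.
  move=> h; have h0 : 0 <= t ^+ 2 * s ^+ 2 by rewrite mulr_ge0// sqr_ge0.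
  have h1 : 0 <= t ^+ 2 * s ^+ 2 / 2 by lra.
  have h2 : t ^+ 2 * s ^+ 2 / 2 <= 1 / 2 by lra.
  by have := key t; have := expb _ h1 h2; lra.
have small e : 0 < e -> e < 1 -> (e / s) ^+ 2 * s ^+ 2 <= 1.
  by move=> e0 e1; rewrite exprMn exprVn mulfVK ?expf_neq0//; nra.
congr EFin; apply/eqP; rewrite eq_le; apply/andP; split.
- apply: (@ler_addM_small _ _ s (ltW s_gt0)) => e e0 e1.
  have := key _ (small _ e0 e1); rewrite exprMn exprVn mulfVK ?expf_neq0//.
  rewrite add0r mulrAC ler_pdivrMr// expr2 -!mulrA ler_pM2l//.
- apply: (@ler_addM_small _ _ s (ltW s_gt0)) => e e0 e1.
  have := key (- (e / s)); rewrite sqrrN => /(_ (small _ e0 e1)).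
  rewrite exprMn exprVn mulfVK ?expf_neq0// mulNr lerNl.
  rewrite mulrAC ler_pdivlMr// expr2 -mulrN -mulrA ler_pM2l//.
  lra.
Qed.

End gaussian_moments.

(** * Independence and sums of martingale differences *)

Section independence.
Context {d : measure_display} {T : measurableType d} {R : realType}.
Variable P : probability T R.

(** The law of (X, Y) is the product of the two laws, since rectangles determine a product measure;
    by Fubini the inner integral is then x E Y = 0. *)
Lemma integralM_indep_eq0 (X Y : T -> R) :
  measurable_fun setT X -> measurable_fun setT Y ->
  (forall A B : set R, measurable A -> measurable B ->
    P (X @^-1` A `&` Y @^-1` B) = (P (X @^-1` A) * P (Y @^-1` B))%E) ->
  P.-integrable setT (fun w => (Y w)%:E) ->
  P.-integrable setT (fun w => (X w * Y w)%:E) ->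
  (\int[P]_w (Y w)%:E = 0)%E ->
  (\int[P]_w (X w * Y w)%:E = 0)%E.
Proof.
move=> mX mY indep iY iXY EY0.
pose X' : {mfun T >-> R} := mfun_Sub (mem_set mX).
pose Y' : {mfun T >-> R} := mfun_Sub (mem_set mY).
pose m1 := distribution P X'; pose m2 := distribution P Y'.
pose Z w := (X w, Y w).
have mZ : measurable_fun setT Z by exact: measurable_fun_pair.
pose Z' : {mfun T >-> _} := mfun_Sub (mem_set mZ).
pose m := distribution P Z'.
pose f (p : R * R) : \bar R := (p.1 * p.2)%:E.
have mf : measurable_fun setT f.
  apply/measurable_EFinP; apply: measurable_funM; first exact: measurable_fst.
  exact: measurable_snd.
have mE A : measurable A -> (m1 \x m2)%E A = m A.
  apply: product_measure_unique => B C mB mC.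
  by rewrite /m1 /m2 /m /distribution /pushforward -indep.
have iE : (\int[P]_w (X w * Y w)%:E = \int[m1 \x m2]_z f z)%E.
  rewrite (eq_measure_integral m); last by move=> A mA _; exact: mE.
  by rewrite /m integral_distribution.
rewrite iE -integral12_prod_meas1; last first.
  apply/integrableP; split => //.
  rewrite (eq_measure_integral m); last by move=> A mA _; exact: mE.
  rewrite /m ge0_integral_distribution//; last first.
    by apply: measurableT_comp.
  by case/integrableP : iXY.
apply: integral0_eq => x _; rewrite /fubini_F /f /=.
under eq_integral do rewrite EFinM.
have iY2 : (m2.-integrable setT (fun y : R => y%:E))%E.
  apply/integrableP; split; first exact/measurable_EFinP.
  rewrite /m2 ge0_integral_distribution//; last first.
    by apply: measurableT_comp => //; exact/measurable_EFinP.
  by case/integrableP : iY.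
rewrite integralZl//.
rewrite (_ : \int[m2]_y y%:E = 0)%E ?mule0//.
rewrite /m2 integral_distribution//; exact/measurable_EFinP.
Qed.

(** A filtration is recorded through generators, so that [G] may be a pi-system on which
    independence is checked directly. *)
Definition measurable_wrt (G : set (set T)) (X : T -> R) : Prop :=
  @measurable_fun _ _ (g_sigma_algebraType G) R setT X.

Lemma measurable_wrtW (G H : set (set T)) (X : T -> R) :
  G `<=` <<s H >> -> measurable_wrt G X -> measurable_wrt H X.
Proof.
move=> GH mX _ B mB.
exact: (smallest_sub (smallest_sigma_algebra setT H) GH (mX measurableT B mB)).
Qed.

Lemma measurable_wrt_fun (G : set (set T)) (X : T -> R) :
  G `<=` measurable -> measurable_wrt G X -> measurable_fun setT X.
Proof.
move=> GH mX _ B mB.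
exact: (smallest_sub (sigma_algebra_measurable T) GH (mX measurableT B mB)).
Qed.

(** Orthogonality of martingale differences: the partial sum times [f n] is measurable for [G n],
    hence independent of the centered [xi n], so the cross term of the square integrates to 0. The
    induction needs the measurability of the sum, which is why it is part of the conclusion. *)
Lemma integral_sqr_martingale_sum (G : nat -> set (set T)) (f xi : nat -> T -> R)
    (v : R) (n : nat) :
  (forall k, G k `<=` <<s G k.+1 >>) -> (forall k, G k `<=` measurable) ->
  (forall k, measurable_wrt (G k) (f k)) -> (forall k w, `|f k w| <= 1) ->
  (forall k, measurable_wrt (G k.+1) (xi k)) ->
  (forall k E B, <<s G k >> E -> measurable B ->
    P (E `&` xi k @^-1` B) = (P E * P (xi k @^-1` B))%E) ->
  (forall k, P.-integrable setT (fun w => (xi k w)%:E)) ->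
  (forall k, P.-integrable setT (fun w => (xi k w ^+ 2)%:E)) ->
  (forall k, \int[P]_w (xi k w)%:E = 0)%E ->
  (forall k, \int[P]_w (xi k w ^+ 2)%:E <= v%:E)%E ->
  let S w := \sum_(k < n) f k w * xi k w in
  [/\ measurable_wrt (G n) S, P.-integrable setT (fun w => (S w ^+ 2)%:E) &
      (\int[P]_w (S w ^+ 2)%:E <= (n%:R * v)%:E)%E].
Proof.
move=> Gmono Gmeas mf f1 mxi indep ixi ixi2 xi0 xi2.
have mf' k : measurable_fun setT (f k) by exact: measurable_wrt_fun (Gmeas k) (mf k).
have mxi' k : measurable_fun setT (xi k) by exact: measurable_wrt_fun (Gmeas k.+1) (mxi k).
elim: n => [|n [mS iS leS]] S.
  split.
  - rewrite (_ : S = fun=> 0); last by apply/funext => w; rewrite /S big_ord0.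
    exact: measurable_cst.
  - rewrite (_ : (fun w => (S w ^+ 2)%:E) = cst 0%E) ?integrable0//.
    by apply/funext => w; rewrite /S big_ord0 expr0n.
  - rewrite mul0r (_ : (fun w => (S w ^+ 2)%:E) = cst 0%E) ?integral0//.
    by apply/funext => w; rewrite /S big_ord0 expr0n.
pose S0 w := \sum_(k < n) f k w * xi k w.
have SE w : S w = S0 w + f n w * xi n w by rewrite /S big_ord_recr.
have mS0 : measurable_fun setT S0 by exact: measurable_wrt_fun (Gmeas n) mS.
have mSS : measurable_wrt (G n.+1) S.
  rewrite (_ : S = fun w => S0 w + f n w * xi n w); last exact/funext.
  have h1 : measurable_wrt (G n.+1) S0 := measurable_wrtW (Gmono n) mS.
  have h2 : measurable_wrt (G n.+1) (f n) := measurable_wrtW (Gmono n) (mf n).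
  exact: (measurable_funD h1 (measurable_funM h2 (mxi n))).
have ifxi2 : P.-integrable setT (fun w => ((f n w * xi n w) ^+ 2)%:E).
  apply: le_integrable (ixi2 n) => //.
    by apply/measurable_EFinP; apply: measurable_funX; exact: measurable_funM.
  move=> w _ /=; rewrite lee_fin !ger0_norm ?sqr_ge0// exprMn ler_piMl ?sqr_ge0//.
  by rewrite -real_normK ?num_real// expr_le1.
have icross : P.-integrable setT (fun w => ((S0 w * f n w) * xi n w)%:E).
  apply: (@le_integrable _ _ _ P _ _ _ (fun w => (S0 w ^+ 2)%:E + (xi n w ^+ 2)%:E)%E) => //.
  - apply/measurable_EFinP; apply: measurable_funM => //; exact: measurable_funM.
  - move=> w _ /=; rewrite lee_fin [leRHS]ger0_norm ?addr_ge0 ?sqr_ge0//.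
    rewrite !normrM.
    apply: (@le_trans _ _ (`|S0 w| * `|xi n w|)).
      by rewrite ler_wpM2r// ler_piMr.
    rewrite -[S0 w ^+ 2]real_normK ?num_real// -[xi n w ^+ 2]real_normK ?num_real//.
    have := normr_ge0 (S0 w); have := normr_ge0 (xi n w); nra.
  - exact: integrableD.
have cross0 : (\int[P]_w ((S0 w * f n w) * xi n w)%:E = 0)%E.
  apply: integralM_indep_eq0 => //; first exact: measurable_funM.
  move=> A B mA mB; apply: indep => //.
  by rewrite -[X in <<s _ >> X]setTI; apply: (measurable_funM mS (mf n)).
have S2E : (fun w => (S w ^+ 2)%:E) = (fun w => (S0 w ^+ 2)%:E +
    (2%:E * ((S0 w * f n w) * xi n w)%:E + ((f n w * xi n w) ^+ 2)%:E))%E.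
  by apply/funext => w; rewrite SE -!EFinM -!EFinD; congr EFin; ring.
have icross2 : P.-integrable setT (fun w => 2%:E * ((S0 w * f n w) * xi n w)%:E)%E.
  exact: integrableZl.
have iR : P.-integrable setT (fun w =>
    (2%:E * ((S0 w * f n w) * xi n w)%:E + ((f n w * xi n w) ^+ 2)%:E))%E.
  exact: integrableD.
split => //.
- by rewrite S2E; exact: integrableD.
- rewrite S2E integralD// integralD// integralZl// cross0 mule0 add0e.
  rewrite -natr1 mulrDl mul1r EFinD leeD//.
  apply: le_trans (xi2 n); apply: le_integral => // w _.
  rewrite lee_fin exprMn ler_piMl ?sqr_ge0//.
  by rewrite -real_normK ?num_real// expr_le1.
Qed.

Lemma chebyshev_sqr (X : T -> R) (a C : R) : 0 < a ->
  measurable_fun setT X -> (\int[P]_w (X w ^+ 2)%:E <= C%:E)%E ->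
  (P [set w | (a < `|X w|)%R] <= (C / a ^+ 2)%:E)%E.
Proof.
move=> a0 mX XC; rewrite EFinM lee_pdivlMr ?exprn_gt0//.
apply: le_trans XC; rewrite muleC.
have mX2 : measurable_fun setT (fun w => (X w ^+ 2)%:E).
  by apply/measurable_EFinP; exact: measurable_funX.
have a20 : 0 < a ^+ 2 by rewrite exprn_gt0.
have := le_integral_abse P measurableT mX2 a20.
under [X in (_ <= X)%E -> _]eq_integral do rewrite /= ger0_norm ?sqr_ge0//.
apply: le_trans; rewrite setTI lee_wpmul2l ?lee_fin ?(ltW a20)//.
apply: le_measure; rewrite ?inE.
- rewrite (_ : [set _ | _] = setT `&` (fun w => `|X w|) @^-1` `]a, +oo[).
    by apply: measurableT_comp mX _ _ _ => //.
  by rewrite setTI; apply/seteqP; split => w /=; rewrite in_itv/= andbT.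
- rewrite (_ : [set _ | _] = setT `&` (fun w => (X w ^+ 2)) @^-1` `[a ^+ 2, +oo[).
    by apply: (measurable_funX 2 mX).
  rewrite setTI; apply/seteqP; split => w /=;
    by rewrite in_itv/= andbT lee_fin ger0_norm ?sqr_ge0.
- move=> w /= aX; rewrite lee_fin ger0_norm ?sqr_ge0//.
  by rewrite -[X w ^+ 2]real_normK ?num_real// ler_pXn2r ?nnegrE// ?ltW.
Qed.

End independence.

(** * Brownian increments on a uniform grid *)

(** Dynkin's pi-lambda argument: for fixed [D], the sets independent of [D] contain the pi-system
    and are closed under complements and countable disjoint unions. *)
Lemma indep_g_sigma_algebra {d : measure_display} {T : measurableType d}
    {R : realType} (P : probability T R) (G : set (set T)) (D : set T) :
  G `<=` measurable -> setI_closed G -> measurable D ->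
  (forall E, G E -> P (E `&` D) = (P E * P D)%E) ->
  forall E, <<s G >> E -> P (E `&` D) = (P E * P D)%E.
Proof.
move=> Gm GI mD GD.
have Gsub : <<s G >> `<=` measurable.
  exact: (smallest_sub (sigma_algebra_measurable T) Gm).
apply: (@dynkin_induction _ (g_sigma_algebraType G) G
  (fun E : set T => P (E `&` D) = (P E * P D)%E)) => //.
- by rewrite setTI probability_setT mul1e.
- move=> S /Gsub mS SE.
  rewrite probability_setC// muleBl ?fin_num_measure// mul1e -SE.
  rewrite [~` S `&` D]setIC -setDE measureD//; first by rewrite setIC.
  by rewrite -ge0_fin_numE// fin_num_measure.
- move=> F mF tF FD.
  have mF' n : d.-measurable (F n) := Gsub _ (mF n).
  rewrite setI_bigcupl measure_semi_bigcup; last 3 first.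
  + by move=> n; exact: measurableI.
  + exact: trivIset_setIr.
  + by apply: bigcupT_measurable => n; exact: measurableI.
  rewrite (measure_semi_bigcup P mF' tF); last exact: bigcupT_measurable.
  rewrite (_ : (\sum_(i <oo) P (F i `&` D) = \sum_(i <oo) (P D * P (F i)))%E); last first.
    by apply: eq_eseriesr => n _; rewrite FD muleC.
  rewrite [RHS]muleC -(@fineK _ (P D)) ?fin_num_measure//.
  by rewrite nneseriesZl.
Qed.

Section brownian_grid.
Context {d : measure_display} {T : measurableType d} {R : realType}.
Variables (P : probability T R) (W : R -> T -> R) (xi : T -> R) (h : R).
Hypotheses (BM : is_brownian_motion P W) (mxi : measurable_fun setT xi).
Hypotheses (xi_indep : independent_of_process P xi W) (h_gt0 : 0 < h).

Definition grid_incr (k : nat) (w : T) : R := W (k.+1%:R * h) w - W (k%:R * h) w.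

(** A pi-system of cylinder sets, generating the sigma-algebra of the initial value and the first
    [k] increments. *)
Definition grid_past (k : nat) : set (set T) :=
  [set A | exists B0 B, [/\ measurable B0, forall i, measurable (B i) &
     A = xi @^-1` B0 `&` \bigcap_(i < k) grid_incr i @^-1` B i]].

Let grid_ge0 k : 0 <= k%:R * h.
Proof. by rewrite mulr_ge0// ltW. Qed.

Lemma measurable_grid_incr k : measurable_fun setT (grid_incr k).
Proof. by case: BM => mW _ _ _ _; apply: measurable_funB; exact: mW. Qed.

Let mpreW k (B : set R) : measurable B -> measurable (grid_incr k @^-1` B).
Proof. by move=> mB; rewrite -[_ @^-1` _]setTI; exact: measurable_grid_incr. Qed.

Let mprexi (B : set R) : measurable B -> measurable (xi @^-1` B).
Proof. by move=> mB; rewrite -[_ @^-1` _]setTI; exact: mxi. Qed.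

Lemma grid_past_measurable k : grid_past k `<=` measurable.
Proof.
move=> _ [B0 [B [mB0 mB ->]]]; apply: measurableI; first exact: mprexi.
by apply: bigcap_measurableType => i _; exact: mpreW.
Qed.

Lemma grid_past_setI k : setI_closed (grid_past k).
Proof.
move=> _ _ [B0 [B [mB0 mB ->]]] [C0 [C [mC0 mC ->]]].
exists (B0 `&` C0), (fun i => B i `&` C i); split.
- exact: measurableI.
- by move=> i; exact: measurableI.
- by rewrite setIACA -bigcapI.
Qed.

Lemma grid_past_mono k : grid_past k `<=` <<s grid_past k.+1 >>.
Proof.
move=> _ [B0 [B [mB0 mB ->]]]; apply: sub_sigma_algebra.
exists B0, (fun i => if (i < k)%N then B i else setT); split => //.
  by move=> i; case: ifPn.
congr (_ `&` _); apply/seteqP; split => w /= H i /=.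
  by move=> _; case: ifPn => //= ik; exact: H.
by move=> ik; have := H i (ltnW ik); rewrite /= ik.
Qed.

Lemma measurable_wrt_initial k : measurable_wrt (grid_past k) xi.
Proof.
move=> _ B mB; rewrite setTI; apply: sub_sigma_algebra.
exists B, (fun=> setT); split => //.
rewrite [X in _ `&` X](_ : _ = setT) ?setIT//.
by apply/seteqP; split.
Qed.

Lemma measurable_wrt_grid_incr k : measurable_wrt (grid_past k.+1) (grid_incr k).
Proof.
move=> _ B mB; rewrite setTI; apply: sub_sigma_algebra.
exists setT, (fun i => if i == k then B else setT); split => //.
  by move=> i; case: ifPn.
rewrite preimage_setT setTI; apply/seteqP; split => w /=.
  by move=> H i /= _; case: eqP => // ->.
by move=> /(_ k (ltnSn k)); rewrite /= eqxx.
Qed.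

(** On a cylinder set this is a computation: adjoining increment [k] gives a cylinder in [k.+1]
    increments, the initial value splits off by its independence from [W], and the increments
    factor. Dynkin's argument extends it to the generated sigma-algebra. *)
Lemma grid_incr_indep k (E : set T) (B : set R) :
  <<s grid_past k >> E -> measurable B ->
  P (E `&` grid_incr k @^-1` B) = (P E * P (grid_incr k @^-1` B))%E.
Proof.
move=> sE mB; apply: indep_g_sigma_algebra sE => //.
- exact: grid_past_measurable.
- exact: grid_past_setI.
- exact: mpreW.
move=> _ [B0 [C [mB0 mC ->]]].
have [_ _ _ incr _] := BM.
have gmW t : 0 <= t -> forall A, measurable A -> generated_sigma_algebra W (W t @^-1` A).
  by move=> t0 A mA; apply: sub_sigma_algebra; exists t, A.
have mW t : 0 <= t -> @measurable_fun _ _ (g_sigma_algebraType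
    [set A | exists t, exists B : set R,
         [/\ 0 <= t, measurable B & A = W t @^-1` B]]) R setT (W t).
  by move=> t0 _ A mA; rewrite setTI; exact: gmW.
have gincr i A : measurable A -> generated_sigma_algebra W (grid_incr i @^-1` A).
  move=> mA; rewrite -[_ @^-1` _]setTI.
  exact: (measurable_funB (mW _ (grid_ge0 i.+1)) (mW _ (grid_ge0 i))).
have gcap n (D : nat -> set R) : (forall i, measurable (D i)) ->
    generated_sigma_algebra W (\bigcap_(i < n) grid_incr i @^-1` D i).
  move=> mD; apply: (@bigcap_measurableType _ (g_sigma_algebraType
    [set A | exists t, exists B : set R,
         [/\ 0 <= t, measurable B & A = W t @^-1` B]])) => i _.
  exact: gincr.
have incrE n (D : nat -> set R) : (forall i, measurable (D i)) ->
    P (\bigcap_(i < n) grid_incr i @^-1` D i) =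
    (\prod_(i < n) P (grid_incr i @^-1` D i))%E.
  move=> mD; apply: (incr n (fun i => i%:R * h) D) => //.
  by move=> i; rewrite ler_pM2r// ler_nat.
rewrite -setIA.
have -> : \bigcap_(i < k) grid_incr i @^-1` C i `&` grid_incr k @^-1` B =
    \bigcap_(i < k.+1) grid_incr i @^-1` (if i == k then B else C i).
  apply/seteqP; split => w /=.
    move=> [H Hk] i /= ik; case: eqP => [->//|/eqP ik'].
    by apply: H => /=; rewrite ltn_neqAle ik' -ltnS.
  move=> H; split; last by have := H k (ltnSn k); rewrite /= eqxx.
  by move=> i /= ik; have := H i (ltnW ik); rewrite /= (ltn_eqF ik).
have mC' i : measurable (if i == k then B else C i) by case: ifPn.
rewrite !xi_indep//; last 2 first.
- exact: gcap.
- exact: gcap.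
rewrite !incrE// big_ord_recr/= eqxx muleA; congr (_ * _ * _)%E.
by apply: eq_bigr => i _; rewrite (ltn_eqF (ltn_ord i)).
Qed.

Lemma grid_incr_law k (B : set R) : measurable B ->
  P (grid_incr k @^-1` B) = normal_prob 0 (Num.sqrt h) B.
Proof.
move=> mB; have [_ _ _ _ law] := BM.
have ltk : k%:R * h < k.+1%:R * h by rewrite ltr_pM2r// ltr_nat.
have hE : k.+1%:R * h - k%:R * h = h by rewrite -natr1 mulrDl mul1r [X in X - _]addrC addrK.
by rewrite -[in RHS]hE -law.
Qed.

End brownian_grid.

Section grid_sums.
Context {d : measure_display} {T : measurableType d} {R : realType}.
Variables (P : probability T R) (W : R -> T -> R) (xi : T -> R) (h : R).
Hypotheses (BM : is_brownian_motion P W) (mxi : measurable_fun setT xi).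
Hypotheses (xi_indep : independent_of_process P xi W) (h_gt0 : 0 < h).
Local Notation dW := (grid_incr W h).
Local Notation past := (grid_past W xi h).

Let sh_gt0 : 0 < Num.sqrt h. Proof. by rewrite sqrtr_gt0. Qed.
Let sh2 : Num.sqrt h ^+ 2 = h. Proof. by rewrite sqr_sqrtr// ltW. Qed.
Let sh4 : Num.sqrt h ^+ 4 = h ^+ 2.
Proof. by rewrite (exprM _ 2 2) sh2. Qed.
Let mdW := measurable_grid_incr BM h_gt0.
Let ldW := grid_incr_law BM h_gt0.

Let past_m k : past k `<=` measurable := grid_past_measurable BM mxi h_gt0 (k := k).

Variable phi : nat -> T -> R.
Hypothesis phi_adapted : forall k, measurable_wrt (past k) (phi k).
Hypothesis phi_le1 : forall k w, `|phi k w| <= 1.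

(** Each increment has variance h, so the second moment is at most n h for any adapted integrand
    bounded by 1. *)
Lemma grid_sum_ub (n : nat) (a : R) : 0 < a ->
  measurable_fun setT (fun w => \sum_(k < n) phi k w * dW k w) /\
  (P [set w | (a < `|\sum_(k < n) phi k w * dW k w|)%R] <=
   (n%:R * h / a ^+ 2)%:E)%E.
Proof.
move=> a0.
have [| | | | | | | | | |mS _ leS] :=
    @integral_sqr_martingale_sum _ _ _ P past phi dW h n => //.
- by move=> k; exact: grid_past_mono.
- by move=> k; exact: measurable_wrt_grid_incr.
- by move=> k E B; exact: grid_incr_indep.
- by move=> k; exact: normal_law_integrable1 sh_gt0 (mdW k) (@ldW k).
- by move=> k; exact: normal_law_integrable2 sh_gt0 (mdW k) (@ldW k).
- by move=> k; exact: normal_law_mean sh_gt0 (mdW k) (@ldW k).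
- by move=> k; rewrite (normal_law_moment2 sh_gt0 (mdW k) (@ldW k)) sh2.
have mS' := measurable_wrt_fun (@past_m n) mS.
split => //; exact: chebyshev_sqr.
Qed.

(** The centered squares are again martingale differences, of variance at most 29 h^2. For n h = T
    the bound is of order T^2 / n and vanishes as the grid is refined. *)
Lemma grid_qv_sum_ub (n : nat) (a : R) : 0 < a ->
  measurable_fun setT (fun w => \sum_(k < n) phi k w * (dW k w ^+ 2 - h)) /\
  (P [set w | (a < `|\sum_(k < n) phi k w * (dW k w ^+ 2 - h)|)%R] <=
   (n%:R * (29 * h ^+ 2) / a ^+ 2)%:E)%E.
Proof.
move=> a0; pose eta k w := dW k w ^+ 2 - h.
have meta k : measurable_wrt (past k.+1) (eta k).
  have m2 := measurable_funX 2 (@measurable_wrt_grid_incr _ _ _ W xi h k).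
  by apply: (measurable_funB m2); exact: measurable_cst.
have meta' k := measurable_wrt_fun (@past_m k.+1) (meta k).
have i2 k := normal_law_integrable2 sh_gt0 (mdW k) (@ldW k).
have i4 k := normal_law_integrable4 sh_gt0 (mdW k) (@ldW k).
have ih : P.-integrable setT (fun=> h%:E) by exact: finite_measure_integrable_cst.
have ieta k : P.-integrable setT (fun w => (eta k w)%:E).
  by under eq_fun do rewrite EFinB; exact: integrableB.
have eta2E k : (fun w => (eta k w ^+ 2)%:E) = (fun w => (dW k w ^+ 4)%:E +
    ((- (2 * h))%:E * (dW k w ^+ 2)%:E + (h ^+ 2)%:E))%E.
  by apply/funext => w; rewrite -!EFinM -!EFinD; congr EFin; rewrite /eta; ring.
have ih2 : P.-integrable setT (fun=> (h ^+ 2)%:E) by exact: finite_measure_integrable_cst.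
have i2h k : P.-integrable setT (fun w => (- (2 * h))%:E * (dW k w ^+ 2)%:E)%E.
  exact: integrableZl.
have iR k : P.-integrable setT (fun w => (- (2 * h))%:E * (dW k w ^+ 2)%:E + (h ^+ 2)%:E)%E.
  exact: integrableD.
have cstE c : (\int[P]_w c%:E = c%:E)%E.
  by rewrite integral_cst//= probability_setT mule1.
have [| | | | | | | | | |mS _ leS] :=
    @integral_sqr_martingale_sum _ _ _ P past phi eta (29 * h ^+ 2) n => //.
- by move=> k; exact: grid_past_mono.
- move=> k E B sE mB.
  have mB' : measurable ((fun x : R => x ^+ 2 - h) @^-1` B).
    rewrite -[_ @^-1` _]setTI.
    exact: (measurable_funB (@exprn_measurable R setT 2) (measurable_cst h)).
  exact: (grid_incr_indep BM mxi xi_indep h_gt0 sE mB').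
- by move=> k; rewrite eta2E; exact: integrableD.
- move=> k; under eq_integral do rewrite EFinB.
  by rewrite integralB// (normal_law_moment2 sh_gt0 (mdW k) (@ldW k)) sh2 cstE subee.
- move=> k; rewrite eta2E integralD// integralD// integralZl//.
  rewrite (normal_law_moment2 sh_gt0 (mdW k) (@ldW k)) sh2 cstE.
  apply: (@le_trans _ _ ((29 * h ^+ 2)%:E + (- (2 * h) * h + h ^+ 2)%:E)%E).
    rewrite -EFinM -EFinD leeD2r// -sh4.
    exact: (normal_law_moment4 sh_gt0 (mdW k) (@ldW k)).
  by rewrite -EFinD lee_fin; nra.
have mS' := measurable_wrt_fun (@past_m n) mS.
split => //; exact: chebyshev_sqr.
Qed.

End grid_sums.

(** * Outer probability and moduli of continuity *)

Section outer_probability.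
Context {d : measure_display} {T : measurableType d} {R : realType}.
Variable P : probability T R.
Implicit Types (A B : set T) (p q : R).

(* An upper bound on the outer probability: no measurability of A is needed. *)
Definition outer_le A p : Prop :=
  exists B, [/\ measurable B, A `<=` B & (P B <= p%:E)%E].

Lemma outer_le_measurable A p : measurable A -> (P A <= p%:E)%E -> outer_le A p.
Proof. by move=> mA Ap; exists A; split. Qed.

Lemma outer_leW A B p q : A `<=` B -> p <= q -> outer_le B p -> outer_le A q.
Proof.
move=> AB pq [C [mC BC PC]]; exists C; split => //.
  exact: subset_trans BC.
by rewrite (le_trans PC)// lee_fin.
Qed.

Lemma outer_leU A B p q : outer_le A p -> outer_le B q ->
  outer_le (A `|` B) (p + q).
Proof.
move=> [C [mC AC PC]] [D [mD BD PD]]; exists (C `|` D); split.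
- exact: measurableU.
- exact: setUSS.
- by rewrite EFinD (le_trans (measureU2 P mC mD))// leeD.
Qed.

Lemma outer_le_ae (Q : T -> Prop) :
  {ae P, forall w, Q w} -> outer_le [set w | ~ Q w] 0.
Proof. by move=> [C [mC C0 sC]]; exists C; split => //; rewrite C0. Qed.

Lemma outer_le_bigcup (A : (set T)^nat) :
  (forall n, outer_le (A n) 0) -> outer_le (\bigcup_n A n) 0.
Proof.
move=> /choice[C HC]; exists (\bigcup_n C n); split.
- by apply: bigcupT_measurable => n; have [] := HC n.
- by apply: subset_bigcup => n _; have [] := HC n.
- apply: (le_trans (measure_sigma_subadditive P _ _ (@subset_refl _ _))).
  + by move=> n; have [] := HC n.
  + by apply: bigcupT_measurable => n; have [] := HC n.
  + rewrite eseries0// => n _ _; apply/eqP; rewrite -measure_le0.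
    by have [] := HC n.
Qed.

(** The tail intersections of measurable covers increase, and each has probability at most [p]. In
    the applications, a path on which the limit statement fails lies in the bad event of every
    sufficiently fine grid. *)
Lemma outer_le_lim_inf (A : (set T)^nat) (N : nat) p :
  (forall n, (N <= n)%N -> outer_le (A n) p) ->
  outer_le [set w | exists N, forall n, (N <= n)%N -> A n w] p.
Proof.
move=> HA.
have HA' n : exists C, [/\ measurable C, A (n + N)%N `<=` C & (P C <= p%:E)%E].
  by apply: HA; rewrite leq_addl.
have [C HC] := choice HA'.
pose D m := \bigcap_(n in [set n | (m <= n)%N]) C n.
have mD m : measurable (D m).
  by apply: bigcap_measurableType => n _; have [] := HC n.
exists (\bigcup_m D m); split.
- exact: bigcupT_measurable.
- move=> w [M HM]; exists M => // n /= Mn; have [_ sC _] := HC n.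
  by apply: sC; apply: HM; rewrite (leq_trans Mn)// leq_addr.
- have ndD : nondecreasing_seq D.
    move=> m n mn; apply/subsetPset => w Dw k /= nk; apply: Dw.
    exact: leq_trans mn nk.
  have cD := @nondecreasing_cvg_mu _ _ _ P D mD (bigcupT_measurable _ mD) ndD.
  rewrite -(cvg_lim _ cD)//; apply: lime_le; first by apply/cvg_ex; eexists; exact: cD.
  apply: nearW => m /=; have [mC _ PC] := HC m; apply: le_trans PC.
  by apply: le_measure; rewrite ?inE//; apply: bigcap_inf => /=.
Qed.

(** The covers for p = 1 / (n + 1) intersect in a single null cover. *)
Lemma outer_le_0 A : (forall p, 0 < p -> outer_le A p) -> outer_le A 0.
Proof.
move=> HA.
have HA' n : exists C, [/\ measurable C, A `<=` C & (P C <= (n.+1%:R^-1)%:E)%E].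
  by apply: HA; rewrite invr_gt0.
have [C HC] := choice HA'.
have mC : measurable (\bigcap_n C n).
  by apply: bigcap_measurableType => n _; have [] := HC n.
exists (\bigcap_n C n); split => //.
- by move=> w Aw n _; have [_ sC _] := HC n; exact: sC.
- apply/lee_addgt0Pr => e e0; rewrite add0e.
  have [n ne] : exists n, n.+1%:R^-1 <= e.
    exists (Num.truncn e^-1); rewrite -[leRHS]invrK lef_pV2 ?posrE ?invr_gt0//.
    exact/ltW/truncnS_gt.
  have [mCn _ PC] := HC n.
  apply: (@le_trans _ _ (n.+1%:R^-1)%:E); last by rewrite lee_fin.
  apply: le_trans PC; apply: le_measure; rewrite ?inE//.
  exact: bigcap_inf.
Qed.

Lemma outer_le_prob A p : measurable A -> outer_le A p -> (P A <= p%:E)%E.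
Proof.
move=> mA [C [mC AC PC]]; apply: le_trans PC.
by apply: le_measure; rewrite ?inE.
Qed.

End outer_probability.

Section path_analysis.
Context {R : realType}.
Implicit Types (x g : R -> R) (t e T : R).

Lemma within_eps_delta x t e : {within `[0, +oo[, continuous x} ->
  0 <= t -> 0 < e ->
  exists2 D, 0 < D & forall s, 0 <= s -> `|s - t| < D -> `|x s - x t| < e.
Proof.
move=> /subspace_continuousP cx t0 e0.
have tin : `[0, +oo[%classic t by rewrite /= in_itv/= t0.
have /cvgrPdist_lt/(_ e e0) := cx _ tin.
rewrite near_withinE => -[D /= D0 HD]; exists D => // s s0 sD.
rewrite distrC; apply: HD => /=; first by rewrite distrC.
by rewrite in_itv/= s0.
Qed.

(** Heine's theorem on [[0, T]]; the continuity radius at a covering point is halved so that both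
    times fall within it. *)
Lemma uniform_modulus x T e : {within `[0, +oo[, continuous x} -> 0 < e ->
  exists2 D, 0 < D & forall s t, 0 <= s <= T -> 0 <= t <= T ->
    `|s - t| <= D -> `|x s - x t| <= e.
Proof.
move=> cx e0.
pose Q (D : R) (s : R) := 0 <= s <= T -> forall t, 0 <= t <= T ->
  `|s - t| <= D -> `|x s - x t| <= e.
have : \forall D \near 0^'+, forall s, `[0, T]%classic s -> Q D s.
  have /compact_near_coveringP := @segment_compact R 0 T.
  apply => s; rewrite /= in_itv/= => /andP[s0 sT].
  have e20 : 0 < e / 2 by rewrite divr_gt0.
  have [D D0 HD] := within_eps_delta cx s0 e20.
  have D20 : 0 < D / 2 by rewrite divr_gt0.
  exists ([set s' | `|s - s'| < D / 2], [set D' | D' < D / 2]) => /=.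
    split; first by exists (D / 2).
    by near=> D'; near: D'; exact: nbhs_right_lt.
  move=> [s' D'] /= [ss' D'D] /andP[s'0 s'T] t /andP[t0 tT] s't.
  have h1 : `|x s' - x s| < e / 2.
    by apply: HD => //; rewrite distrC (lt_trans ss')// ltr_pdivrMr// ltr_pMr// ltr1n.
  have h2 : `|x t - x s| < e / 2.
    apply: HD => //; rewrite -(subrKA s') (le_lt_trans (ler_normD _ _))//.
    rewrite (splitr D) ltrD//; first by rewrite distrC (le_lt_trans s't).
    by rewrite distrC.
  rewrite -(subrKA (x s)) (le_trans (ler_normD _ _))// [X in _ + X]distrC.
  by rewrite (splitr e) lerD// ltW.
move=> H.
have : \forall D \near 0^'+, 0 < D /\ forall s, `[0, T]%classic s -> Q D s.
  by apply: filterI => //; exact: nbhs_right_gt.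
move=> /filter_ex[D [D0 HD]]; exists D => // s t hs ht st.
by apply: (HD s) => //=; rewrite in_itv.
Unshelve. all: by end_near.
Qed.

Lemma uniform_modulus_grid x T e : {within `[0, +oo[, continuous x} ->
  0 < T -> 0 < e ->
  exists N, forall n s t, (N <= n)%N -> 0 <= s <= T -> 0 <= t <= T ->
    `|s - t| <= T / n.+1%:R -> `|x s - x t| <= e.
Proof.
move=> cx T0 e0; have [D D0 HD] := uniform_modulus T cx e0.
exists (Num.truncn (T / D)) => n s t Nn hs ht st; apply: HD => //.
apply: (le_trans st); rewrite ler_pdivrMr// -ler_pdivrMl// mulrC.
by rewrite ltW// (lt_le_trans (truncnS_gt _))// ler_nat ltnS.
Qed.

Lemma Rintegral_incr g (s t c e : R) : {within `[0, +oo[, continuous g} ->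
  0 <= s <= t -> (forall u, s <= u <= t -> `|g u - c| <= e) ->
  `|\int[lebesgue_measure]_(u in `[0, t]) g u -
    \int[lebesgue_measure]_(u in `[0, s]) g u - (t - s) * c| <= (t - s) * e.
Proof.
move=> cg /andP[s0 st] ge.
have ig : lebesgue_measure.-integrable `[0, t] (EFin \o g).
  apply: continuous_compact_integrable; first exact: segment_compact.
  apply: continuous_subspaceW cg => u /=.
  by rewrite !in_itv/= => /andP[->].
rewrite Rintegral_itvB//.
have sub : `]s, t] `<=` `[0, t].
  by move=> u /=; rewrite !in_itv/= => /andP[su ->]; rewrite (le_trans s0)// ltW.
have ig' : lebesgue_measure.-integrable `]s, t] (EFin \o g).
  by apply: integrableS ig.
have ic k : lebesgue_measure.-integrable `]s, t] (EFin \o (fun=> k : R)).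
  apply: (@integrableS _ _ _ lebesgue_measure `[s, t]) => //.
    exact: subset_itv_oc_cc.
  apply: continuous_compact_integrable; first exact: segment_compact.
  by apply: continuous_subspaceT => u; exact: cvg_cst.
have mE k : \int[lebesgue_measure]_(u in `]s, t]) k = (t - s) * k.
  rewrite Rintegral_cst//= lebesgue_measure_itv/= lte_fin mulrC.
  by move: st; rewrite le_eqVlt => /predU1P[->|->//]; rewrite ltxx subrr.
rewrite -[X in _ - X]mE -RintegralB//.
have igc : lebesgue_measure.-integrable `]s, t] (EFin \o (fun u => g u - c)).
  exact: (integrableB _ ig' (ic c)).
apply: (le_trans (le_normr_Rintegral _ igc)) => //.
rewrite -mE; apply: le_Rintegral => //; first exact: (integrable_norm igc).
by move=> u /=; rewrite in_itv/= => /andP[su ut]; apply: ge; rewrite (ltW su).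
Qed.

End path_analysis.

(** * The Euler scheme *)

Section trigonometric_bounds.
Context {R : realType}.
Implicit Types (a b u : R).

Lemma mean_value_bound0 (f df : R -> R) (u B : R) :
  (forall x : R, is_derive x 1 f (df x)) -> f 0 = 0 ->
  (forall c, `|c| <= `|u| -> `|df c| <= B) -> `|f u| <= B * `|u|.
Proof.
move=> fd f0 dfB.
have cf x y : {within `[x, y], continuous f}.
  apply: continuous_subspaceT => z; apply: differentiable_continuous.
  by apply/derivable1_diffP; have [] := fd z.
have [u0|u0] := leP 0 u.
  have [c] := MVT_segment u0 (fun x _ => fd x) (@cf _ _).
  rewrite in_itv/= => /andP[c0 cu]; rewrite f0 !subr0 => ->.
  by rewrite normrM ler_wpM2r// dfB// !ger0_norm.
have [c] := MVT_segment (ltW u0) (fun x _ => fd x) (@cf _ _).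
rewrite in_itv/= => /andP[cu c0]; rewrite f0 !sub0r => /(congr1 Num.norm).
rewrite normrN normrM normrN => ->.
by rewrite ler_wpM2r// dfB// !ler0_norm ?lerN2// ltW.
Qed.

Lemma sin_lipschitz a b : `|sin a - sin b| <= `|a - b|.
Proof.
pose f u := sin (b + u) - sin b.
have fd (x : R) : is_derive x 1 f (cos (b + x)).
  by rewrite /f; apply: is_derive_eq; rewrite /GRing.scale/=; ring.
have := @mean_value_bound0 f _ (a - b) 1 fd.
rewrite /f addr0 subrr subrKC mul1r; apply=> // c _; exact: cos_max.
Qed.

Lemma cos_lipschitz a b : `|cos a - cos b| <= `|a - b|.
Proof.
rewrite -!sinDpihalf (le_trans (sin_lipschitz _ _))//.
by rewrite opprD addrACA subrr addr0.
Qed.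

(** The mean value bound is applied to the derivative of the remainder, then to the remainder.
    Bounding by suprema rather than integrating gives the constant 1 in place of 1 / 6. *)
Lemma cos_taylor2 a u :
  `|cos (a + u) - (cos a - sin a * u - cos a / 2 * u ^+ 2)| <= `|u| ^+ 3.
Proof.
pose G u := sin a - sin (a + u) + cos a * u.
have Gd (x : R) : is_derive x 1 G (cos a - cos (a + x)).
  by rewrite /G; apply: is_derive_eq; rewrite /GRing.scale/=; ring.
have GB v : `|G v| <= `|v| ^+ 2.
  rewrite expr2; apply: (mean_value_bound0 Gd).
    by rewrite /G addr0 subrr mulr0 addr0.
  move=> c cv; apply: le_trans cv; apply: (le_trans (cos_lipschitz _ _)).
  by rewrite opprD addrA subrr sub0r normrN.
pose F u := cos (a + u) - (cos a - sin a * u - cos a / 2 * u ^+ 2).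
have Fd (x : R) : is_derive x 1 F (G x).
  by rewrite /F; apply: is_derive_eq; rewrite /G /GRing.scale/=; field.
rewrite [`|u| ^+ 3]exprSr; apply: (mean_value_bound0 Fd).
  by rewrite /F !addr0 expr0n/= !mulr0 !subr0 subrr.
move=> c cu; apply: le_trans (GB c) _.
by rewrite ler_pXn2r ?nnegrE.
Qed.

Lemma sin_taylor2 a u :
  `|sin (a + u) - (sin a + cos a * u - sin a / 2 * u ^+ 2)| <= `|u| ^+ 3.
Proof.
have := cos_taylor2 (a - pi / 2) u.
by rewrite -addrA (addrC _ u) addrA !cosBpihalf sinBpihalf mulNr opprK.
Qed.

End trigonometric_bounds.

Section euler_scheme.
Context {R : realType}.
Implicit Types (x g : R -> R) (t e T : R).

(** The driving sequence [dw] is arbitrary, so that one recursion serves both for convergence along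
    a path and, with random increments, for adaptedness. *)
Fixpoint euler (b : R -> R) (c h : R) (dw : nat -> R) (y0 : R) (k : nat) : R :=
  if k is k'.+1 then
    let y := euler b c h dw y0 k' in y + h * b y + c * dw k'
  else y0.

(** With a = L h and E the exponential at step k, (1 + a) e (E - 1) + a e = e ((1 + a) E - 1), and 1
    + a <= expR a. *)
Lemma gronwall_expR (err : nat -> R) (L h e : R) (n : nat) :
  0 <= L -> 0 <= h -> 0 <= e -> err 0%N <= 0 ->
  (forall k, (k < n)%N -> err k.+1 <= (1 + L * h) * err k + h * (L * e)) ->
  forall k, (k <= n)%N -> err k <= e * (expR (L * (k%:R * h)) - 1).
Proof.
move=> L0 h0 e0 err0 errS; elim => [_|k IH kn].
  by rewrite mul0r mulr0 expR0 subrr mulr0.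
apply: (le_trans (errS k kn)).
have := IH (ltnW kn); have := expR_ge1Dx (L * h).
have -> : L * (k.+1%:R * h) = L * (k%:R * h) + L * h by rewrite -natr1; ring.
rewrite expRD.
have := expR_gt0 (L * (k%:R * h)); have : 0 <= L * h by rewrite mulr_ge0.
set E := expR _; set F := expR _; set a := L * h => a0 E0 F1 IH'.
apply: (@le_trans _ _ ((1 + a) * (e * (E - 1)) + h * (L * e))).
  by rewrite lerD2r ler_wpM2l// addr_ge0.
have -> : h * (L * e) = a * e by rewrite /a; ring.
have : 0 <= e * E * (F - 1 - a) by rewrite !mulr_ge0// ?(ltW E0)//; lra.
lra.
Qed.

Lemma within_comp g x : continuous g -> {within `[0, +oo[, continuous x} ->
  {within `[0, +oo[, continuous (g \o x)}.
Proof. by move=> cg cx t; exact: (continuous_comp (cx t) (cg _)). Qed.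

Lemma grid_point_bounds (T : R) (N k : nat) : 0 < T -> (k < N)%N ->
  [/\ 0 <= k%:R * (T / N%:R), k%:R * (T / N%:R) <= k.+1%:R * (T / N%:R),
      k.+1%:R * (T / N%:R) <= T &
      k.+1%:R * (T / N%:R) - k%:R * (T / N%:R) = T / N%:R].
Proof.
move=> T0 kN; have N0 : 0 < N%:R :> R by rewrite ltr0n (leq_ltn_trans _ kN).
have h0 : 0 < T / N%:R by rewrite divr_gt0.
split.
- by rewrite mulr_ge0// ltW.
- by rewrite ler_pM2r// ler_nat.
- by rewrite mulrA ler_pdivrMr// mulrC ler_pM2l// ler_nat.
- by rewrite -natr1 mulrDl mul1r [X in X - _]addrC addrK.
Qed.

Lemma Rintegral_itv0 g : \int[lebesgue_measure]_(u in `[0, 0]) g u = 0 :> R.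
Proof. by rewrite set_itv1 Rintegral_set1. Qed.

Lemma riemann_sum_cvg g T e : {within `[0, +oo[, continuous g} -> 0 < T -> 0 < e ->
  exists N0, forall N, (N0 < N)%N ->
  `|T / N%:R * (\sum_(k < N) g (k%:R * (T / N%:R))) -
    \int[lebesgue_measure]_(u in `[0, T]) g u| <= e.
Proof.
move=> cg T0 e0; have eT0 : 0 < e / T by rewrite divr_gt0.
have [N0 HN] := uniform_modulus_grid cg T0 eT0.
exists N0 => -[//|N] N0N; set h := T / _.
have hE : T = N.+1%:R * h by rewrite /h mulrC divfK.
have -> : \int[lebesgue_measure]_(u in `[0, T]) g u =
    \sum_(k < N.+1) (\int[lebesgue_measure]_(u in `[0, k.+1%:R * h]) g u -
      \int[lebesgue_measure]_(u in `[0, k%:R * h]) g u).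
  rewrite -(big_mkord xpredT (fun k : nat => \int[lebesgue_measure]_(u in `[0, k.+1%:R * h]) g u -
      \int[lebesgue_measure]_(u in `[0, k%:R * h]) g u)).
  by rewrite (telescope_sumr (fun k : nat => \int[lebesgue_measure]_(u in `[0, k%:R * h]) g u))//
    mul0r Rintegral_itv0 subr0 -hE.
rewrite big_distrr/= -sumrB; apply: (le_trans (ler_norm_sum _ _ _)).
apply: (@le_trans _ _ (\sum_(k < N.+1) h * (e / T))).
  apply: ler_sum => k _.
  have [k0 kk1 k1T dk] := grid_point_bounds T0 (ltn_ord k).
  rewrite distrC -[X in _ - X * _]dk -[X in _ <= X * _]dk; apply: Rintegral_incr => //.
    by rewrite k0.
  move=> u /andP[ku uk]; apply: (HN N) => //.
  - by rewrite (le_trans k0 ku) (le_trans uk).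
  - by rewrite k0 (le_trans kk1).
  - by rewrite ger0_norm ?subr_ge0// -[leRHS]dk lerD2r.
rewrite sumr_const card_ord -[_ *+ N.+1]mulr_natl mulrA -hE mulrC divfK//.
by rewrite gt_eqF.
Qed.

(** The finite variation part of the Ito sums, with [g] the drift along the path. The bound on [f]
    makes each cell cost only the oscillation of [g]. *)
Lemma riemann_stieltjes_sum_cvg (f g : R -> R) T e :
  {within `[0, +oo[, continuous f} -> {within `[0, +oo[, continuous g} ->
  (forall t, `|f t| <= 1) -> 0 < T -> 0 < e ->
  exists N0, forall N, (N0 < N)%N ->
  `|\sum_(k < N) f (k%:R * (T / N%:R)) *
      (\int[lebesgue_measure]_(u in `[0, k.+1%:R * (T / N%:R)]) g u -
       \int[lebesgue_measure]_(u in `[0, k%:R * (T / N%:R)]) g u) -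
    \int[lebesgue_measure]_(u in `[0, T]) (f u * g u)| <= e.
Proof.
move=> cf cg f1 T0 e0; have e20 : 0 < e / 2 by rewrite divr_gt0.
have eT0 : 0 < e / 2 / T by rewrite divr_gt0.
have cfg : {within `[0, +oo[, continuous (fun u => f u * g u)}.
  by move=> t; apply: continuousM; [exact: cf|exact: cg].
have [N0 HN] := uniform_modulus_grid cg T0 eT0.
have [N1 HN1] := riemann_sum_cvg cfg T0 e20.
exists (maxn N0 N1) => -[//|N]; rewrite ltnS geq_max => /andP[N0N N1N].
have := HN1 N.+1 N1N; set h := T / _ => HR.
have hE : T = N.+1%:R * h by rewrite /h mulrC divfK.
rewrite -(subrKA (h * \sum_(k < N.+1) f (k%:R * h) * g (k%:R * h))).
rewrite (le_trans (ler_normD _ _))// (splitr e) lerD//.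
rewrite big_distrr/= -sumrB; apply: (le_trans (ler_norm_sum _ _ _)).
apply: (@le_trans _ _ (\sum_(k < N.+1) h * (e / 2 / T))).
  apply: ler_sum => k _.
  have [k0 kk1 k1T dk] := grid_point_bounds T0 (ltn_ord k).
  rewrite [h * (_ * _)]mulrCA -mulrBr normrM (le_trans (ler_piMl _ (f1 _)))//.
  rewrite -[X in _ - X * _]dk -[X in _ <= X * _]dk; apply: Rintegral_incr => //.
    by rewrite k0.
  move=> u /andP[ku uk]; apply: (HN N) => //.
  - by rewrite (le_trans k0 ku) (le_trans uk).
  - by rewrite k0 (le_trans kk1).
  - by rewrite ger0_norm ?subr_ge0// -[leRHS]dk lerD2r.
rewrite sumr_const card_ord -[_ *+ N.+1]mulr_natl mulrA -hE mulrC divfK//.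
by rewrite gt_eqF.
Qed.

Variables (x w b : R -> R) (c L : R).
Hypotheses (cx : {within `[0, +oo[, continuous x}) (L_ge0 : 0 <= L).
Hypothesis b_lip : forall u v, `|b u - b v| <= L * `|u - v|.
Hypothesis sde : forall t, 0 <= t ->
  x t = x 0 + \int[lebesgue_measure]_(s in `[0, t]) b (x s) + c * w t.

Let cb : continuous b.
Proof.
have L1 : 0 < L + 1 by rewrite ltr_wpDl.
move=> u; apply/cvgrPdist_le => e e0; apply/nbhs_ballP.
exists ((L + 1)^-1 * e) => /=; first by rewrite mulr_gt0// invr_gt0.
move=> v; rewrite /ball/= ltr_pdivlMl// => uv.
apply: (le_trans (b_lip u v)); apply: le_trans (ltW uv).
by rewrite ler_wpM2r// lerDl.
Qed.

(** With a constant diffusion coefficient the noise term of an Euler step is exact; the error comes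
    only from freezing the drift. *)
Lemma sde_step_bound s t e : 0 <= s <= t ->
  (forall u, s <= u <= t -> `|x u - x s| <= e) ->
  `|x t - (x s + (t - s) * b (x s) + c * (w t - w s))| <= (t - s) * (L * e).
Proof.
move=> /andP[s0 st] osc.
have cbx := within_comp cb cx.
have st' : 0 <= s <= t by rewrite s0.
have := @Rintegral_incr _ _ s t (b (x s)) (L * e) cbx st'.
move=> H; apply: le_trans (H _); last first.
  by move=> u su; rewrite (le_trans (b_lip _ _))// ler_wpM2l// osc.
have Et := sde (le_trans s0 st); have Es := sde s0.
rewrite le_eqVlt; apply/orP; left; apply/eqP; congr (`| _ |).
rewrite /= Et {1}Es; ring.
Qed.

Lemma euler_cvg T e : 0 < T -> 0 < e ->
  exists N0, forall N k, (N0 < N)%N -> (k <= N)%N ->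
  `|euler b c (T / N%:R)
      (fun k => w (k.+1%:R * (T / N%:R)) - w (k%:R * (T / N%:R))) (x 0) k -
    x (k%:R * (T / N%:R))| <= e.
Proof.
move=> T0 e0.
(* The Gronwall factor at time [T]: an oscillation of at most e / C on each step leaves a final
   error of at most e. *)
pose C := expR (L * T); have C0 : 0 < C by exact: expR_gt0.
have eC0 : 0 < e / C by rewrite divr_gt0.
have [N0 HN] := uniform_modulus_grid cx T0 eC0.
exists N0 => -[//|N] k N0N kN; set h := T / _.
have h0 : 0 <= h by rewrite divr_ge0// ltW.
set Y := euler _ _ _ _ _.
pose err k := `|Y k - x (k%:R * h)|.
have := @gronwall_expR err L h (e / C) N.+1 L_ge0 h0 (ltW eC0).
have err0 : err 0%N <= 0 by rewrite /err /= mul0r subrr normr0.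
move=> /(_ err0) H; apply: (le_trans (H _ k kN)) => {H} [j jN|]; last first.
  rewrite -mulrA ler_piMr// ?(ltW e0)// ler_pdivrMl// mulr1.
  apply: (@le_trans _ _ (expR (L * (k%:R * h)))); first by rewrite lerBlDr lerDl.
  rewrite ler_expR ler_wpM2l// /h mulrA ler_pdivrMr// mulrC ler_pM2l//.
  by rewrite ler_nat.
have [j0 jj1 j1T dj] := grid_point_bounds T0 jN.
rewrite -/h in j0 jj1 j1T dj.
have := @sde_step_bound (j%:R * h) (j.+1%:R * h) (e / C).
rewrite j0 jj1 dj => /(_ isT) H.
have {}H := H _.
have /H {}H : forall u, j%:R * h <= u <= j.+1%:R * h -> `|x u - x (j%:R * h)| <= e / C.
  move=> u /andP[ju uj]; apply: (HN N) => //.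
  - by rewrite (le_trans j0 ju) (le_trans uj).
  - by rewrite j0 (le_trans jj1).
  - by rewrite ger0_norm ?subr_ge0// -[leRHS]dj lerD2r.
rewrite /err; set y := Y j; set xj := x (j%:R * h) in H *.
have -> : Y j.+1 = y + h * b y + c * (w (j.+1%:R * h) - w (j%:R * h)) by [].
set dw := c * _ in H *; set xj1 := x _ in H *.
have -> : y + h * b y + dw - xj1 =
  (y - xj) + h * (b y - b xj) - (xj1 - (xj + h * b xj + dw)) by ring.
rewrite (le_trans (ler_normB _ _))// lerD//.
rewrite (le_trans (ler_normD _ _))// mulrDl mul1r lerD2l normrM ger0_norm//.
by rewrite (mulrC L) -[leRHS]mulrA ler_wpM2l.
Qed.

Lemma euler_riemann_sum_cvg (G : R -> R) (K T e : R) : 0 < T -> 0 < e -> 0 <= K ->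
  (forall u v, `|G u - G v| <= K * `|u - v|) -> continuous G ->
  exists N0, forall N, (N0 < N)%N ->
  `|T / N%:R * (\sum_(k < N) G (euler b c (T / N%:R)
      (fun k => w (k.+1%:R * (T / N%:R)) - w (k%:R * (T / N%:R))) (x 0) k)) -
    \int[lebesgue_measure]_(u in `[0, T]) G (x u)| <= e.
Proof.
move=> T0 e0 K0 Glip cG; have e20 : 0 < e / 2 by rewrite divr_gt0.
have K1 : 0 < (K + 1) * T by rewrite mulr_gt0// ltr_wpDl.
have eK : 0 < e / 2 / ((K + 1) * T) by rewrite divr_gt0.
have [N0 HN] := euler_cvg T0 eK.
have [N1 HN1] := riemann_sum_cvg (within_comp cG cx) T0 e20.
exists (maxn N0 N1) => -[//|N]; rewrite ltnS geq_max => /andP[N0N N1N].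
have := HN1 N.+1 N1N => HR.
rewrite -(subrKA (T / N.+1%:R * \sum_(k < N.+1) G (x (k%:R * (T / N.+1%:R))))).
rewrite (le_trans (ler_normD _ _))// (splitr e) lerD//.
rewrite -mulrBr -sumrB normrM ger0_norm ?divr_ge0 ?(ltW T0)//.
rewrite mulrAC ler_pdivrMr// (le_trans (ler_wpM2l (ltW T0) (ler_norm_sum _ _ _)))//.
apply: (@le_trans _ _ (T * \sum_(k < N.+1) (K + 1) * (e / 2 / ((K + 1) * T)))).
  rewrite ler_wpM2l ?(ltW T0)//; apply: ler_sum => k _.
  apply: (le_trans (Glip _ _)); apply: ler_pM => //; first by rewrite lerDl.
  by apply: HN => //; exact: ltnW.
rewrite sumr_const card_ord -[_ *+ N.+1]mulr_natl le_eqVlt; apply/orP; left; apply/eqP.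
have K10 : K + 1 != 0 by rewrite gt_eqF// ltr_wpDl.
by field; rewrite K10 gt_eqF.
Qed.

End euler_scheme.

(** * Discrete Ito formula and lower bound on the information *)

Section discrete_ito.
Context {R : realType}.
Variables (y b xi : nat -> R) (N : nat) (h c L m A V : R).
Hypotheses (h_ge0 : 0 <= h) (c_ge0 : 0 <= c) (L_ge0 : 0 <= L) (m_ge0 : 0 <= m).
Hypothesis yS : forall k, y k.+1 = y k + h * b k + c * xi k.
Hypothesis b_le : forall k, `|b k| <= L.
Hypothesis xi_le : forall k, (k < N)%N -> `|xi k| <= m.
Let T := N%:R * h.
Hypothesis qvV : `|\sum_(k < N) (xi k ^+ 2 - h)| <= V.

(** Bounds, after division by 2, the terms of the Taylor expansion in the doubled angle that vanish
    with the mesh: drift times noise, squared drift, and the cubic remainder. Each carries a factor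
    [h] or [m]. *)
Definition ito_remainder (T h c L m V : R) : R :=
  2 * c * T * L * m + h * T * L ^+ 2 +
  4 * (h * L + c * m) * (2 * T * L ^+ 2 * h + 2 * c ^+ 2 * (T + V)).

Let D k := h * b k + c * xi k.

Let sum_le (F : nat -> R) B : (forall k, (k < N)%N -> F k <= B) ->
  \sum_(k < N) F k <= N%:R * B.
Proof.
move=> FB; apply: (@le_trans _ _ (\sum_(k < N) B)).
  by apply: ler_sum => k _; exact: FB.
by rewrite sumr_const card_ord -[_ *+ N]mulr_natl.
Qed.

Let b2 k : b k ^+ 2 <= L ^+ 2.
Proof. by rewrite -[b k ^+ 2]real_normK ?num_real// ler_pXn2r ?nnegrE. Qed.

(** One factor is bounded by h L + c m. The remaining squares are at most 2 h^2 L^2 + 2 c^2 xi^2,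
    and the xi^2 sum to at most T + V. *)
Let cube_sum : \sum_(k < N) `|D k| ^+ 3 <=
  (h * L + c * m) * (2 * T * L ^+ 2 * h + 2 * c ^+ 2 * (T + V)).
Proof.
have hLcm : 0 <= h * L + c * m by rewrite addr_ge0// mulr_ge0.
apply: (@le_trans _ _ (\sum_(k < N) (h * L + c * m) *
    (2 * h ^+ 2 * L ^+ 2 + 2 * c ^+ 2 * h + 2 * c ^+ 2 * (xi k ^+ 2 - h)))).
  apply: ler_sum => k _; rewrite exprS ler_pM ?exprn_ge0//.
    rewrite (le_trans (ler_normD _ _))// lerD// normrM ger0_norm ?ler_wpM2l//.
    exact: xi_le.
  rewrite real_normK ?num_real// /D; have h2 : 0 <= h ^+ 2 by exact: sqr_ge0.
  have := sqr_ge0 (h * b k - c * xi k); have := ler_wpM2l h2 (b2 k); nra.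
rewrite -mulr_sumr ler_wpM2l// big_split/= sumr_const card_ord.
rewrite -mulr_sumr -[_ *+ N]mulr_natl.
have : 2 * c ^+ 2 * (\sum_(k < N) (xi k ^+ 2 - h)) <= 2 * c ^+ 2 * V.
  by rewrite ler_wpM2l ?mulr_ge0 ?sqr_ge0// (le_trans (ler_norm _)).
rewrite /T; lra.
Qed.

(** Discrete Ito formula divided by 2, with [df] the derivative and [f2] minus the second derivative
    in the doubled angle. The increments of [f] telescope to at most 2, and writing xi^2 = (xi^2 -
    h) + h produces the term in c^2 f2. *)
Let step_bound (f df f2 : nat -> R) :
  (forall k, `|df k| <= 1) -> (forall k, `|f2 k| <= 1) ->
  (forall k, `|f k| <= 1) ->
  (forall k, `|f k.+1 - (f k + df k * (2 * D k) - f2 k / 2 * (2 * D k) ^+ 2)| <=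
     `|2 * D k| ^+ 3) ->
  `|\sum_(k < N) df k * xi k| <= A ->
  `|\sum_(k < N) f2 k * (xi k ^+ 2 - h)| <= V ->
  `|h * \sum_(k < N) (df k * b k - c ^+ 2 * f2 k)| <=
    1 + c * A + c ^+ 2 * V + ito_remainder T h c L m V.
Proof.
move=> df1 f21 f1 taylor dfA f2V.
pose r k := f k.+1 - (f k + df k * (2 * D k) - f2 k / 2 * (2 * D k) ^+ 2).
pose X := \sum_(k < N) (df k * b k - c ^+ 2 * f2 k).
pose M := \sum_(k < N) df k * xi k.
pose Q := \sum_(k < N) f2 k * (xi k ^+ 2 - h).
pose C := \sum_(k < N) f2 k * b k * xi k.
pose B := \sum_(k < N) f2 k * b k ^+ 2.
pose U := \sum_(k < N) r k.
have tel : f N - f 0%N = 2 * (h * X) + 2 * c * M - 2 * c ^+ 2 * Q -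
    4 * c * h * C - 2 * h ^+ 2 * B + U.
  rewrite -(telescope_sumr f (leq0n N)) big_mkord.
  rewrite /X /M /Q /C /B /U !mulr_sumr -!sumrN -!big_split/=.
  by apply: eq_bigr => k _; rewrite /r /D; field.
have fN : `|f N - f 0%N| <= 2 by rewrite (le_trans (ler_normB _ _))// lerD.
have CB : `|C| <= N%:R * (L * m).
  apply: (le_trans (ler_norm_sum _ _ _)).
  apply: (sum_le (F := fun k => `|f2 k * b k * xi k|)) => k kN.
  rewrite !normrM; apply: ler_pM => //; last exact: xi_le.
  by rewrite (le_trans (ler_piMl _ (f21 k))).
have BB : `|B| <= N%:R * L ^+ 2.
  apply: (le_trans (ler_norm_sum _ _ _)).
  apply: (sum_le (F := fun k => `|f2 k * b k ^+ 2|)) => k kN.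
  by rewrite normrM (le_trans (ler_piMl _ (f21 k)))// ger0_norm ?sqr_ge0.
have UB : `|U| <= 8 * ((h * L + c * m) * (2 * T * L ^+ 2 * h + 2 * c ^+ 2 * (T + V))).
  apply: (le_trans (ler_norm_sum _ _ _)).
  apply: (@le_trans _ _ (\sum_(k < N) 8 * `|D k| ^+ 3)).
    apply: ler_sum => k _; apply: (le_trans (taylor k)).
    by rewrite normrM exprMn ger0_norm//; lra.
  by rewrite -mulr_sumr ler_wpM2l.
have cM : `|c * M| <= c * A by rewrite normrM ger0_norm// ler_wpM2l.
have cQ : `|c ^+ 2 * Q| <= c ^+ 2 * V.
  by rewrite normrM ger0_norm ?sqr_ge0// ler_wpM2l ?sqr_ge0.
have cC : `|c * h * C| <= c * T * L * m.
  rewrite normrM ger0_norm ?mulr_ge0//.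
  apply: (le_trans (ler_wpM2l _ CB)); first by rewrite mulr_ge0.
  by rewrite /T le_eqVlt; apply/orP; left; apply/eqP; ring.
have hB : `|h ^+ 2 * B| <= h * T * L ^+ 2.
  rewrite normrM ger0_norm ?sqr_ge0//.
  apply: (le_trans (ler_wpM2l _ BB)); first by rewrite sqr_ge0.
  by rewrite /T le_eqVlt; apply/orP; left; apply/eqP; ring.
move: fN cM cQ cC hB UB; rewrite tel -/X /ito_remainder !ler_norml.
move=> /andP[? ?] /andP[? ?] /andP[? ?] /andP[? ?] /andP[? ?] /andP[? ?].
by apply/andP; split; lra.
Qed.

Let y2S k : 2 * y k.+1 = 2 * y k + 2 * D k.
Proof. by rewrite yS /D; ring. Qed.

Lemma discrete_ito_cos :
  `|\sum_(k < N) sin (2 * y k) * xi k| <= A ->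
  `|\sum_(k < N) cos (2 * y k) * (xi k ^+ 2 - h)| <= V ->
  `|h * \sum_(k < N) (sin (2 * y k) * b k + c ^+ 2 * cos (2 * y k))| <=
    1 + c * A + c ^+ 2 * V + ito_remainder T h c L m V.
Proof.
move=> sA cV.
rewrite -normrN -mulrN -sumrN.
rewrite (eq_bigr (fun k : 'I_N =>
  - sin (2 * y k) * b k - c ^+ 2 * cos (2 * y k))); last by move=> k _; ring.
apply: (@step_bound (fun k => cos (2 * y k)) (fun k => - sin (2 * y k))
  (fun k => cos (2 * y k))) => //.
- by move=> k; rewrite normrN; exact: sin_max.
- by move=> k; exact: cos_max.
- by move=> k; exact: cos_max.
- move=> k; have := cos_taylor2 (2 * y k) (2 * D k).
  by rewrite y2S mulNr.
- rewrite (eq_bigr (fun k : 'I_N => - (sin (2 * y k) * xi k))).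
    by rewrite sumrN normrN.
  by move=> k _; rewrite mulNr.
Qed.

Lemma discrete_ito_sin :
  `|\sum_(k < N) cos (2 * y k) * xi k| <= A ->
  `|\sum_(k < N) sin (2 * y k) * (xi k ^+ 2 - h)| <= V ->
  `|h * \sum_(k < N) (cos (2 * y k) * b k - c ^+ 2 * sin (2 * y k))| <=
    1 + c * A + c ^+ 2 * V + ito_remainder T h c L m V.
Proof.
move=> cA sV.
apply: (@step_bound (fun k => sin (2 * y k)) (fun k => cos (2 * y k))
  (fun k => sin (2 * y k))) => //.
- by move=> k; exact: cos_max.
- by move=> k; exact: sin_max.
- by move=> k; exact: sin_max.
- move=> k; have := sin_taylor2 (2 * y k) (2 * D k).
  by rewrite y2S.
Qed.

Let E := 1 + c * A + c ^+ 2 * V + ito_remainder T h c L m V.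

(** The Ito formula is used for |u|^2 cos 2(y - arg u) = g^2 - s^2, where g and s are the components
    of u along and across the direction y. Up to the factor -1/2 its generator is c^2 (g^2 - s^2) -
    2 b s g, whose time integral is at most 2 |u|^2 E <= c^2 T |u|^2 / 4. Pointwise this expression
    is at least c^2 |u|^2 / 2 minus a multiple of s^2, so the s^2 must make up the difference. *)
Lemma discrete_information_lb (u1 u2 : R) : 0 < c -> 0 < L ->
  `|\sum_(k < N) cos (2 * y k) * xi k| <= A ->
  `|\sum_(k < N) sin (2 * y k) * xi k| <= A ->
  `|\sum_(k < N) cos (2 * y k) * (xi k ^+ 2 - h)| <= V ->
  `|\sum_(k < N) sin (2 * y k) * (xi k ^+ 2 - h)| <= V ->
  E <= c ^+ 2 * T / 8 ->
  c ^+ 2 / 4 * T * (u1 ^+ 2 + u2 ^+ 2) <= (2 * c ^+ 2 + 2 * L ^+ 2 / c ^+ 2) *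
    (h * \sum_(k < N) (u2 * cos (y k) - u1 * sin (y k)) ^+ 2).
Proof.
move=> c0 L0 cA sA cV sV E_le.
have := discrete_ito_cos sA cV; have := discrete_ito_sin cA sV.
rewrite -/E; set SP := h * _; set SQ := h * _ => SPE SQE.
(* al + i be is the square of u1 + i u2, which rotates the sums in the angle 2y into sums in [s] and
   [g]. *)
pose al := u1 ^+ 2 - u2 ^+ 2; pose be := 2 * u1 * u2; pose n2 := u1 ^+ 2 + u2 ^+ 2.
pose s k := u2 * cos (y k) - u1 * sin (y k).
pose g k := u1 * cos (y k) + u2 * sin (y k).
have n20 : 0 <= n2 by rewrite addr_ge0// sqr_ge0.
have sg k : s k ^+ 2 + g k ^+ 2 = n2.
  by have := cos2Dsin2 (y k); rewrite /s /g /n2; nra.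
have sin2 k : sin (2 * y k) = 2 * cos (y k) * sin (y k).
  by rewrite mulrC mulr_natr sin_mulr2n -mulr_natl mulrA.
have cos2 k : cos (2 * y k) = cos (y k) ^+ 2 - sin (y k) ^+ 2.
  by rewrite mulrC mulr_natr cos_mulr2n sin2cos2; ring.
have key : al * SQ - be * SP =
    h * \sum_(k < N) (c ^+ 2 * (n2 - 2 * s k ^+ 2) - 2 * b k * (s k * g k)).
  rewrite /SP /SQ !(mulrCA _ h) -mulrBr; congr (_ * _).
  rewrite !mulr_sumr -sumrB.
  apply: eq_bigr => k _; rewrite -(sg k) sin2 cos2 /al /be /s /g.
  ring.
(* AM-GM: 2 L |s g| <= c^2 / 2 g^2 + 2 L^2 / c^2 s^2 *)
have lb k : c ^+ 2 / 2 * n2 - (2 * c ^+ 2 + 2 * L ^+ 2 / c ^+ 2) * s k ^+ 2 <=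
    c ^+ 2 * (n2 - 2 * s k ^+ 2) - 2 * b k * (s k * g k).
  have c_neq0 : c != 0 by rewrite gt_eqF.
  have g2 : g k ^+ 2 <= n2 by rewrite -(sg k) lerDr sqr_ge0.
  have bs : b k ^+ 2 * s k ^+ 2 <= L ^+ 2 * s k ^+ 2 by rewrite ler_wpM2r ?sqr_ge0.
  have amgm : 0 <= (c ^+ 2 * g k + 2 * (b k * s k)) ^+ 2 by exact: sqr_ge0.
  have c2_gt0 : 0 < c ^+ 2 by rewrite exprn_gt0.
  rewrite -subr_ge0 -(pmulr_rge0 _ c2_gt0).
  have -> : c ^+ 2 * (c ^+ 2 * (n2 - 2 * s k ^+ 2) - 2 * b k * (s k * g k) -
      (c ^+ 2 / 2 * n2 - (2 * c ^+ 2 + 2 * L ^+ 2 / c ^+ 2) * s k ^+ 2)) =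
      c ^+ 2 * c ^+ 2 / 2 * n2 - 2 * c ^+ 2 * (b k * s k) * g k +
      2 * (L ^+ 2 * s k ^+ 2) by field.
  have := ler_wpM2l (ltW c2_gt0) (ler_wpM2l (ltW c2_gt0) g2).
  have := sqr_ge0 (c ^+ 2 * g k - 2 * (b k * s k)).
  nra.
have keylb : c ^+ 2 / 2 * n2 * T - (2 * c ^+ 2 + 2 * L ^+ 2 / c ^+ 2) *
    (h * \sum_(k < N) s k ^+ 2) <= al * SQ - be * SP.
  rewrite key; apply: (@le_trans _ _ (h * \sum_(k < N) (c ^+ 2 / 2 * n2 -
      (2 * c ^+ 2 + 2 * L ^+ 2 / c ^+ 2) * s k ^+ 2))); last first.
    by rewrite ler_wpM2l//; apply: ler_sum => k _; exact: lb.
  rewrite sumrB sumr_const card_ord -mulr_sumr -[_ *+ N]mulr_natl /T.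
  by rewrite le_eqVlt; apply/orP; left; apply/eqP; ring.
have al_le : `|al| <= n2.
  by rewrite /al /n2 ler_norml; have := sqr_ge0 u1; have := sqr_ge0 u2;
    move=> *; apply/andP; split; lra.
have be_le : `|be| <= n2.
  by rewrite /be /n2 ler_norml; have := sqr_ge0 (u1 - u2); have := sqr_ge0 (u1 + u2);
    move=> *; apply/andP; split; lra.
have aE : al * SQ <= n2 * E.
  by rewrite (le_trans (ler_norm _))// normrM ler_pM.
have bE : - (be * SP) <= n2 * E.
  by rewrite (le_trans (ler_norm _))// normrN normrM ler_pM.
have nE : n2 * E <= n2 * (c ^+ 2 * T / 8) by rewrite ler_wpM2l.
have -> : \sum_(k < N) (u2 * cos (y k) - u1 * sin (y k)) ^+ 2 =
  \sum_(k < N) s k ^+ 2 by [].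
rewrite -/n2; lra.
Qed.

End discrete_ito.

Section drift_bounds.
Context {R : realType}.
Variables (lam mu : R).
Hypothesis lam_ge0 : 0 <= lam.

Lemma drift_lipschitz (a b : R) :
  `|drift lam mu a - drift lam mu b| <= lam * `|a - b|.
Proof.
rewrite /drift -mulrBr normrM normrN (ger0_norm lam_ge0) ler_wpM2l//.
by rewrite (le_trans (sin_lipschitz _ _))// opprB addrA subrK.
Qed.

Lemma drift_le (a : R) : `|drift lam mu a| <= lam.
Proof. by rewrite /drift normrM normrN (ger0_norm lam_ge0) ler_piMr// sin_max. Qed.

Lemma continuous_drift : continuous (drift lam mu).
Proof.
move=> y; apply: cvgM; first exact: cvg_cst.
apply: (cvg_comp _ sin); last exact: continuous_sin.
by apply: cvgB; [exact: cvg_id|exact: cvg_cst].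
Qed.

End drift_bounds.

Lemma measurable_norm_gt {d : measure_display} {T : measurableType d}
    {R : realType} (X : T -> R) (a : R) :
  measurable_fun setT X -> measurable [set w | a < `|X w|].
Proof.
move=> mX; rewrite (_ : [set w | _] = (fun w => a < `|X w|) @^-1` [set true])//.
rewrite -[_ @^-1` _]setTI; apply: measurable_fun_ltr => //.
exact: measurableT_comp mX.
Qed.

Lemma truncn_divr_le {R : realType} (C e : R) (n : nat) : 0 < e ->
  (Num.truncn (C / e) <= n)%N -> C / n.+1%:R <= e.
Proof.
move=> e0 Cn; rewrite ler_pdivrMr// mulrC -ler_pdivrMr//.
by rewrite ltW// (lt_le_trans (truncnS_gt _))// ler_nat ltnS.
Qed.

(** For h, m <= D <= 1 the remainder is at most D K: every term has a factor [h] or [m], and a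
    further [h] is bounded by 1. *)
Lemma ito_remainder_small {R : realType} (T c L V e : R) :
  0 <= T -> 0 <= c -> 0 <= L -> 0 <= V -> 0 < e ->
  exists2 D, 0 < D & forall h m, 0 <= h <= D -> 0 <= m <= D ->
    ito_remainder T h c L m V <= e.
Proof.
move=> T0 c0 L0 V0 e0.
pose K := 2 * c * T * L + T * L ^+ 2 + 4 * (L + c) * (2 * T * L ^+ 2 + 2 * c ^+ 2 * (T + V)).
have K0 : 0 <= K.
  by rewrite /K !addr_ge0 ?mulr_ge0 ?addr_ge0 ?mulr_ge0 ?sqr_ge0 ?addr_ge0.
exists (Num.min 1 (e / (K + 1))); first by rewrite lt_min ltr01 divr_gt0// ltr_wpDl.
set D := Num.min _ _ => h m /andP[h0 hD] /andP[m0 mD].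
have D1 : D <= 1 by rewrite ge_min lexx.
have DK : D * K <= e.
  apply: (@le_trans _ _ (e / (K + 1) * (K + 1))).
    by apply: ler_pM => //; rewrite ?(le_trans h0 hD)// ?ge_min ?lexx ?orbT// lerDl.
  by rewrite divfK// gt_eqF// ltr_wpDl.
apply: le_trans DK; have h1 := le_trans hD D1.
have -> : D * K = D * (2 * c * T * L) + D * (T * L ^+ 2) +
  4 * (D * (L + c)) * (2 * T * L ^+ 2 + 2 * c ^+ 2 * (T + V)) by rewrite /K; ring.
have cTL : 0 <= 2 * c * T * L by rewrite !mulr_ge0.
have TL2 : 0 <= T * L ^+ 2 by rewrite mulr_ge0 ?sqr_ge0.
rewrite /ito_remainder; apply: lerD; first apply: lerD.
- by rewrite mulrC ler_wpM2r.
- by rewrite -mulrA ler_wpM2r.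
- apply: ler_pM.
  + by rewrite mulr_ge0// addr_ge0 ?mulr_ge0.
  + by rewrite addr_ge0// !mulr_ge0 ?exprn_ge0 ?addr_ge0.
  + rewrite ler_wpM2l// mulrDr; apply: lerD; first exact: ler_wpM2r.
    by rewrite mulrC; exact: ler_wpM2r.
  + by rewrite lerD2r -[leRHS]mulr1; apply: ler_wpM2l; rewrite ?mulr_ge0 ?exprn_ge0.
Qed.

(** * Euler scheme and information of the von Mises process *)

Section von_mises_path.
Context {d : measure_display} {Omega : measurableType d} {R : realType}.
Variables (P : probability Omega R) (W : R -> Omega -> R).
Variables (lam mu sigma : R) (theta : R -> Omega -> R) (T : R).
Hypotheses (BM : is_brownian_motion P W) (lam_gt0 : 0 < lam).
Hypotheses (sigma_gt0 : 0 < sigma) (T_gt0 : 0 < T).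
Hypothesis VM : is_von_mises_process P W lam mu sigma theta.

Let b := drift lam mu.
Let mth0 : measurable_fun setT (theta 0).
Proof. by case: VM => mth _ _ _; exact: mth. Qed.
Let th0_indep : independent_of_process P (theta 0) W.
Proof. by case: VM. Qed.
Let cth w : {within `[0, +oo[, continuous (fun t => theta t w)}.
Proof. by case: VM. Qed.
Let cW w : {within `[0, +oo[, continuous (fun t => W t w)}.
Proof. by case: BM. Qed.

(** Its measurability is not given: the almost sure equation only provides a measurable null set
    covering the complement. *)
Definition sde_holds : set Omega := [set w | forall t, 0 <= t ->
  theta t w = theta 0 w +
    \int[lebesgue_measure]_(s in `[0, t]) drift lam mu (theta s w) +
    sigma * W t w].

Lemma sde_holds_ae : outer_le P (~` sde_holds) 0.
Proof. by case: VM => _ _ _ /outer_le_ae. Qed.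

Definition euler_path (N k : nat) (w : Omega) : R :=
  euler (drift lam mu) sigma (T / N%:R)
    (fun k => grid_incr W (T / N%:R) k w) (theta 0 w) k.

Local Notation Y := euler_path.
Local Notation past N := (grid_past W (theta 0) (T / N%:R)).

Let h_gt0 N : 0 < T / N.+1%:R. Proof. by rewrite divr_gt0. Qed.

Let NhE N : N.+1%:R * (T / N.+1%:R) = T. Proof. by rewrite mulrC divfK. Qed.

(** The adaptedness that [theta] itself is not known to have: step [k] of the scheme is a function
    of the initial value and the first [k] increments. *)
Lemma measurable_wrt_euler_path N k : measurable_wrt (past N.+1 k) (Y N.+1 k).
Proof.
elim: k => [|k IH]; first exact: measurable_wrt_initial.
have mY := measurable_wrtW (@grid_past_mono _ _ _ _ _ (T / N.+1%:R) k) IH.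
have mb : measurable_fun setT (drift lam mu).
  by apply: continuous_measurable_fun; exact: continuous_drift.
have mW := @measurable_wrt_grid_incr _ _ _ W (theta 0) (T / N.+1%:R) k.
exact: (measurable_funD (measurable_funD mY
  (measurable_funM (measurable_cst (T / N.+1%:R)) (measurableT_comp mb mY)))
  (measurable_funM (measurable_cst sigma) mW)).
Qed.

Lemma measurable_wrt_euler_comp (f : R -> R) N k : continuous f ->
  measurable_wrt (past N.+1 k) (fun w => f (Y N.+1 k w)).
Proof.
move=> cf; have mf : measurable_fun setT f by exact: continuous_measurable_fun.
exact: (measurableT_comp mf (@measurable_wrt_euler_path N k)).
Qed.

Lemma euler_path_cvg w e : sde_holds w -> 0 < e -> exists N0, forall N k,
  (N0 < N)%N -> (k <= N)%N ->
  `|Y N k w - theta (k%:R * (T / N%:R)) w| <= e.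
Proof.
move=> sdew e0.
have [N0 HN] := @euler_cvg _ (fun t => theta t w) (fun t => W t w) _ _ _
  (@cth w) (ltW lam_gt0) (drift_lipschitz mu (ltW lam_gt0)) sdew T e T_gt0 e0.
by exists N0 => N k N0N kN; exact: HN.
Qed.

Lemma euler_sum_ub (f : R -> R) N a : 0 < a -> continuous f ->
  (forall y, `|f y| <= 1) ->
  outer_le P [set w | a < `|\sum_(k < N.+1) f (Y N.+1 k w) *
    grid_incr W (T / N.+1%:R) k w|] (T / a ^+ 2).
Proof.
move=> a0 cf f1.
have [mS PS] := grid_sum_ub BM mth0 th0_indep (h_gt0 N)
  (fun k => @measurable_wrt_euler_comp f N k cf) (fun k w => f1 _) N.+1 a0.
apply: outer_le_measurable; last by rewrite NhE in PS.
exact: measurable_norm_gt.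
Qed.

Lemma euler_qv_sum_ub (f : R -> R) N a : 0 < a -> continuous f ->
  (forall y, `|f y| <= 1) ->
  outer_le P [set w | a < `|\sum_(k < N.+1) f (Y N.+1 k w) *
    (grid_incr W (T / N.+1%:R) k w ^+ 2 - T / N.+1%:R)|]
    (29 * T ^+ 2 / a ^+ 2 / N.+1%:R).
Proof.
move=> a0 cf f1.
have [mS PS] := grid_qv_sum_ub BM mth0 th0_indep (h_gt0 N)
  (fun k => @measurable_wrt_euler_comp f N k cf) (fun k w => f1 _) N.+1 a0.
apply: outer_le_measurable; first exact: measurable_norm_gt.
apply: (le_trans PS); rewrite lee_fin le_eqVlt; apply/orP; left; apply/eqP.
by field; rewrite nat1r pnatr_eq0/= gt_eqF.
Qed.

Lemma grid_qv_ub N a : 0 < a ->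
  outer_le P [set w | a < `|\sum_(k < N.+1)
    (grid_incr W (T / N.+1%:R) k w ^+ 2 - T / N.+1%:R)|]
    (29 * T ^+ 2 / a ^+ 2 / N.+1%:R).
Proof.
move=> a0; have cst_le1 (y : R) : `|1 : R| <= 1 by rewrite normr1.
apply: outer_leW (euler_qv_sum_ub N a0 (fun=> cvg_cst _) cst_le1) => //.
by move=> w /=; under [X in _ -> _ < `|X|]eq_bigr do rewrite mul1r.
Qed.

Lemma grid_incr_modulus w e : 0 < e -> exists N0, forall N k,
  (N0 <= N)%N -> (k < N.+1)%N -> `|grid_incr W (T / N.+1%:R) k w| <= e.
Proof.
move=> e0; have [N0 HN] := uniform_modulus_grid (@cW w) T_gt0 e0.
exists N0 => N k N0N kN; have [k0 kk1 k1T dk] := grid_point_bounds T_gt0 kN.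
apply: (HN N) => //.
- by rewrite (le_trans k0).
- by rewrite k0 (le_trans kk1).
- by rewrite dk ger0_norm// ltW.
Qed.

Let continuous_scale (f : R -> R) : continuous f -> continuous (fun y : R => f (2 * y)).
Proof.
move=> cf y; apply: (cvg_comp (fun y : R => 2 * y) f); last exact: cf.
by apply: cvgM; [exact: cvg_cst|exact: cvg_id].
Qed.

Definition information_bound (L u1 u2 : R) : set Omega := [set w |
  sigma ^+ 2 / 4 * T * (u1 ^+ 2 + u2 ^+ 2) <=
  (2 * sigma ^+ 2 + 2 * L ^+ 2 / sigma ^+ 2) *
  \int[lebesgue_measure]_(t in `[0, T])
    (u2 * cos (theta t w) - u1 * sin (theta t w)) ^+ 2].

(** The five bad events of a grid do not involve u1 and u2, so the bound holds in all directions at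
    once. If it fails for some u on a path, then on every fine grid either a bad event occurs or the
    discrete bound is contradicted, since the Riemann sums converge to the integral. *)
Lemma information_bound_outer_le L p : lam <= L -> 32 <= sigma ^+ 2 * T -> 0 < p ->
  outer_le P [set w | ~ forall u1 u2, information_bound L u1 u2 w]
    (2048 / (sigma ^+ 2 * T) + p).
Proof.
move=> lamL T32 p0; have L0 : 0 < L by exact: lt_le_trans lamL.
(* sigma A, sigma^2 V and, on fine grids, the Ito remainder are each at most sigma^2 T / 32, and so
   is 1 by assumption; together they stay below the sigma^2 T / 8 of the discrete bound. Each of the
   two martingale sums contributes T / A^2 = 1024 / (sigma^2 T). *)
pose A := sigma * T / 32; pose V := T / 32.
have A0 : 0 < A by rewrite divr_gt0// mulr_gt0.
have V0 : 0 < V by rewrite divr_gt0.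
pose h N := T / N.+1%:R.
pose xi N k w := grid_incr W (h N) k w.
pose B1 (f : R -> R) N :=
  [set w | A < `|\sum_(k < N.+1) f (2 * Y N.+1 k w) * xi N k w|].
pose B2 (f : R -> R) N := [set w |
  V < `|\sum_(k < N.+1) f (2 * Y N.+1 k w) * (xi N k w ^+ 2 - h N)|].
pose B3 N := [set w | V < `|\sum_(k < N.+1) (xi N k w ^+ 2 - h N)|].
pose B N := (B1 cos N `|` B1 sin N) `|` (B2 cos N `|` B2 sin N `|` B3 N).
pose C := 29 * T ^+ 2 / V ^+ 2.
have TA : T / A ^+ 2 = 1024 / (sigma ^+ 2 * T).
  by rewrite /A; field; rewrite !gt_eqF.
have BP N : (Num.truncn (C / (p / 3)) <= N)%N ->
    outer_le P (B N) (2048 / (sigma ^+ 2 * T) + p).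
  move=> HN; have Cp : C / N.+1%:R <= p / 3.
    by apply: truncn_divr_le => //; rewrite divr_gt0.
  have o1 := euler_sum_ub N A0 (continuous_scale (@continuous_cos R)) (fun y => cos_max (2 * y)).
  have o2 := euler_sum_ub N A0 (continuous_scale (@continuous_sin R)) (fun y => sin_max (2 * y)).
  have o3 := euler_qv_sum_ub N V0 (continuous_scale (@continuous_cos R)) (fun y => cos_max (2 * y)).
  have o4 := euler_qv_sum_ub N V0 (continuous_scale (@continuous_sin R)) (fun y => sin_max (2 * y)).
  have o5 := grid_qv_ub N V0.
  apply: outer_leW (outer_leU (outer_leU o1 o2) (outer_leU (outer_leU o3 o4) o5)) => //.
  have -> : 2048 / (sigma ^+ 2 * T) =
    1024 / (sigma ^+ 2 * T) + 1024 / (sigma ^+ 2 * T) by rewrite -mulrDl -natrD.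
  rewrite TA -/C; move: Cp; set q := C / _; set Z := 1024 / _ => Cp; lra.
apply: outer_leW (outer_leU sde_holds_ae (outer_le_lim_inf BP)); last by rewrite add0r.
move=> w /= Hw; have [sdew|] := pselect (sde_holds w); [right|by left].
move/existsNP : Hw => [u1 /existsNP[u2 /negP]].
rewrite -ltNge => info_lt.
pose K := 2 * sigma ^+ 2 + 2 * L ^+ 2 / sigma ^+ 2.
have K0 : 0 < K by rewrite addr_gt0// ?divr_gt0 ?mulr_gt0 ?exprn_gt0.
set I := Rintegral _ _ _ in info_lt; rewrite -/K in info_lt.
pose G (y : R) := (u2 * cos y - u1 * sin y) ^+ 2.
pose U := `|u1| + `|u2|.
have U0 : 0 <= U by rewrite addr_ge0.
have Glip x y : `|G x - G y| <= (2 * U ^+ 2) * `|x - y|.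
  have -> : G x - G y =
      (u2 * (cos x - cos y) - u1 * (sin x - sin y)) *
      ((u2 * cos x - u1 * sin x) + (u2 * cos y - u1 * sin y)) by rewrite /G; ring.
  have gU z : `|u2 * cos z - u1 * sin z| <= U.
    rewrite (le_trans (ler_normB _ _))// /U addrC lerD// normrM ler_piMr//.
      exact: sin_max.
    exact: cos_max.
  rewrite normrM.
  have -> : 2 * U ^+ 2 * `|x - y| = (U * `|x - y|) * (U + U) by ring.
  apply: ler_pM => //; last by rewrite (le_trans (ler_normD _ _))// lerD.
  rewrite (le_trans (ler_normB _ _))// /U mulrDl addrC !normrM lerD// ler_wpM2l//.
    exact: sin_lipschitz.
  exact: cos_lipschitz.
have cG : continuous G.
  move=> y; apply: (cvg_comp _ (fun z => z ^+ 2)); last exact: exprn_continuous.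
  by apply: cvgB; apply: cvgM; [exact: cvg_cst|exact: continuous_cos|
    exact: cvg_cst|exact: continuous_sin].
(* Half the deficit, divided by K: a Riemann sum within [gap] of the integral still violates the
   discrete bound. *)
pose gap := (sigma ^+ 2 / 4 * T * (u1 ^+ 2 + u2 ^+ 2) - K * I) / (2 * K).
have gap0 : 0 < gap by rewrite divr_gt0 ?subr_gt0 ?mulr_gt0.
have [N1 HN1] := @euler_riemann_sum_cvg _ (fun t => theta t w) (fun t => W t w)
  _ _ _ (@cth w) (ltW lam_gt0) (drift_lipschitz mu (ltW lam_gt0)) sdew G (2 * U ^+ 2)
  T gap T_gt0 gap0 (mulr_ge0 (ler0n _ 2) (sqr_ge0 U)) Glip cG.
have rem0 : 0 < sigma ^+ 2 * T / 32 by rewrite divr_gt0 ?mulr_gt0 ?exprn_gt0.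
have [D D0 HD] := ito_remainder_small (ltW T_gt0) (ltW sigma_gt0) (ltW L0) (ltW V0) rem0.
have [N2 HN2] := @grid_incr_modulus w D D0.
exists (maxn (maxn N1 N2) (Num.truncn (T / D))) => N; rewrite !geq_max.
move=> /andP[/andP[N1N N2N] DN]; apply: contrapT => notB.
have notlt (x y : R) : ~ (x < y) -> y <= x by move=> /negP; rewrite -leNgt.
have [nc1 ns1 nc2 ns2 n3] : [/\ ~ B1 cos N w, ~ B1 sin N w, ~ B2 cos N w,
    ~ B2 sin N w & ~ B3 N w].
  by split=> H; apply: notB; rewrite /B; [left; left|left; right|
    right; left; left|right; left; right|right; right].
have hD : h N <= D by exact: truncn_divr_le.
have yS k : Y N.+1 k.+1 w = Y N.+1 k w + h N * b (Y N.+1 k w) + sigma * xi N k w by [].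
have bL k : `|b (Y N.+1 k w)| <= L.
  by rewrite (le_trans (drift_le _ (ltW lam_gt0) _)).
have := @discrete_information_lb _ (fun k => Y N.+1 k w) (fun k => b (Y N.+1 k w))
  (fun k => xi N k w) N.+1 (h N) sigma L D A V (ltW (h_gt0 N)) (ltW sigma_gt0)
  (ltW L0) (ltW D0) yS bL (fun k kN => HN2 N k N2N kN) (notlt _ _ n3) u1 u2
  sigma_gt0 L0 (notlt _ _ nc1) (notlt _ _ ns1) (notlt _ _ nc2) (notlt _ _ ns2).
rewrite /h NhE -/K => H.
have {}H := H _.
have : 1 + sigma * A + sigma ^+ 2 * V + ito_remainder T (T / N.+1%:R) sigma L D V <=
    sigma ^+ 2 * T / 8.
  have := HD (h N) D; rewrite (ltW (h_gt0 N)) hD (ltW D0) lexx /h => /(_ isT isT).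
  rewrite /A /V; lra.
move=> /H {H}.
have := HN1 N.+1 N1N.
set S := T / N.+1%:R * _ => SI SK.
have SI' : S <= I + gap by rewrite addrC -lerBlDr; exact: le_trans (ler_norm _) SI.
have := ler_wpM2l (ltW K0) SI' => h1.
have KG : K * gap = (sigma ^+ 2 / 4 * T * (u1 ^+ 2 + u2 ^+ 2) - K * I) / 2.
  by rewrite /gap; field; rewrite gt_eqF.
have := le_trans SK h1; rewrite [K * (_ + _)]mulrDr KG; lra.
Qed.

End von_mises_path.

(** * Martingale part and quadratic variation *)

Lemma sum_blocks {R : realType} (F : nat -> R) (n m : nat) :
  \sum_(k < n * m) F k = \sum_(i < n) \sum_(j < m) F (i * m + j)%N.
Proof.
elim: n => [|n IH]; first by rewrite mul0n !big_ord0.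
rewrite big_ord_recr/= -IH -!(big_mkord xpredT F) mulSn addnC.
rewrite (big_cat_nat (n := (n * m)%N))//= ?leq_addr//; congr (_ + _).
rewrite -{1}[(n * m)%N]add0n big_addn addKn.
rewrite -(big_mkord xpredT (fun j => F (n * m + j)%N)).
by apply: eq_bigr => j _; rewrite addnC.
Qed.

Lemma measurable_wrt_grid_le {d : measure_display} {T : measurableType d}
    {R : realType} (W : R -> T -> R) (xi : T -> R) (h : R) (X : T -> R) (j k : nat) :
  (j <= k)%N -> measurable_wrt (grid_past W xi h j) X ->
  measurable_wrt (grid_past W xi h k) X.
Proof.
elim: k => [|k IH]; first by rewrite leqn0 => /eqP ->.
rewrite leq_eqVlt => /predU1P[->//|/IH jk mX].
exact: (measurable_wrtW (@grid_past_mono _ _ _ W xi h k) (jk mX)).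
Qed.

Lemma outer_le_neq {d : measure_display} {T : measurableType d} {R : realType}
    (P : probability T R) (X Z : T -> R) :
  (forall a p : R, 0 < a -> 0 < p -> outer_le P [set w | a < `|X w - Z w|] p) ->
  outer_le P [set w | X w <> Z w] 0.
Proof.
move=> H.
have H' n : outer_le P [set w | n.+1%:R^-1 < `|X w - Z w|] 0.
  by apply: outer_le_0 => p p0; apply: H => //; rewrite invr_gt0.
apply: outer_leW (outer_le_bigcup H') => // w /= XZ.
have XZ0 : 0 < `|X w - Z w| by rewrite normr_gt0 subr_eq0; exact/eqP.
exists (Num.truncn (`|X w - Z w|)^-1) => //=.
by rewrite -[ltRHS]invrK ltf_pV2 ?posrE ?invr_gt0// truncnS_gt.
Qed.

Section coarse_sums.
Context {d : measure_display} {Omega : measurableType d} {R : realType}.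
Variables (P : probability Omega R) (W : R -> Omega -> R).
Variables (lam mu sigma : R) (theta : R -> Omega -> R) (T : R).
Hypotheses (BM : is_brownian_motion P W) (lam_gt0 : 0 < lam).
Hypotheses (sigma_gt0 : 0 < sigma) (T_gt0 : 0 < T).
Hypothesis VM : is_von_mises_process P W lam mu sigma theta.

Let mth0 : measurable_fun setT (theta 0).
Proof. by case: VM => mth _ _ _; exact: mth. Qed.
Let th0_indep : independent_of_process P (theta 0) W.
Proof. by case: VM. Qed.
Let cth w : {within `[0, +oo[, continuous (fun t => theta t w)}.
Proof. by case: VM. Qed.
Let cdrift w := within_comp (@continuous_drift _ lam mu) (@cth w).

Local Notation Y := (euler_path W lam mu sigma theta T).

Definition time (n i : nat) : R := i%:R * (T / n.+1%:R).

(* The integrand is frozen on blocks of m.+1 steps of the fine grid, along which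
   the Euler scheme is computed, so that the sum is one over the coarse grid. *)
Lemma block_sum_ub (f : R -> R) (n m : nat) a : 0 < a -> continuous f ->
  (forall y, `|f y| <= 1) ->
  outer_le P [set w | a < `|\sum_(i < n.+1) f (Y (n.+1 * m.+1) (i * m.+1) w) *
    grid_incr W (T / n.+1%:R) i w|] (T / a ^+ 2).
Proof.
move=> a0 cf f1.
have [M ME] : exists M, (n.+1 * m.+1)%N = M.+1.
  by exists (n.+1 * m.+1).-1%N; rewrite prednK// muln_gt0.
have h0 : 0 < T / M.+1%:R by rewrite divr_gt0.
pose phi k w := f (Y M.+1 (k %/ m.+1 * m.+1)%N w).
have mphi k : measurable_wrt (grid_past W (theta 0) (T / M.+1%:R) k) (phi k).
  apply: (@measurable_wrt_grid_le _ _ _ W _ _ _ (k %/ m.+1 * m.+1)%N).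
    exact: leq_divM.
  exact: (measurable_wrt_euler_comp lam mu sigma).
have [mS PS] := grid_sum_ub BM mth0 th0_indep h0 mphi (fun k w => f1 _) M.+1 a0.
have NhE : M.+1%:R * (T / M.+1%:R) = T by rewrite mulrC divfK.
rewrite NhE in PS.
apply: outer_leW (outer_le_measurable (measurable_norm_gt a mS) PS) => //.
move=> w /=; congr (_ < `|_|).
rewrite -ME (sum_blocks (fun k => phi k w * grid_incr W (T / (n.+1 * m.+1)%:R) k w)); apply: eq_bigr => i _.
have blk j : (j < m.+1)%N -> ((i * m.+1 + j) %/ m.+1)%N = i.
  by move=> jm; rewrite divnMDl// divn_small// addn0.
under eq_bigr => j _ do rewrite /phi -ME blk//.
rewrite -mulr_sumr; congr (_ * _).
pose w' k := W (((i * m.+1 + k)%:R) * (T / (n.+1 * m.+1)%:R)) w.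
rewrite [RHS](eq_bigr (fun j : 'I_m.+1 => w' j.+1 - w' j)); last first.
  by move=> j _; rewrite /grid_incr /w' addnS.
rewrite -(big_mkord xpredT (fun j => w' j.+1 - w' j)) telescope_sumr// /w' /grid_incr.
have n0 : n.+1%:R != 0 :> R by rewrite pnatr_eq0.
have m0 : m.+1%:R != 0 :> R by rewrite pnatr_eq0.
by congr (W _ w - W _ w); rewrite ?addn0 ?natrD !natrM -?(natr1 i); field; rewrite !nat1r n0 m0.
Qed.

(** Letting m grow on a fixed coarse grid replaces the Euler values by those of [theta]; half of [a]
    absorbs the difference, whence the factor 4. The bound does not depend on n, so it survives the
    limit that defines the Ito integral. *)
Lemma coarse_sum_ub (f : R -> R) (n : nat) a : 0 < a ->
  (forall x y, `|f x - f y| <= `|x - y|) -> continuous f -> (forall y, `|f y| <= 1) ->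
  outer_le P [set w | a < `|\sum_(i < n.+1) f (theta (time n i) w) *
    (W (time n i.+1) w - W (time n i) w)|] (4 * T / a ^+ 2).
Proof.
move=> a0 flip cf f1; have a20 : 0 < a / 2 by rewrite divr_gt0.
have H m : (0 <= m)%N -> outer_le P [set w | a / 2 <
    `|\sum_(i < n.+1) f (Y (n.+1 * m.+1) (i * m.+1) w) *
      grid_incr W (T / n.+1%:R) i w|] (4 * T / a ^+ 2).
  move=> _; apply: outer_leW (block_sum_ub n m a20 cf f1) => //.
  by rewrite le_eqVlt; apply/orP; left; apply/eqP; field; rewrite gt_eqF.
apply: outer_leW (outer_leU (sde_holds_ae VM) (outer_le_lim_inf H)); last by rewrite add0r.
move=> w /= Hw.
have [sdew|] := pselect (sde_holds W lam mu sigma theta w); [right|by left].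
(* The coarse increments of the path stay fixed as m grows, so a uniform error of the scheme is
   multiplied by [D]; dividing by [D + 1] covers D = 0. *)
pose D := \sum_(i < n.+1) `|grid_incr W (T / n.+1%:R) i w|.
have D0 : 0 <= D by apply: sumr_ge0.
have D1 : 0 < D + 1 by rewrite ltr_wpDl.
have e0 : 0 < a / 2 / (D + 1) by rewrite divr_gt0.
have [N0 HN] := euler_path_cvg lam_gt0 T_gt0 VM sdew e0.
exists N0 => m N0m /=.
set S := \sum_(i < n.+1) _ in Hw; set S' := \sum_(i < n.+1) _.
have SS' : `|S - S'| <= a / 2.
  rewrite /S /S' -sumrB; apply: (le_trans (ler_norm_sum _ _ _)).
  apply: (@le_trans _ _ (\sum_(i < n.+1) (a / 2 / (D + 1)) *
      `|grid_incr W (T / n.+1%:R) i w|)).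
    apply: ler_sum => i _; rewrite -mulrBl normrM ler_wpM2r//.
    apply: (le_trans (flip _ _)); rewrite distrC.
    have -> : time n i = (i * m.+1)%:R * (T / (n.+1 * m.+1)%:R).
      rewrite /time !natrM; field.
      by rewrite !nat1r !pnatr_eq0.
    apply: HN; first by rewrite (leq_trans _ (leq_pmull _ _)).
    by rewrite leq_pmul2r// ltnW.
  by rewrite -mulr_sumr -/D -mulrA ler_piMr// ?(ltW a20)// ler_pdivrMl// mulr1 lerDl.
have : `|S| <= `|S'| + `|S - S'|.
  by rewrite -{1}(subrK S' S) addrC ler_normD.
lra.
Qed.

Lemma theta_incr w n i : sde_holds W lam mu sigma theta w ->
  theta (time n i.+1) w - theta (time n i) w =
  (\int[lebesgue_measure]_(s in `[0, time n i.+1]) drift lam mu (theta s w) -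
   \int[lebesgue_measure]_(s in `[0, time n i]) drift lam mu (theta s w)) +
  sigma * (W (time n i.+1) w - W (time n i) w).
Proof.
move=> sdew; have t0 k : 0 <= time n k by rewrite mulr_ge0// divr_ge0// ltW.
by rewrite (sdew _ (t0 i.+1)) (sdew _ (t0 i)); ring.
Qed.

Definition riemann_sum (f : R -> R) (n : nat) (w : Omega) : R :=
  \sum_(i < n.+1) f (theta (time n i) w) * (theta (time n i.+1) w - theta (time n i) w).

Definition cv_outer (X : nat -> Omega -> R) (Z : Omega -> R) : Prop :=
  forall e p : R, 0 < e -> 0 < p -> exists N, forall n, (N <= n)%N ->
    outer_le P [set w | e < `|X n w - Z w|] p.

(** [Z] is the integral of f(theta) against theta; without its drift part it is sigma times the
    integral against [W]. The tolerance is split into a / 4 for the limit of the sums, a / 4 for the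
    drift part and a / 2 for the noise. *)
Lemma score_ub (f : R -> R) (Z : Omega -> R) a p : 0 < a -> 0 < p ->
  (forall x y, `|f x - f y| <= `|x - y|) -> continuous f -> (forall y, `|f y| <= 1) ->
  cv_outer (riemann_sum f) Z ->
  outer_le P [set w | a < `|Z w - \int[lebesgue_measure]_(t in `[0, T])
    (f (theta t w) * drift lam mu (theta t w))|] (16 * sigma ^+ 2 * T / a ^+ 2 + p).
Proof.
move=> a0 p0 flip cf f1 cvZ; have a40 : 0 < a / 4 by rewrite divr_gt0.
have a20 : 0 < a / (2 * sigma) by rewrite divr_gt0// mulr_gt0.
have [N0 HN0] := cvZ _ _ a40 p0.
pose M n w := \sum_(i < n.+1) f (theta (time n i) w) *
    (W (time n i.+1) w - W (time n i) w).
have H n : (N0 <= n)%N -> outer_le P ([set w | a / (2 * sigma) < `|M n w|] `|`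
    [set w | a / 4 < `|riemann_sum f n w - Z w|]) (16 * sigma ^+ 2 * T / a ^+ 2 + p).
  move=> Nn; apply: outer_leW (outer_leU (coarse_sum_ub n a20 flip cf f1) (HN0 n Nn)) => //.
  rewrite lerD2r le_eqVlt; apply/orP; left; apply/eqP.
  by field; rewrite !gt_eqF.
apply: outer_leW (outer_leU (sde_holds_ae VM) (outer_le_lim_inf H)); last by rewrite add0r.
move=> w /= Hw.
have [sdew|] := pselect (sde_holds W lam mu sigma theta w); [right|by left].
have [N1 HN1] := riemann_stieltjes_sum_cvg (within_comp cf (@cth w)) (@cdrift w)
  (fun t => f1 _) T_gt0 a40.
exists (N0 + N1)%N => n Nn; have N1n : (N1 < n.+1)%N by rewrite ltnS (leq_trans (leq_addl _ _) Nn).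
have := HN1 n.+1 N1n; set S1 := \sum_(k < n.+1) _; set I := Rintegral _ _ _ => S1I.
have RE : riemann_sum f n w = S1 + sigma * M n w.
  rewrite /riemann_sum /S1 /M mulr_sumr -big_split/=; apply: eq_bigr => i _.
  by rewrite theta_incr// mulrDr mulrCA.
apply: contrapT => /not_orP[/negP + /negP]; rewrite -!leNgt => M_le R_le.
have sM : `|sigma * M n w| <= a / 2.
  rewrite normrM gtr0_norm// (le_trans (ler_wpM2l (ltW sigma_gt0) M_le))//.
  by rewrite le_eqVlt; apply/orP; left; apply/eqP; field; rewrite gt_eqF.
have : `|Z w - I| <= `|riemann_sum f n w - Z w| + `|S1 - I| + `|sigma * M n w|.
  have -> : Z w - I = - (riemann_sum f n w - Z w) + (S1 - I) + sigma * M n w.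
    by rewrite RE; ring.
  by rewrite (le_trans (ler_normD _ _))// lerD2r (le_trans (ler_normD _ _))// normrN.
by move: Hw; rewrite -/I; lra.
Qed.

(** The drift increments are at most lam times the mesh, so only the squares of the noise survive;
    they sum to sigma^2 T up to a deviation that tends to 0 in probability as the grid is
    refined. *)
Lemma quadratic_variation_limit (Z : Omega -> R) :
  cv_outer (fun n w =>
    \sum_(i < n.+1) (theta (time n i.+1) w - theta (time n i) w) ^+ 2) Z ->
  outer_le P [set w | Z w <> sigma ^+ 2 * T] 0.
Proof.
move=> cvZ; apply: outer_le_neq => a p a0 p0.
have s20 : 0 < sigma ^+ 2 by rewrite exprn_gt0.
have a40 : 0 < a / 4 by rewrite divr_gt0.
have p20 : 0 < p / 2 by rewrite divr_gt0.
pose V := a / (2 * sigma ^+ 2).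
have V0 : 0 < V by rewrite divr_gt0// mulr_gt0.
have [N0 HN0] := cvZ _ _ a40 p20.
pose C := 29 * T ^+ 2 / V ^+ 2.
pose xi n k w := grid_incr W (T / n.+1%:R) k w.
pose X n w := \sum_(i < n.+1) (theta (time n i.+1) w - theta (time n i) w) ^+ 2.
pose Q n w := \sum_(k < n.+1) (xi n k w ^+ 2 - T / n.+1%:R).
have H n : (maxn N0 (Num.truncn (C / (p / 2))) <= n)%N ->
    outer_le P ([set w | a / 4 < `|X n w - Z w|] `|` [set w | V < `|Q n w|]) p.
  rewrite geq_max => /andP[N0n Cn].
  have Cp : C / n.+1%:R <= p / 2 by exact: truncn_divr_le.
  apply: outer_leW (outer_leU (HN0 n N0n)
    (grid_qv_ub BM T_gt0 VM n V0)) => //.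
  rewrite -/C; move: Cp; set q := C / _ => Cp; lra.
apply: outer_leW (outer_leU (sde_holds_ae VM) (outer_le_lim_inf H)); last by rewrite add0r.
move=> w /= Hw.
have [sdew|] := pselect (sde_holds W lam mu sigma theta w); [right|by left].
(* If [D] bounds both the mesh and the increments of [W], the squared drift and the cross terms sum
   to at most K D = a / 4. *)
pose K := T * (lam ^+ 2 + 2 * sigma * lam).
have K0 : 0 < K by rewrite mulr_gt0// addr_gt0 ?exprn_gt0 ?mulr_gt0.
pose D := a / 4 / K; have D0 : 0 < D by rewrite divr_gt0.
have [N1 HN1] := grid_incr_modulus BM T_gt0 w D0.
exists (maxn N1 (Num.truncn (T / D))) => n; rewrite geq_max => /andP[N1n Dn].
have hD : T / n.+1%:R <= D by exact: truncn_divr_le.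
have h0 : 0 < T / n.+1%:R by rewrite divr_gt0.
apply: contrapT => /not_orP[/negP + /negP]; rewrite -!leNgt => XZ QV.
pose I i := \int[lebesgue_measure]_(s in `[0, time n i.+1]) drift lam mu (theta s w) -
   \int[lebesgue_measure]_(s in `[0, time n i]) drift lam mu (theta s w).
have I_le i : (i < n.+1)%N -> `|I i| <= T / n.+1%:R * lam.
  move=> ilt; have [k0 kk1 k1T dk] := grid_point_bounds T_gt0 ilt.
  have kk : 0 <= time n i <= time n i.+1 by rewrite k0.
  have := @Rintegral_incr _ _ _ _ 0 lam (@cdrift w) kk.
  rewrite mulr0 subr0 /time dk; apply=> u _; rewrite subr0.
  exact: drift_le (ltW lam_gt0) _.
have XE : X n w - sigma ^+ 2 * T = sigma ^+ 2 * Q n w +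
    \sum_(i < n.+1) (I i ^+ 2 + 2 * sigma * I i * xi n i w).
  have {1}-> : T = \sum_(k < n.+1) T / n.+1%:R.
    by rewrite sumr_const card_ord -[_ *+ n.+1]mulr_natl mulrC divfK.
  rewrite /X /Q !mulr_sumr -sumrB -big_split/=; apply: eq_bigr => i _.
  rewrite theta_incr// -/(I i).
  have -> : W (time n i.+1) w - W (time n i) w = xi n i w by [].
  by ring.
have rem_le : `|\sum_(i < n.+1) (I i ^+ 2 + 2 * sigma * I i * xi n i w)| <= a / 4.
  apply: (le_trans (ler_norm_sum _ _ _)).
  apply: (@le_trans _ _ (\sum_(i < n.+1) T / n.+1%:R * (lam ^+ 2 + 2 * sigma * lam) * D)).
    apply: ler_sum => i _; have := I_le i (ltn_ord i).
    have := HN1 n i N1n (ltn_ord i); rewrite -/(xi n i w).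
    move: (I i) (xi n i w) => x y yD xL.
    have h0' := ltW h0; have s0' := ltW sigma_gt0; have l0' := ltW lam_gt0.
    apply: (le_trans (ler_normD _ _)).
    have -> : T / n.+1%:R * (lam ^+ 2 + 2 * sigma * lam) * D =
      T / n.+1%:R * lam * (D * lam) + 2 * sigma * (T / n.+1%:R * lam) * D by ring.
    apply: lerD.
      rewrite normrX expr2; apply: ler_pM => //; apply: (le_trans xL).
      by rewrite ler_wpM2r.
    rewrite !normrM (ger0_norm s0') (@ger0_norm _ 2)//; apply: ler_pM => //.
      by rewrite !mulr_ge0.
    by rewrite ler_wpM2l// mulr_ge0.
  rewrite sumr_const card_ord -[_ *+ n.+1]mulr_natl /D /K.
  rewrite le_eqVlt; apply/orP; left; apply/eqP.
  by field; rewrite nat1r pnatr_eq0/= !gt_eqF// addr_gt0// !mulr_gt0.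
have sQ : `|sigma ^+ 2 * Q n w| <= a / 2.
  rewrite normrM gtr0_norm// (le_trans (ler_wpM2l (ltW s20) QV))//.
  by rewrite le_eqVlt; apply/orP; left; apply/eqP; rewrite /V; field; rewrite gt_eqF.
have : `|Z w - sigma ^+ 2 * T| <= `|X n w - Z w| + `|sigma ^+ 2 * Q n w| + a / 4.
  have -> : Z w - sigma ^+ 2 * T = - (X n w - Z w) + sigma ^+ 2 * Q n w +
    \sum_(i < n.+1) (I i ^+ 2 + 2 * sigma * I i * xi n i w).
    by rewrite -addrA -XE; ring.
  rewrite (le_trans (ler_normD _ _))// lerD//.
  by rewrite (le_trans (ler_normD _ _))// normrN.
by move: Hw; lra.
Qed.

End coarse_sums.

(** * Ito integrals of the drifts *)

Section convergence_in_outer_probability.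
Context {d : measure_display} {Omega : measurableType d} {R : realType}.
Variable P : probability Omega R.
Implicit Types (X : nat -> Omega -> R) (Z : Omega -> R).

Lemma cv_outer_linear X X' Z Z' (a a' : R) :
  cv_outer P X Z -> cv_outer P X' Z' ->
  cv_outer P (fun n w => a * X n w + a' * X' n w) (fun w => a * Z w + a' * Z' w).
Proof.
move=> XZ XZ' e p e0 p0.
have D0 : 0 < `|a| + `|a'| + 1 by rewrite ltr_wpDl// addr_ge0.
have e'0 : 0 < e / (`|a| + `|a'| + 1) by rewrite divr_gt0.
have p20 : 0 < p / 2 by rewrite divr_gt0.
have [N HN] := XZ _ _ e'0 p20; have [N' HN'] := XZ' _ _ e'0 p20.
exists (maxn N N') => n; rewrite geq_max => /andP[Nn N'n].
apply: outer_leW (outer_leU (HN n Nn) (HN' n N'n)); last by rewrite -splitr.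
move=> w /= Hw; apply: contrapT => /not_orP[/negP + /negP]; rewrite -!leNgt => h h'.
move: Hw; apply/negP; rewrite -leNgt.
have -> : a * X n w + a' * X' n w - (a * Z w + a' * Z' w) =
  a * (X n w - Z w) + a' * (X' n w - Z' w) by ring.
rewrite (le_trans (ler_normD _ _))// !normrM.
apply: (@le_trans _ _ (`|a| * (e / (`|a| + `|a'| + 1)) + `|a'| * (e / (`|a| + `|a'| + 1)))).
  by rewrite lerD// ler_wpM2l.
by rewrite -mulrDl mulrCA ler_piMr ?(ltW e0)// ler_pdivrMr// mul1r lerDl.
Qed.

Lemma cv_outer_unique X Z Z' : cv_outer P X Z -> cv_outer P X Z' ->
  outer_le P [set w | Z w <> Z' w] 0.
Proof.
move=> XZ XZ'; apply: outer_le_neq => a p a0 p0.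
have a20 : 0 < a / 2 by rewrite divr_gt0.
have p20 : 0 < p / 2 by rewrite divr_gt0.
have [N HN] := XZ _ _ a20 p20; have [N' HN'] := XZ' _ _ a20 p20.
apply: outer_leW (outer_leU (HN (maxn N N') (leq_maxl _ _))
  (HN' (maxn N N') (leq_maxr _ _))); last by rewrite -splitr.
move=> w /= Hw; apply: contrapT => /not_orP[/negP + /negP]; rewrite -!leNgt => h h'.
move: Hw; apply/negP; rewrite -leNgt -(subrKA (X (maxn N N') w)).
by rewrite (le_trans (ler_normD _ _))// (splitr a) lerD// distrC.
Qed.

Lemma eq_cv_outer X X' Z : (forall n w, X n w = X' n w) ->
  cv_outer P X Z -> cv_outer P X' Z.
Proof.
move=> XX' XZ e p e0 p0; have [N HN] := XZ e p e0 p0; exists N => n Nn.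
by apply: outer_leW (HN n Nn) => // w /=; rewrite XX'.
Qed.

Variable T : R.
Hypothesis T_gt0 : 0 < T.

Definition uniform_partition (n : nat) : seq R := mkseq (fun i => time T n i.+1) n.+1.

Lemma size_uniform_partition n : size (uniform_partition n) = n.+1.
Proof. exact: size_mkseq. Qed.

Lemma partition_timeE n i : (i <= n.+1)%N ->
  partition_time (uniform_partition n) i = time T n i.
Proof.
case: i => [_|i ilt]; first by rewrite /partition_time /time mul0r.
by rewrite /partition_time /= nth_mkseq.
Qed.

Lemma time_incr n i : time T n i.+1 - time T n i = T / n.+1%:R.
Proof. by rewrite /time -natr1 mulrDl mul1r [X in X - _]addrC addrK. Qed.

Lemma itv_uniform_partition n : itv_partition 0 T (uniform_partition n).
Proof.
split.
  apply/(pathP 0) => i; rewrite size_uniform_partition => ilt.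
  have := partition_timeE (ltnW ilt); rewrite /partition_time => ->.
  rewrite nth_mkseq// -subr_gt0 time_incr divr_gt0//.
rewrite -nth_last size_uniform_partition nth_mkseq//.
by rewrite /time mulrC divfK.
Qed.

Lemma limit_of_partitions_cv (S : seq R -> Omega -> R) (I : Omega -> R) :
  (forall n, measurable_fun setT (S (uniform_partition n))) ->
  limit_in_probability_of_partitions P T S I ->
  cv_outer P (fun n => S (uniform_partition n)) I.
Proof.
move=> mS [mI SI] e p e0 p0; have [h h0 Hh] := SI e p e0 p0.
(* The mesh condition is strict, hence h / 2. *)
exists (Num.truncn (T / (h / 2))) => n Nn.
have hn : T / n.+1%:R <= h / 2 by apply: truncn_divr_le => //; rewrite divr_gt0.
have mesh : mesh_lt (uniform_partition n) h.
  move=> i; rewrite size_uniform_partition => ilt.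
  rewrite !partition_timeE// ?(ltnW ilt)// time_incr (le_lt_trans hn)//.
  by rewrite ltr_pdivrMr// ltr_pMr// ltr1n.
apply: outer_le_measurable; last exact: Hh (itv_uniform_partition n) mesh.
by apply: measurable_norm_gt; exact: measurable_funB.
Qed.

Lemma ito_integral_cv (Y X : R -> Omega -> R) (I : Omega -> R) :
  (forall t, 0 <= t -> measurable_fun setT (Y t)) ->
  (forall t, 0 <= t -> measurable_fun setT (X t)) ->
  is_ito_integral P T Y X I ->
  cv_outer P (fun n w => \sum_(i < n.+1) Y (time T n i) w *
    (X (time T n i.+1) w - X (time T n i) w)) I.
Proof.
move=> mY mX ito.
have t0 n i : 0 <= time T n i by rewrite mulr_ge0// divr_ge0// ltW.
have sumE n w : \sum_(i < size (uniform_partition n))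
      Y (partition_time (uniform_partition n) i) w *
      (X (partition_time (uniform_partition n) i.+1) w -
       X (partition_time (uniform_partition n) i) w) =
    \sum_(i < n.+1) Y (time T n i) w * (X (time T n i.+1) w - X (time T n i) w).
  rewrite size_uniform_partition; apply: eq_bigr => i _.
  by rewrite !partition_timeE// ltnW.
apply: eq_cv_outer (limit_of_partitions_cv _ ito) => //.
move=> n; apply: eq_measurable_fun (fun w _ => esym (sumE n w)) _.
apply: measurable_sum => i; apply: measurable_funM; first exact: mY.
by apply: measurable_funB; exact: mX.
Qed.

Lemma quadratic_variation_cv (X : R -> Omega -> R) (Q : Omega -> R) :
  (forall t, 0 <= t -> measurable_fun setT (X t)) ->
  is_quadratic_variation P T X Q ->
  cv_outer P (fun n w => \sum_(i < n.+1)
    (X (time T n i.+1) w - X (time T n i) w) ^+ 2) Q.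
Proof.
move=> mX qv.
have t0 n i : 0 <= time T n i by rewrite mulr_ge0// divr_ge0// ltW.
have sumE n w : \sum_(i < size (uniform_partition n))
      (X (partition_time (uniform_partition n) i.+1) w -
       X (partition_time (uniform_partition n) i) w) ^+ 2 =
    \sum_(i < n.+1) (X (time T n i.+1) w - X (time T n i) w) ^+ 2.
  rewrite size_uniform_partition; apply: eq_bigr => i _.
  by rewrite !partition_timeE// ltnW.
apply: eq_cv_outer (limit_of_partitions_cv _ qv) => //.
move=> n; apply: eq_measurable_fun (fun w _ => esym (sumE n w)) _.
apply: measurable_sum => i; apply: measurable_funX.
by apply: measurable_funB; exact: mX.
Qed.

End convergence_in_outer_probability.

(** If g (a, b) is nonzero, continuity makes g differ from it by less than |g (a, b)| nearby, so g
    is nonzero at close rational points, which lie in A and B by openness. *)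
Lemma within_eq0_rat {R : realType} (A B : set R) (g : R * R -> R) :
  open A -> open B -> {within A `*` B, continuous g} ->
  (forall q r : rat, A (ratr q) -> B (ratr r) -> g (ratr q, ratr r) = 0) ->
  forall a b, A a -> B b -> g (a, b) = 0.
Proof.
move=> oA oB cg g0 a b Aa Bb; apply: contrapT => /eqP gab0.
have e0 : 0 < `|g (a, b)| by rewrite normr_gt0.
move/subspace_continuousP : cg => /(_ (a, b) (conj Aa Bb)).
move=> /cvgrPdist_lt/(_ _ e0); rewrite near_withinE => /nbhs_ballP[r /= r0 Hr].
have [s /= s0 Hs] : nbhs_ball a A by apply/nbhs_ballP; move: oA; rewrite openE; exact.
have [t /= t0 Ht] : nbhs_ball b B by apply/nbhs_ballP; move: oB; rewrite openE; exact.
have rat_near (c x : R) : 0 < x -> exists q : rat, `|c - ratr q| < x.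
  move=> x0; have : c - x < c + x by lra.
  move=> /rat_in_itvoo[q]; rewrite in_itv/= => /andP[h1 h2]; exists q.
  by rewrite ltr_norml; apply/andP; split; lra.
have [q Hq] := rat_near a (Num.min r s) ltac:(by rewrite lt_min r0).
have [q' Hq'] := rat_near b (Num.min r t) ltac:(by rewrite lt_min r0).
move: Hq Hq'; rewrite !lt_min => /andP[qr qs] /andP[q'r q't].
have Aq : A (ratr q) by exact: Hs.
have Bq : B (ratr q') by exact: Ht.
have : `|g (a, b) - g (ratr q, ratr q')| < `|g (a, b)|.
  exact: (Hr (ratr q, ratr q') (conj qr q'r) (conj Aq Bq)).
by rewrite g0// subr0 ltxx.
Qed.

Section drift_integral.
Context {d : measure_display} {Omega : measurableType d} {R : realType}.
Variables (P : probability Omega R) (theta : R -> Omega -> R) (T : R).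
Variables (Lam Mu : set R) (J : R -> R -> Omega -> R).
Hypotheses (T_gt0 : 0 < T) (oLam : open Lam) (oMu : open Mu).
Hypothesis J_cv : forall lam mu, Lam lam -> Mu mu ->
  cv_outer P (riemann_sum theta T (drift lam mu)) (J lam mu).
Hypothesis J_cont : forall w,
  {within Lam `*` Mu, continuous (fun p : R * R => J p.1 p.2 w)}.

Lemma driftE (lam mu y : R) :
  drift lam mu y = - (lam * cos mu) * sin y + (lam * sin mu) * cos y.
Proof. by rewrite /drift sinB; ring. Qed.

Lemma riemann_sum_linear (f g : R -> R) (a c : R) n w :
  riemann_sum theta T (fun y => a * f y + c * g y) n w =
  a * riemann_sum theta T f n w + c * riemann_sum theta T g n w.
Proof.
by rewrite /riemann_sum !mulr_sumr -big_split/=; apply: eq_bigr => i _; ring.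
Qed.

(* The exceptional null set is a union over rational parameters; continuity of J
   extends the identity to all the others. *)
Lemma drift_integral_linear lam0 mu0 : Lam lam0 -> 0 < lam0 -> Mu mu0 ->
  exists Zs Zc, [/\ cv_outer P (riemann_sum theta T sin) Zs,
    cv_outer P (riemann_sum theta T cos) Zc &
    outer_le P [set w | ~ forall lam mu, Lam lam -> Mu mu ->
      J lam mu w = - (lam * cos mu) * Zs w + (lam * sin mu) * Zc w] 0].
Proof.
move=> Lam0 lam0_gt0 Mu0.
have [r /= r0 Hr] : nbhs_ball mu0 Mu.
  by apply/nbhs_ballP; move: oMu; rewrite openE; exact.
(* A second angle in the open set [Mu], with sin (mu1 - mu0) > 0 because s lies in (0, 1]. The
   drifts at the two angles span sin and cos, and solving the 2 x 2 system divides by lam0 sin s. *)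
pose s := Num.min 1 (r / 2); pose mu1 := mu0 + s.
have s0 : 0 < s by rewrite lt_min ltr01 divr_gt0.
have s1 : s <= 1 by rewrite ge_min lexx.
have Mu1 : Mu mu1.
  apply: Hr; rewrite /ball/= /mu1 opprD addrA subrr sub0r normrN gtr0_norm//.
  by rewrite (@le_lt_trans _ _ (r / 2))// ?ge_min ?lexx ?orbT// ltr_pdivrMr// ltr_pMr// ltr1n.
have D0 : 0 < sin s.
  by apply: sin2_gt0; rewrite s0 (le_lt_trans s1)// ltr1n.
have DE : sin s = sin mu1 * cos mu0 - cos mu1 * sin mu0.
  by rewrite -sinB /mu1 addrAC subrr add0r.
pose D := lam0 * sin s; have D_neq0 : D != 0 by rewrite gt_eqF// mulr_gt0.
have lin (a c : R) f : (forall y, f y = a * drift lam0 mu0 y + c * drift lam0 mu1 y) ->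
    cv_outer P (riemann_sum theta T f)
      (fun w => a * J lam0 mu0 w + c * J lam0 mu1 w).
  move=> fE; apply: eq_cv_outer (cv_outer_linear a c (J_cv Lam0 Mu0) (J_cv Lam0 Mu1)) => n w.
  rewrite -riemann_sum_linear; congr riemann_sum; exact/funext.
exists (fun w => - (sin mu1 / D) * J lam0 mu0 w + (sin mu0 / D) * J lam0 mu1 w).
exists (fun w => - (cos mu1 / D) * J lam0 mu0 w + (cos mu0 / D) * J lam0 mu1 w).
set Zs := (X in cv_outer P (riemann_sum theta T sin) X).
set Zc := (X in cv_outer P (riemann_sum theta T cos) X).
have n1 : lam0 != 0 by rewrite gt_eqF.
have n2 : sin mu1 * cos mu0 - cos mu1 * sin mu0 != 0 by rewrite -DE gt_eqF.
have cs : cv_outer P (riemann_sum theta T sin) Zs.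
  apply: lin => y; rewrite !driftE /D DE; field.
  by rewrite n1 n2.
have cc : cv_outer P (riemann_sum theta T cos) Zc.
  apply: lin => y; rewrite !driftE /D DE; field.
  by rewrite n1 n2.
split => //.
have null lam mu : Lam lam -> Mu mu -> outer_le P [set w | J lam mu w <>
    - (lam * cos mu) * Zs w + (lam * sin mu) * Zc w] 0.
  move=> Llam Mmu; apply: cv_outer_unique (J_cv Llam Mmu) _.
  apply: eq_cv_outer (cv_outer_linear (- (lam * cos mu)) (lam * sin mu) cs cc) => n w.
  rewrite -riemann_sum_linear; congr riemann_sum; apply/funext => y.
  by rewrite driftE.
(* Pairs of rationals are enumerated through [unpickle]; an integer that codes no pair gives the
   empty set. *)
pose A k := if unpickle k is Some (q, q') then
  [set w | [/\ Lam (ratr q), Mu (ratr q') & J (ratr q) (ratr q') w <>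
    - (ratr q * cos (ratr q')) * Zs w + (ratr q * sin (ratr q')) * Zc w]] else set0.
have A0 k : outer_le P (A k) 0.
  rewrite /A; case: unpickle => [[q q']|]; last first.
    by apply: outer_le_measurable => //; rewrite measure0.
  have [[Lq Mq]|H] := pselect (Lam (ratr q) /\ Mu (ratr q')).
    by apply: outer_leW (null _ _ Lq Mq) => // w [].
  apply: (@outer_leW _ _ _ _ _ set0 0 0) => //; first by move=> w [? ? _]; apply: H.
  by apply: outer_le_measurable => //; rewrite measure0.
apply: outer_leW (outer_le_bigcup A0) => // w /= Hw.
apply: contrapT => notA; apply: Hw => lam mu Llam Mmu.
apply/eqP; rewrite -subr_eq0; apply/eqP.
apply: (@within_eq0_rat _ Lam Mu (fun p => J p.1 p.2 w -
  (- (p.1 * cos p.2) * Zs w + (p.1 * sin p.2) * Zc w))) => //.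
- move=> p; apply: cvgB; first exact: J_cont.
  apply: (@continuous_subspaceT _ _ _ (fun p : R * R =>
    - (p.1 * cos p.2) * Zs w + (p.1 * sin p.2) * Zc w)).
  move=> {}p; apply: cvgD; apply: cvgM; try exact: cvg_cst.
    apply: cvgN; apply: cvgM; first exact: cvg_fst.
    by apply: (cvg_comp snd cos); [exact: cvg_snd|exact: continuous_cos].
  apply: cvgM; first exact: cvg_fst.
  by apply: (cvg_comp snd sin); [exact: cvg_snd|exact: continuous_sin].
- move=> q q' Lq Mq /=; apply/eqP; rewrite subr_eq0; apply/eqP.
  have [k kE] : exists k, unpickle k = Some (q, q') by eexists; exact: pickleK.
  by apply: contrapT => H; apply: notA; exists k; [exact: I|rewrite /A kE].
Qed.

End drift_integral.

(** * The likelihood *)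

Section likelihood.
Context {R : realType}.
Variables (x : R -> R) (T sigma : R).
Hypotheses (cx : {within `[0, +oo[, continuous x}) (T_gt0 : 0 < T).
Hypothesis sigma_gt0 : 0 < sigma.
Local Notation int g := (\int[lebesgue_measure]_(t in `[0, T]) g t).

Lemma Rintegral_lin (f g : R -> R) (a c : R) :
  {within `[0, +oo[, continuous f} -> {within `[0, +oo[, continuous g} ->
  int (fun t => a * f t + c * g t) = a * int f + c * int g.
Proof.
move=> cf cg.
have ig (k : R -> R) : {within `[0, +oo[, continuous k} ->
    lebesgue_measure.-integrable `[0, T] (EFin \o k).
  move=> ck; apply: continuous_compact_integrable; first exact: segment_compact.
  apply: continuous_subspaceW ck => u /=.
  by rewrite !in_itv/= => /andP[->].
have iM (k : R) (u : R -> R) : {within `[0, +oo[, continuous u} ->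
    lebesgue_measure.-integrable `[0, T] (EFin \o (fun t => k * u t)).
  by move=> cu; apply: ig => t; apply: cvgM; [exact: cvg_cst|exact: cu].
rewrite RintegralD//; [|exact: iM|exact: iM].
by rewrite !RintegralZl//; exact: ig.
Qed.

Definition Iss := int (fun t => sin (x t) ^+ 2).
Definition Isc := int (fun t => sin (x t) * cos (x t)).
Definition Icc := int (fun t => cos (x t) ^+ 2).

Let cs : {within `[0, +oo[, continuous (fun t => sin (x t))}.
Proof. exact: (within_comp (@continuous_sin R) cx). Qed.
Let cc : {within `[0, +oo[, continuous (fun t => cos (x t))}.
Proof. exact: (within_comp (@continuous_cos R) cx). Qed.
Let css : {within `[0, +oo[, continuous (fun t => sin (x t) ^+ 2)}.
Proof. exact: (within_comp (@exprn_continuous R 2) cs). Qed.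
Let ccc : {within `[0, +oo[, continuous (fun t => cos (x t) ^+ 2)}.
Proof. exact: (within_comp (@exprn_continuous R 2) cc). Qed.
Let csc : {within `[0, +oo[, continuous (fun t => sin (x t) * cos (x t))}.
Proof. by move=> t; apply: cvgM; [exact: cs|exact: cc]. Qed.

Lemma int_quadratic (a c : R) :
  int (fun t => (a * sin (x t) + c * cos (x t)) ^+ 2) =
  a ^+ 2 * Iss + 2 * a * c * Isc + c ^+ 2 * Icc.
Proof.
have clin : {within `[0, +oo[, continuous
    (fun t => a ^+ 2 * sin (x t) ^+ 2 + 2 * a * c * (sin (x t) * cos (x t)))}.
  move=> t; apply: cvgD; apply: cvgM; try exact: cvg_cst; first exact: css.
  exact: csc.
rewrite /Iss /Isc /Icc -Rintegral_lin// -[X in X + _]mul1r -Rintegral_lin//.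
by apply: eq_Rintegral => t _; ring.
Qed.

Lemma int_sin_drift (a c : R) :
  int (fun t => sin (x t) * (a * sin (x t) + c * cos (x t))) = a * Iss + c * Isc.
Proof.
by rewrite /Iss /Isc -Rintegral_lin//; apply: eq_Rintegral => t _; ring.
Qed.

Lemma int_cos_drift (a c : R) :
  int (fun t => cos (x t) * (a * sin (x t) + c * cos (x t))) = a * Isc + c * Icc.
Proof.
by rewrite /Icc /Isc -Rintegral_lin//; apply: eq_Rintegral => t _; ring.
Qed.

(** [Zs] and [Zc] stand for the integrals of sin theta and cos theta against theta. This expression
    is free of [J] and continuous on the whole plane. *)
Definition likelihood_form (Zs Zc lam mu : R) : R :=
  (sigma ^+ 2)^-1 * (- (lam * cos mu) * Zs + (lam * sin mu) * Zc) -
  (2 * sigma ^+ 2)^-1 * ((lam * cos mu) ^+ 2 * Iss -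
    2 * (lam * cos mu) * (lam * sin mu) * Isc + (lam * sin mu) ^+ 2 * Icc).

Lemma log_likelihoodE (J : R -> R -> (R -> R) -> R) (Zs Zc lam mu : R) :
  J lam mu x = - (lam * cos mu) * Zs + (lam * sin mu) * Zc ->
  log_likelihood sigma T J lam mu x = likelihood_form Zs Zc lam mu.
Proof.
move=> JE; rewrite /log_likelihood /likelihood_form JE; congr (_ - _ * _).
under eq_Rintegral do rewrite driftE.
by rewrite int_quadratic; ring.
Qed.

(** In the coordinates v = (a, c), sigma^2 times the difference is half the information [Q] in the
    direction v - v0 plus a term linear in the score errors [E1] and [E2]. At distance at least r
    the quadratic term wins, because [eta] is a small multiple of T r. *)
Lemma likelihood_form_lt (Zs Zc lam0 mu0 lam mu K eta r : R) :
  0 < K -> 0 < r -> eta = sigma ^+ 2 / 4 / K * T * r / 4 ->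
  (forall u1 u2, sigma ^+ 2 / 4 * T * (u1 ^+ 2 + u2 ^+ 2) <=
     K * int (fun t => (u2 * cos (x t) - u1 * sin (x t)) ^+ 2)) ->
  `|Zs - int (fun t => sin (x t) * drift lam0 mu0 (x t))| <= eta ->
  `|Zc - int (fun t => cos (x t) * drift lam0 mu0 (x t))| <= eta ->
  r ^+ 2 <= (lam * cos mu - lam0 * cos mu0) ^+ 2 +
    (lam * sin mu - lam0 * sin mu0) ^+ 2 ->
  likelihood_form Zs Zc lam mu < likelihood_form Zs Zc lam0 mu0.
Proof.
move=> K0 r0 etaE info.
under [X in Zs - X]eq_Rintegral do rewrite driftE.
under [X in Zc - X]eq_Rintegral do rewrite driftE.
rewrite int_sin_drift int_cos_drift /likelihood_form.
set a := lam * cos mu; set c := lam * sin mu.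
set a0 := lam0 * cos mu0; set c0 := lam0 * sin mu0 => Zs_le Zc_le r_le.
have := info (a - a0) (c - c0).
rewrite [X in K * X](_ : _ =
    int (fun t => (- (a - a0) * sin (x t) + (c - c0) * cos (x t)) ^+ 2)); last first.
  by apply: eq_Rintegral => t _; congr (_ ^+ 2); ring.
rewrite int_quadratic.
set da := a - a0 in r_le *; set dc := c - c0 in r_le *.
set Q := _ + _ + _ * Icc => infoQ.
have s20 : 0 < sigma ^+ 2 by rewrite exprn_gt0.
pose kap := sigma ^+ 2 / 4 / K.
have kap0 : 0 < kap by rewrite !divr_gt0.
have Q_ge : kap * T * (da ^+ 2 + dc ^+ 2) <= Q.
  by rewrite /kap -(ler_pM2l K0); move: infoQ; rewrite {1}(_ : sigma ^+ 2 / 4 * T =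
    K * (sigma ^+ 2 / 4 / K * T)) -?mulrA//; field; rewrite gt_eqF.
rewrite -subr_gt0 -(pmulr_rgt0 _ s20).
set E1 := Zs - _ in Zs_le; set E2 := Zc - _ in Zc_le.
have -> : sigma ^+ 2 * ((sigma ^+ 2)^-1 * (- a0 * Zs + c0 * Zc) -
    (2 * sigma ^+ 2)^-1 * (a0 ^+ 2 * Iss - 2 * a0 * c0 * Isc + c0 ^+ 2 * Icc) -
    ((sigma ^+ 2)^-1 * (- a * Zs + c * Zc) -
     (2 * sigma ^+ 2)^-1 * (a ^+ 2 * Iss - 2 * a * c * Isc + c ^+ 2 * Icc))) =
    Q / 2 + da * E1 - dc * E2.
  by rewrite /Q /E1 /E2 /da /dc; field; rewrite gt_eqF.
pose q := `|da| + `|dc|.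
have q0 : 0 <= q by rewrite addr_ge0.
have qE : - (da * E1 - dc * E2) <= q * eta.
  rewrite (le_trans (ler_norm _))// normrN (le_trans (ler_normB _ _))//.
  by rewrite /q [leRHS]mulrDl !normrM; apply: lerD; exact: ler_wpM2l.
have q2 : q ^+ 2 <= 2 * (da ^+ 2 + dc ^+ 2).
  rewrite /q -[da ^+ 2]real_normK ?num_real// -[dc ^+ 2]real_normK ?num_real//.
  by have := sqr_ge0 (`|da| - `|dc|); lra.
have D0 : 0 < da ^+ 2 + dc ^+ 2 by apply: lt_le_trans r_le; rewrite exprn_gt0.
(* From (q / 2 - r)^2 >= 0 and r^2 <= |v - v0|^2. Then q eta is at most 3/8 of kap T |v - v0|^2,
   less than the 1/2 provided by Q / 2. *)
have qr : q * r <= 3 / 2 * (da ^+ 2 + dc ^+ 2).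
  by have := sqr_ge0 (q / 2 - r); lra.
have kT0 : 0 < kap * T by rewrite mulr_gt0.
have := ler_wpM2l (ltW kT0) qr => qr'.
have etaE' : q * eta = kap * T * (q * r) / 4 by rewrite etaE /kap; field; rewrite gt_eqF.
have kD : 0 < kap * T * (da ^+ 2 + dc ^+ 2) by rewrite mulr_gt0.
lra.
Qed.

Lemma continuous_likelihood_form (Zs Zc : R) :
  continuous (fun p : R * R => likelihood_form Zs Zc p.1 p.2).
Proof.
have cfst : continuous (fst : R * R -> R) by move=> p; exact: cvg_fst.
have ca : continuous (fun p : R * R => p.1 * cos p.2).
  move=> p; apply: cvgM; first exact: cvg_fst.
  by apply: (cvg_comp snd cos); [exact: cvg_snd|exact: continuous_cos].
have cd : continuous (fun p : R * R => p.1 * sin p.2).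
  move=> p; apply: cvgM; first exact: cvg_fst.
  by apply: (cvg_comp snd sin); [exact: cvg_snd|exact: continuous_sin].
move=> p; rewrite /likelihood_form.
apply: cvgB; apply: cvgM; try exact: cvg_cst.
  apply: cvgD; apply: cvgM; try exact: cvg_cst; last exact: cd.
  by apply: cvgN; exact: ca.
apply: cvgD; last first.
  apply: cvgM; last exact: cvg_cst.
  apply: (cvg_comp _ (fun z => z ^+ 2)); [exact: cd|exact: exprn_continuous].
apply: cvgB; apply: cvgM; try exact: cvg_cst.
  apply: (cvg_comp _ (fun z => z ^+ 2)); [exact: ca|exact: exprn_continuous].
apply: cvgM; last exact: cd.
by apply: cvgM; [exact: cvg_cst|exact: ca].
Qed.

End likelihood.

(** * Separation of parameters; measurability and compactness tools *)

Section separation.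
Context {R : realType}.

Lemma cos_le_away (e y : R) : 0 < e -> e <= 1 -> e <= `|y| -> `|y| <= 2 * pi - e ->
  cos y <= cos e.
Proof.
move=> e0 e1 ey ye; rewrite -(cos_norm y); move: `|y| ey ye => z ez ze.
have pi2 := @pi_ge2 R.
have mono u : e <= u -> u <= pi -> cos u <= cos e.
  move=> eu up; rewrite leNgt ltr_cos ?in_itv/= -?leNgt//; lra.
have [zp|pz] := leP z pi; first exact: mono.
rewrite -cosN -(cosD2pi (- z)) -mulr_natl; apply: mono; lra.
Qed.

(** Law of cosines. If the angles are within e, the radii differ by more than e. Otherwise v lies on
    a ray at angle at least e from v0, at distance at least lam0 sin e from it; the margins of mu0
    exclude angles that are close only modulo 2 pi. *)
Lemma parameter_separation (lam0 mu0 lam mu e : R) :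
  0 < e -> e <= 1 -> e <= lam0 -> 0 < lam -> 0 <= mu < 2 * pi ->
  e <= mu0 -> mu0 + e <= 2 * pi ->
  ~ (`|lam - lam0| <= e /\ `|mu - mu0| <= e) ->
  (e * sin e) ^+ 2 <= (lam * cos mu - lam0 * cos mu0) ^+ 2 +
    (lam * sin mu - lam0 * sin mu0) ^+ 2.
Proof.
move=> e0 e1 elam0 lam_gt0 /andP[mu_ge0 mu_lt] emu0 mu0e notin.
have sin0 : 0 < sin e by apply: sin2_gt0; rewrite e0 (le_lt_trans e1)// ltr1n.
have -> : (lam * cos mu - lam0 * cos mu0) ^+ 2 + (lam * sin mu - lam0 * sin mu0) ^+ 2
    = lam ^+ 2 + lam0 ^+ 2 - 2 * lam * lam0 * cos (mu - mu0).
  rewrite cosB -[lam ^+ 2]mulr1 -[lam0 ^+ 2]mulr1.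
  by rewrite -{1}(cos2Dsin2 mu) -{1}(cos2Dsin2 mu0); ring.
have ll : 0 < lam * lam0 by rewrite mulr_gt0// (lt_le_trans e0).
have [le_e|gt_e] := leP `|mu - mu0| e.
  have gt_lam : e < `|lam - lam0|.
    by rewrite ltNge; apply/negP => h; apply: notin.
  apply: (@le_trans _ _ (e ^+ 2)).
    by rewrite exprMn ler_piMr ?sqr_ge0// expr_le1 ?sin_le1// ltW.
  apply: (@le_trans _ _ ((lam - lam0) ^+ 2)).
    by rewrite -[leRHS]real_normK ?num_real// ler_pXn2r ?nnegrE// ltW.
  have := ler_wpM2l (ltW ll) (cos_le1 (mu - mu0)); lra.
have away : cos (mu - mu0) <= cos e.
  apply: cos_le_away => //; first exact: ltW.
  by rewrite ler_norml; apply/andP; split; lra.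
have := ler_wpM2l (ltW ll) away.
have le2 : e ^+ 2 * sin e ^+ 2 <= lam0 ^+ 2 * sin e ^+ 2.
  have e_ge0 := ltW e0; have lam0_ge0 := le_trans e_ge0 elam0.
  by apply: ler_wpM2r; [exact: sqr_ge0|rewrite ler_pXn2r ?nnegrE].
have := sqr_ge0 (lam - lam0 * cos e); have := cos2Dsin2 e.
rewrite exprMn => cs1 sq cosl.
have E : lam0 ^+ 2 = lam0 ^+ 2 * cos e ^+ 2 + lam0 ^+ 2 * sin e ^+ 2.
  by rewrite -mulrDr cs1 mulr1.
lra.
Qed.

End separation.

(** The sets of paths whose preimage under [theta] is measurable form a sigma-algebra on
    [path_space T] containing the generators. *)
Lemma path_measurable_comp {d : measure_display} {Omega : measurableType d}
    {R : realType} (theta : R -> Omega -> R) (T : R) (F : (R -> R) -> R) :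
  (forall t, 0 <= t -> measurable_fun setT (theta t)) ->
  (forall w, path_space T (fun t => theta t w)) -> path_measurable T F ->
  measurable_fun setT (fun w => F (fun t => theta t w)).
Proof.
move=> mth cth mF _ B mB; rewrite setTI.
pose C : set (set (R -> R)) := [set S | measurable [set w | S (fun t => theta t w)]].
have sC : sigma_algebra (path_space T) C.
  split.
  - by rewrite /C /= (_ : [set w | _] = set0)//; apply/seteqP; split.
  - move=> A CA; rewrite /C /= (_ : [set w | _] = ~` [set w | A (fun t => theta t w)]).
      exact: measurableC.
    by apply/seteqP; split => w /=; [move=> []|move=> nA; split].
  - move=> A CA; rewrite /C /= (_ : [set w | _] =
      \bigcup_n [set w | A n (fun t => theta t w)]).
      by apply: bigcupT_measurable => n; exact: CA.
    by apply/seteqP; split => w /= [n _ An]; exists n.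
have gC : [set A | exists t, exists C : set R,
    [/\ t \in `[0, T], measurable C & A = path_space T `&` [set x | C (x t)]]] `<=` C.
  move=> _ [t [D [tT mD ->]]]; rewrite /C /=.
  rewrite (_ : [set w | _] = theta t @^-1` D).
    rewrite -[_ @^-1` _]setTI; apply: mth => //.
    by move: tT; rewrite in_itv/= => /andP[].
  by apply/seteqP; split => w /=; [move=> []|move=> H; split].
have := smallest_sub sC gC (mF B mB); rewrite /C /=.
rewrite (_ : [set w | _] = (fun w => F (fun t => theta t w)) @^-1` B)//.
by apply/seteqP; split => w /=; [move=> []|move=> H; split].
Qed.

(** Supplies one box size for all true parameters in the compact set. *)
Lemma compact_open_margin {R : realType} (K A : set R) :
  compact K -> open A -> K `<=` A ->
  exists2 e : R, 0 < e & forall k y, K k -> `|y - k| <= e -> A y.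
Proof.
move=> /compact_near_coveringP cK oA KA.
have H : \forall e \near 0^'+, forall k, K k -> forall y, `|y - k| <= e -> A y.
  apply: cK => k Kk.
  have [r /= r0 Hr] : nbhs_ball k A.
    by apply/nbhs_ballP; move: oA; rewrite openE; apply; exact: KA.
  have r20 : 0 < r / 2 by rewrite divr_gt0.
  exists ([set k' | `|k - k'| < r / 2], [set e | e < r / 2]) => /=.
    split; first by exists (r / 2).
    by near=> e; near: e; exact: nbhs_right_lt.
  move=> [k' e] /= [kk' er] y yk'; apply: Hr; rewrite /ball/= -(subrKA k').
  rewrite (le_lt_trans (ler_normD _ _))// (splitr r) ltrD// distrC.
  exact: le_lt_trans yk' er.
have : \forall e \near 0^'+, 0 < e /\ forall k, K k -> forall y, `|y - k| <= e -> A y.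
  by apply: filterI => //; exact: nbhs_right_gt.
by move=> /filter_ex[e [e0 He]]; exists e => // k y Kk; exact: He.
Unshelve. all: by end_near.
Qed.

Lemma compact_norm_ub {R : realType} (K : set R) : compact K ->
  exists M : R, forall k, K k -> `|k| <= M.
Proof.
move=> /compact_bounded[M [_ HM]]; exists (M + 1) => k Kk.
by apply: HM => //; rewrite ltrDl.
Qed.

Lemma sup_prob_cvg0 {d : measure_display} {Omega : measurableType d} {R : realType}
    (P : probability Omega R) (K : set R) (E : R -> R -> set Omega) :
  (forall p, 0 < p -> exists T0, forall T k, T0 <= T -> K k ->
    (P (E T k) <= p%:E)%E) ->
  sup_prob P K (E T) @[T --> +oo%R] --> (0 : R).
Proof.
move=> H; apply/cvgrPdist_le => e e0; have [T0 HT0] := H e e0.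
near=> T; have T0T : T0 <= T by near: T; exact: nbhs_pinfty_ge (num_real _).
rewrite sub0r normrN /sup_prob.
have ub : ubound [set fine (P (E T k)) | k in K] e.
  move=> _ [k Kk <-]; have := HT0 T k T0T Kk.
  have := measure_ge0 P (E T k); case: (P (E T k)) => [r| |]//.
  by move=> _ _ /=; exact: ltW.
(* On the empty set [sup] takes its default value 0. *)
have [[k0 Kk0]|K0] := pselect (K !=set0); last first.
  have -> : K = set0 by apply/seteqP; split => k // Kk; apply: K0; exists k.
  by rewrite image_set0 sup0 normr0 ltW.
rewrite ger0_norm; first by apply: ge_sup ub; exists (fine (P (E T k0))), k0.
apply: (@le_trans _ _ (fine (P (E T k0)))); first exact: fine_ge0.
apply: ub_le_sup; last by exists k0.
by exists e.
Unshelve. all: by end_near. Qed.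

(** * Existence and location of the maximizers *)

Section maximizer.
Context {R : realType}.
Variables (x : R -> R) (T sigma : R) (Lam Mu : set R).
Variables (J : R -> R -> (R -> R) -> R) (Zs Zc K lam0 mu0 e : R).
Hypotheses (cx : {within `[0, +oo[, continuous x}) (T_gt0 : 0 < T).
Hypotheses (sigma_gt0 : 0 < sigma) (K_gt0 : 0 < K) (e_gt0 : 0 < e) (e_le1 : e <= 1).
Hypotheses (Lam_gt0 : Lam `<=` [set lam | 0 < lam]).
Hypotheses (Mu_itv : Mu `<=` [set mu | 0 <= mu < 2 * pi]).
Hypotheses (Lam_box : forall lam, `|lam - lam0| <= e -> Lam lam).
Hypotheses (Mu_box : forall mu, `|mu - mu0| <= e -> Mu mu).
Hypothesis J_linear : forall lam mu, Lam lam -> Mu mu ->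
  J lam mu x = - (lam * cos mu) * Zs + (lam * sin mu) * Zc.
Let eta := sigma ^+ 2 / 4 / K * T * (e * sin e) / 4.
Hypothesis info : forall u1 u2, sigma ^+ 2 / 4 * T * (u1 ^+ 2 + u2 ^+ 2) <=
  K * \int[lebesgue_measure]_(t in `[0, T]) (u2 * cos (x t) - u1 * sin (x t)) ^+ 2.
Hypothesis Zs_le : `|Zs - \int[lebesgue_measure]_(t in `[0, T])
  (sin (x t) * drift lam0 mu0 (x t))| <= eta.
Hypothesis Zc_le : `|Zc - \int[lebesgue_measure]_(t in `[0, T])
  (cos (x t) * drift lam0 mu0 (x t))| <= eta.

Local Notation L := (fun l m => log_likelihood sigma T J l m x).

Let lam0_in : Lam lam0. Proof. by apply: Lam_box; rewrite subrr normr0 ltW. Qed.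
Let mu0_in : Mu mu0. Proof. by apply: Mu_box; rewrite subrr normr0 ltW. Qed.

Let LE lam mu : Lam lam -> Mu mu -> L lam mu = likelihood_form x T sigma Zs Zc lam mu.
Proof. by move=> Ll Mm; apply: log_likelihoodE => //; exact: J_linear. Qed.

Lemma log_likelihood_lt_outside lam mu : Lam lam -> Mu mu ->
  ~ (`|lam - lam0| <= e /\ `|mu - mu0| <= e) -> L lam mu < L lam0 mu0.
Proof.
move=> Ll Mm notin; rewrite /= !LE//.
have sin0 : 0 < sin e by apply: sin2_gt0; rewrite e_gt0 (le_lt_trans e_le1)// ltr1n.
have r0 : 0 < e * sin e by rewrite mulr_gt0.
apply: (likelihood_form_lt cx T_gt0 sigma_gt0 K_gt0 r0 (erefl eta)) => //.
(* The end points of the box lie in the parameter sets, which yields the margins of lam0 and mu0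
   that the separation requires. *)
have lamE : `|lam0 - e - lam0| <= e by rewrite addrAC subrr add0r normrN gtr0_norm.
have muE : `|mu0 - e - mu0| <= e by rewrite addrAC subrr add0r normrN gtr0_norm.
have muE' : `|mu0 + e - mu0| <= e by rewrite addrAC subrr add0r gtr0_norm.
have := Lam_gt0 (Lam_box lamE); rewrite /= subr_gt0 => lam0e.
have /andP[mu0e _] := Mu_itv (Mu_box muE); rewrite subr_ge0 in mu0e.
have /andP[_ mu0e'] := Mu_itv (Mu_box muE').
apply: parameter_separation => //; [exact: ltW|exact: Lam_gt0|exact: Mu_itv|exact: ltW].
Qed.

(** [is_mle] constrains the estimator only when a maximizer exists. The parameter sets being open,
    the maximum is taken over the compact box; outside it the likelihood is below its value at the
    centre. *)
Lemma maximizer_exists : exists lam mu, is_maximizer Lam Mu L lam mu.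
Proof.
pose B : set (R * R) := `[lam0 - e, lam0 + e] `*` `[mu0 - e, mu0 + e].
have inB lam mu : B (lam, mu) <-> `|lam - lam0| <= e /\ `|mu - mu0| <= e.
  by rewrite /B /= !in_itv/= !ler_distl.
have B0 : B (lam0, mu0) by rewrite inB !subrr normr0 ltW.
have cB : compact B by apply: compact_setX; exact: segment_compact.
have cL := continuous_subspaceT (@continuous_likelihood_form _ x T sigma Zs Zc) (A := B).
have [[lam mu] /set_mem/inB[hl hm] max] := compact_EVT_max (ex_intro _ _ B0) cB cL.
exists lam, mu; split; [exact: Lam_box|exact: Mu_box|] => lam' mu' Ll Mm.
have LB l m : `|l - lam0| <= e /\ `|m - mu0| <= e -> L l m <= L lam mu.
  move=> [hl' hm']; rewrite /= (LE (Lam_box hl') (Mu_box hm')) (LE (Lam_box hl) (Mu_box hm)).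
  by apply: (max (l, m)); rewrite inE; exact/inB.
have [/LB//|/(log_likelihood_lt_outside Ll Mm)/ltW] :=
  pselect (`|lam' - lam0| <= e /\ `|mu' - mu0| <= e).
by move/le_trans; apply; apply: LB; rewrite !subrr normr0 ltW.
Qed.

Lemma maximizer_in_box lam mu : is_maximizer Lam Mu L lam mu ->
  `|lam - lam0| <= e /\ `|mu - mu0| <= e.
Proof.
move=> [Ll Mm max]; apply: contrapT => /(log_likelihood_lt_outside Ll Mm).
by rewrite ltNge => /negP; apply; exact: max.
Qed.

End maximizer.

(** * Consistency *)

Section consistency.
Context {d : measure_display} {Omega : measurableType d} {R : realType}.
Variables (P : probability Omega R) (W : R -> Omega -> R).
Variables (sigma : R) (Lam Mu : set R) (Theta : R -> R -> R -> Omega -> R).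
Hypotheses (BM : is_brownian_motion P W) (sigma_gt0 : 0 < sigma).
Hypotheses (oLam : open Lam) (Lam_gt0 : Lam `<=` [set lam | 0 < lam]).
Hypotheses (oMu : open Mu) (Mu_itv : Mu `<=` [set mu | 0 <= mu < 2 * pi]).
Hypothesis VM : forall lam mu, Lam lam -> Mu mu ->
  is_von_mises_process P W lam mu sigma (Theta lam mu).

Lemma path_space_von_mises lam mu T w : Lam lam -> Mu mu ->
  path_space T (fun t => Theta lam mu t w).
Proof.
move=> Ll Mm; have [_ cth _ _] := VM Ll Mm.
apply: continuous_subspaceW (cth w) => t /=.
by rewrite !in_itv/= => /andP[->].
Qed.

(** Four exceptional events: a null set where [J] is not linear, failure of the information bound,
    and failure of the two score bounds at 16 sigma^2 T / eta^2 each. [K] and [eta] see lam0 only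
    through [L], which makes the bound uniform. *)
Lemma mle_outer_le T lamhat muhat lam0 mu0 e L p :
  0 < T -> is_mle P sigma T Lam Mu Theta lamhat muhat ->
  0 < e -> e <= 1 -> (forall lam, `|lam - lam0| <= e -> Lam lam) ->
  (forall mu, `|mu - mu0| <= e -> Mu mu) -> lam0 <= L ->
  32 <= sigma ^+ 2 * T -> 0 < p ->
  let K := 2 * sigma ^+ 2 + 2 * L ^+ 2 / sigma ^+ 2 in
  let eta := sigma ^+ 2 / 4 / K * T * (e * sin e) / 4 in
  outer_le P [set w | ~ (`|lamhat (fun t => Theta lam0 mu0 t w) - lam0| <= e /\
      `|muhat (fun t => Theta lam0 mu0 t w) - mu0| <= e)]
    (2048 / (sigma ^+ 2 * T) + 32 * sigma ^+ 2 * T / eta ^+ 2 + 3 * p).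
Proof.
move=> T0 [_ _ _ [J [_ J_ito J_cont] mle]] e0 e1 Lbox Mbox lam0L T32 p0 K eta.
have Ll0 : Lam lam0 by apply: Lbox; rewrite subrr normr0 ltW.
have Mm0 : Mu mu0 by apply: Mbox; rewrite subrr normr0 ltW.
have lam0_gt0 : 0 < lam0 := Lam_gt0 Ll0.
have L0 : 0 < L by exact: lt_le_trans lam0L.
have K0 : 0 < K by rewrite addr_gt0// ?divr_gt0 ?mulr_gt0 ?exprn_gt0.
have sin0 : 0 < sin e by apply: sin2_gt0; rewrite e0 (le_lt_trans e1)// ltr1n.
have eta0 : 0 < eta.
  by rewrite /eta !mulr_gt0 ?invr_gt0 ?exprn_gt0.
have VM0 := VM Ll0 Mm0; have [mth cth _ _] := VM0.
pose Jw lam mu w := J lam mu (fun t => Theta lam0 mu0 t w).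
have J_cv lam mu : Lam lam -> Mu mu ->
    cv_outer P (riemann_sum (Theta lam0 mu0) T (drift lam mu)) (Jw lam mu).
  move=> Ll Mm; apply: (ito_integral_cv T0 _ mth (J_ito _ _ _ _ Ll0 Mm0 Ll Mm)).
  move=> t t0; apply: measurableT_comp (mth t t0).
  by apply: continuous_measurable_fun; exact: continuous_drift.
have Jw_cont w : {within Lam `*` Mu, continuous (fun p : R * R => Jw p.1 p.2 w)}.
  by apply: J_cont; exact: path_space_von_mises.
have [Zs [Zc [cvs cvc J_lin]]] := drift_integral_linear oLam oMu J_cv Jw_cont Ll0 lam0_gt0 Mm0.
have os := score_ub BM lam0_gt0 sigma_gt0 T0 VM0 eta0 p0 (@sin_lipschitz R)
  (@continuous_sin R) (@sin_max R) cvs.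
have oc := score_ub BM lam0_gt0 sigma_gt0 T0 VM0 eta0 p0 (@cos_lipschitz R)
  (@continuous_cos R) (@cos_max R) cvc.
have oi := information_bound_outer_le BM lam0_gt0 sigma_gt0 T0 VM0 lam0L T32 p0.
apply: outer_leW (outer_leU J_lin (outer_leU oi (outer_leU os oc))); last first.
  have -> : 32 * sigma ^+ 2 * T / eta ^+ 2 =
    16 * sigma ^+ 2 * T / eta ^+ 2 + 16 * sigma ^+ 2 * T / eta ^+ 2.
    by rewrite -mulrDl -!mulrDl -natrD.
  by set A := 2048 / _; set B := 16 * _ * _ / _; lra.
move=> w /= Hw; apply: contrapT => /not_orP[/contrapT Jl /not_orP[/contrapT info]].
move=> /not_orP[/negP + /negP]; rewrite -!leNgt => Zs_le Zc_le; apply: Hw.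
have xT : path_space T (fun t => Theta lam0 mu0 t w) by exact: path_space_von_mises.
have ex := maximizer_exists (cth w) T0 sigma_gt0 K0 e0 e1 Lam_gt0 Mu_itv Lbox Mbox
  Jl info Zs_le Zc_le.
exact: (maximizer_in_box (cth w) T0 sigma_gt0 K0 e0 e1 Lam_gt0 Mu_itv Lbox Mbox
  Jl info Zs_le Zc_le (mle _ xT ex)).
Qed.

(** Both parameters range over compact sets, so that a singleton for one gives the uniform statement
    for the other. As [eta] is proportional to T, the bound is C / T plus an arbitrarily small term,
    with the same C for all parameters in the compact sets. *)
Lemma mle_uniformly_consistent (lamhat muhat : R -> (R -> R) -> R)
    (Klam Kmu : set R) (eps del : R) :
  (forall T, 0 < T -> is_mle P sigma T Lam Mu Theta (lamhat T) (muhat T)) ->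
  compact Klam -> Klam `<=` Lam -> compact Kmu -> Kmu `<=` Mu ->
  0 < eps -> 0 < del ->
  exists2 T0, 0 < T0 & forall T lam mu, T0 <= T -> Klam lam -> Kmu mu ->
    outer_le P [set w | ~ (`|lamhat T (fun t => Theta lam mu t w) - lam| <= eps /\
      `|muhat T (fun t => Theta lam mu t w) - mu| <= eps)] del.
Proof.
move=> mle cKl KlL cKm KmM eps0 del0.
have [e1 e1_gt0 He1] := compact_open_margin cKl oLam KlL.
have [e2 e2_gt0 He2] := compact_open_margin cKm oMu KmM.
have [M HM] := compact_norm_ub cKl.
(* The box must stay in the parameter sets and within eps; e <= 1 serves the trigonometric
   bounds. *)
pose e := Num.min (Num.min e1 e2) (Num.min eps 1).
have e0 : 0 < e by rewrite !lt_min e1_gt0 e2_gt0 eps0 ltr01.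
have ee1 : e <= e1 by rewrite /e !ge_min lexx.
have ee2 : e <= e2 by rewrite /e !ge_min lexx orbT.
have eeps : e <= eps by rewrite /e !ge_min lexx !orbT.
have e_le1 : e <= 1 by rewrite /e !ge_min lexx !orbT.
have sin0 : 0 < sin e by apply: sin2_gt0; rewrite e0 (le_lt_trans e_le1)// ltr1n.
pose L := `|M| + 1.
have L0 : 0 < L by rewrite ltr_wpDl.
have s20 : 0 < sigma ^+ 2 by rewrite exprn_gt0.
pose K := 2 * sigma ^+ 2 + 2 * L ^+ 2 / sigma ^+ 2.
have K0 : 0 < K by rewrite addr_gt0// ?divr_gt0 ?mulr_gt0 ?exprn_gt0.
(* This is [eta / T]. *)
pose kap := sigma ^+ 2 / 4 / K * (e * sin e) / 4.
have kap0 : 0 < kap by rewrite /kap !mulr_gt0 ?invr_gt0.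
pose C := 2048 / sigma ^+ 2 + 32 * sigma ^+ 2 / kap ^+ 2.
have C0 : 0 < C.
  apply: addr_gt0; apply: divr_gt0; [by rewrite ltr0n|by []| |by rewrite exprn_gt0].
  by apply: mulr_gt0; rewrite ?ltr0n.
exists (Num.max (32 / sigma ^+ 2) (2 * C / del)).
  by rewrite lt_max divr_gt0.
move=> T lam mu; rewrite ge_max => /andP[T32 TC] Kl Km.
have T0 : 0 < T by rewrite (lt_le_trans _ T32)// divr_gt0.
have T32' : 32 <= sigma ^+ 2 * T by rewrite mulrC -ler_pdivrMr.
have lamL : lam <= L.
  rewrite (le_trans (ler_norm _))// (le_trans (HM _ Kl))//.
  by rewrite (le_trans (ler_norm _))// lerDl.
(* The three small terms make up del / 2; the choice of T0 keeps C / T below the other half. *)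
have del6 : 0 < del / 6 by rewrite divr_gt0.
have Lbox l : `|l - lam| <= e -> Lam l by move=> h; apply: (He1 lam) => //; exact: le_trans ee1.
have Mbox m : `|m - mu| <= e -> Mu m by move=> h; apply: (He2 mu) => //; exact: le_trans ee2.
apply: outer_leW (mle_outer_le T0 (mle T T0) e0 e_le1 Lbox Mbox lamL T32' del6).
  move=> w /= Hw [h1 h2]; apply: Hw; split; exact: le_trans eeps.
have boundE (a b k s : R) : k != 0 -> s != 0 -> a / (sigma ^+ 2 * T) +
    b * sigma ^+ 2 * T / (sigma ^+ 2 / 4 / k * T * (e * s) / 4) ^+ 2 + 3 * (del / 6) =
    (a / sigma ^+ 2 + b * sigma ^+ 2 / (sigma ^+ 2 / 4 / k * (e * s) / 4) ^+ 2) / T +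
    del / 2.
  move=> k0 s0; field.
  by rewrite k0 s0 !gt_eqF.
rewrite boundE ?gt_eqF// -/kap -/C.
have : C / T <= del / 2.
  rewrite ler_pdivrMr// mulrC -ler_pdivrMr ?divr_gt0//.
  by rewrite (le_trans _ TC)// le_eqVlt; apply/orP; left; apply/eqP; field; rewrite gt_eqF.
lra.
Qed.

End consistency.

(** No limit in T is involved: at each fixed T > 0 the quadratic variation is almost surely sigma^2
    T. *)
Lemma sigma_estimator_ae {d : measure_display} {Omega : measurableType d} {R : realType}
    (P : probability Omega R) (W : R -> Omega -> R) (lam mu sigma T : R)
    (theta : R -> Omega -> R) (Q sighat : (R -> R) -> R) :
  is_brownian_motion P W -> 0 < lam -> 0 < sigma -> 0 < T ->
  is_von_mises_process P W lam mu sigma theta ->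
  is_quadratic_variation P T theta (fun w => Q (fun t => theta t w)) ->
  (forall w, sighat (fun t => theta t w) = Num.sqrt (Q (fun t => theta t w) / T)) ->
  measurable_fun setT (fun w => sighat (fun t => theta t w)) /\
  outer_le P [set w | sighat (fun t => theta t w) <> sigma] 0.
Proof.
move=> BM lam0 sigma0 T0 VM qv sigE; have [mth _ _ _] := VM.
have [mQ _] := qv; split.
  rewrite (_ : (fun w => _) = Num.sqrt \o (fun w => Q (fun t => theta t w) / T)); last first.
    by apply/funext => w; rewrite sigE.
  apply: measurableT_comp; last exact: measurable_funM.
  exact: continuous_measurable_fun (@sqrt_continuous R).
have H := quadratic_variation_limit BM lam0 sigma0 T0 VM (quadratic_variation_cv T0 mth qv).
apply: outer_leW H => // w /= + QE; apply.
by rewrite sigE QE mulfK ?gt_eqF// sqrtr_sqr gtr0_norm.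
Qed.

Theorem theorem3p1 (R : realType) (d : measure_display)
    (Omega : measurableType d) (P : probability Omega R)
    (W : R -> Omega -> R) (theta : R -> R -> R -> R -> Omega -> R)
    (Lam Mu Sig : set R) (Klam Kmu Ksig : set R)
    (lamhat muhat sighat : R -> (R -> R) -> R) :
  is_brownian_motion P W ->
  open Lam -> Lam `<=` [set lam | 0 < lam] ->
  open Mu -> Mu `<=` [set mu | 0 <= mu < 2 * pi] ->
  open Sig -> Sig `<=` [set sigma | 0 < sigma] ->
  compact Klam -> Klam `<=` Lam ->
  compact Kmu -> Kmu `<=` Mu ->
  compact Ksig -> Ksig `<=` Sig ->
  (forall lam mu sigma, Lam lam -> Mu mu -> Sig sigma ->
     is_von_mises_process P W lam mu sigma (theta lam mu sigma)) ->
  (forall sigma T, Sig sigma -> 0 < T ->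
     is_mle P sigma T Lam Mu (fun lam mu => theta lam mu sigma)
       (lamhat T) (muhat T)) ->
  (forall T, 0 < T ->
     is_sigma_estimator P T Lam Mu Sig theta (sighat T)) ->
  forall eps : R, 0 < eps ->
  [/\ forall mu sigma, Mu mu -> Sig sigma ->
        sup_prob P Klam (fun lam =>
          [set w | eps < `|lamhat T (fun t => theta lam mu sigma t w) - lam|])
        @[T --> +oo%R] --> (0 : R),
      forall lam sigma, Lam lam -> Sig sigma ->
        sup_prob P Kmu (fun mu =>
          [set w | eps < `|muhat T (fun t => theta lam mu sigma t w) - mu|])
        @[T --> +oo%R] --> (0 : R)
    & forall lam mu, Lam lam -> Mu mu ->
        sup_prob P Ksig (fun sigma =>
          [set w | eps < `|sighat T (fun t => theta lam mu sigma t w) - sigma|])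
        @[T --> +oo%R] --> (0 : R)].
Proof.
move=> BM oLam Lam0 oMu Mu0 oSig Sig0 cKl KlL cKm KmM cKs KsS VM mle sig eps eps0.
(* Measurability of the event turns the outer bounds into bounds on [P]. *)
have mpath (F : R -> (R -> R) -> R) lam mu sigma T c : Lam lam -> Mu mu -> Sig sigma ->
    path_measurable T (F T) ->
    measurable [set w | eps < `|F T (fun t => theta lam mu sigma t w) - c|].
  move=> Ll Mm Ss mF; apply: measurable_norm_gt; apply: measurable_funB => //.
  have [mth _ _ _] := VM _ _ _ Ll Mm Ss.
  apply: path_measurable_comp mF => // w.
  exact: (path_space_von_mises (fun l m Ll Mm => VM l m sigma Ll Mm Ss)).
split.
- move=> mu sigma Mm Ss; apply: sup_prob_cvg0 => p p0.
  have mu_sub : [set mu] `<=` Mu by move=> _ ->.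
  have [T0 T0_gt0 HT0] := mle_uniformly_consistent BM (Sig0 _ Ss) oLam Lam0 oMu Mu0
    (fun l m Ll Mm => VM l m sigma Ll Mm Ss) (fun T => mle sigma T Ss)
    cKl KlL (@compact_set1 _ mu) mu_sub eps0 p0.
  exists T0 => T lam T0T Kl; have T_gt0 := lt_le_trans T0_gt0 T0T.
  have [mlam _ _ _] := mle _ _ Ss T_gt0.
  apply: outer_le_prob; first exact: mpath (KlL _ Kl) Mm Ss mlam.
  apply: outer_leW (HT0 T lam mu T0T Kl erefl) => // w /=.
  by rewrite ltNge => /negP H [/H].
- move=> lam sigma Ll Ss; apply: sup_prob_cvg0 => p p0.
  have lam_sub : [set lam] `<=` Lam by move=> _ ->.
  have [T0 T0_gt0 HT0] := mle_uniformly_consistent BM (Sig0 _ Ss) oLam Lam0 oMu Mu0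
    (fun l m Ll Mm => VM l m sigma Ll Mm Ss) (fun T => mle sigma T Ss)
    (@compact_set1 _ lam) lam_sub cKm KmM eps0 p0.
  exists T0 => T mu T0T Km; have T_gt0 := lt_le_trans T0_gt0 T0T.
  have [_ mmu _ _] := mle _ _ Ss T_gt0.
  apply: outer_le_prob; first exact: mpath Ll (KmM _ Km) Ss mmu.
  apply: outer_leW (HT0 T lam mu T0T erefl Km) => // w /=.
  by rewrite ltNge => /negP H [_ /H].
- move=> lam mu Ll Mm; apply: sup_prob_cvg0 => p p0.
  (* The estimator is almost surely exact at every positive time, so any positive threshold will
     do. *)
  exists 1 => T sigma T1 Ks; have T_gt0 : 0 < T by exact: lt_le_trans T1.
  have Ss := KsS _ Ks; have [Q [_ qv sigE]] := sig T T_gt0.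
  have sigE' w : sighat T (fun t => theta lam mu sigma t w) =
      Num.sqrt (Q (fun t => theta lam mu sigma t w) / T).
    apply: sigE.
    exact: (path_space_von_mises (fun l m Ll Mm => VM l m sigma Ll Mm Ss)).
  have [msig osig] := sigma_estimator_ae BM (Lam0 _ Ll) (Sig0 _ Ss) T_gt0
    (VM _ _ _ Ll Mm Ss) (qv _ _ _ Ll Mm Ss) sigE'.
  apply: outer_le_prob.
    by apply: measurable_norm_gt; exact: measurable_funB.
  apply: outer_leW osig; last exact: ltW.
  by move=> w /= + wE; rewrite wE subrr normr0 ltNge (ltW eps0).
Qed.
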